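(* Let $n\ge3$, $\mu_1,\mu_2,\beta>0$, $p=2q+1$ with $\frac{n}{n-2}<p<\frac{n+2}{n-2}$. (3) If $n\ge4$, system (S) has no positive semi-singular solution at $\infty$. (4) Suppose $n\ge4$, or $n=3$ and (S) has no positive semi-singular solution at $\infty$. Then for every positive solution $(u,v)$ of (S), either there is $C_3>0$ with $u(x),v(x)\le C_3|x|^{-(n-2)}$ for all $|x|\ge1$, or there exist constants $0<C_1\le C_2$ with $C_1|x|^{-\frac{2}{p-1}}\le u(x),v(x)\le C_2|x|^{-\frac{2}{p-1}}$ for all $|x|\ge1$.
   Context: System (S): $-\Delta u=\mu_1u^{2q+1}+\beta u^qv^{q+1}$, $-\Delta v=\mu_2v^{2q+1}+\beta v^qu^{q+1}$ in $\mathbb{R}^n\setminus\{0\}$; a positive solution is a pair $u,v\in C^2(\mathbb{R}^n\setminus\{0\})$, $u,v>0$, solving (S). A positive solution $(u,v)$ is semi-singular at $\infty$ if there are constants $C,C_1,C_2>0$ such that, for $|x|$ large, either $u(x)\le C|x|^{-(n-2)}$ and $C_1|x|^{-\frac2{p-1}}\le v(x)\le C_2|x|^{-\frac2{p-1}}$, or the same holds with $u$ and $v$ interchanged. *)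

(* Defs.v *)
From mathcomp Require Import ssreflect ssrbool eqtype ssrnat fintype bigop.
From Stdlib Require Import Reals.
Set Implicit Arguments.
Unset Strict Implicit.
Open Scope R_scope.

Definition point (n : nat) := 'I_n -> R.

Definition sumR (n : nat) (F : 'I_n -> R) : R := \big[Rplus/0]_(i < n) F i.

Definition norm (n : nat) (x : point n) : R := sqrt (sumR (fun i => x i ^ 2)).

Definition psub (n : nat) (x y : point n) : point n := fun j => x j - y j.

Definition upd (n : nat) (x : point n) (i : 'I_n) (t : R) : point n :=
  fun j => if j == i then x j + t else x j.

Definition has_partial (n : nat) (f : point n -> R) (i : 'I_n) (x : point n) (l : R) : Prop :=
  derivable_pt_lim (fun t => f (upd x i t)) 0 l.

Definition cont_at (n : nat) (g : point n -> R) (x : point n) : Prop :=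
  forall eps, 0 < eps -> exists delta, 0 < delta /\
    forall y, norm (psub y x) < delta -> Rabs (g y - g x) < eps.

Definition C2_punct_with (n : nat) (f : point n -> R)
  (D1 : 'I_n -> point n -> R) (D2 : 'I_n -> 'I_n -> point n -> R) : Prop :=
  forall x, norm x <> 0 ->
    cont_at f x /\
    forall i, has_partial f i x (D1 i x) /\ cont_at (D1 i) x /\
      forall j, has_partial (D1 i) j x (D2 i j x) /\ cont_at (D2 i j) x.

Definition laplacian_with (n : nat) (D2 : 'I_n -> 'I_n -> point n -> R) (x : point n) : R :=
  sumR (fun i => D2 i i x).

Definition pos_solution (n : nat) (q mu1 mu2 beta : R) (u v : point n -> R) : Prop :=
  exists Du D2u Dv D2v,
    C2_punct_with u Du D2u /\ C2_punct_with v Dv D2v /\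
    forall x, norm x <> 0 ->
      0 < u x /\ 0 < v x /\
      - laplacian_with D2u x =
        mu1 * Rpower (u x) (2 * q + 1) + beta * Rpower (u x) q * Rpower (v x) (q + 1) /\
      - laplacian_with D2v x =
        mu2 * Rpower (v x) (2 * q + 1) + beta * Rpower (v x) q * Rpower (u x) (q + 1).

Definition semi_sing_pair (n : nat) (p : R) (u v : point n -> R) : Prop :=
  exists C C1 C2 R0, 0 < C /\ 0 < C1 /\ 0 < C2 /\
    forall x, R0 <= norm x ->
      u x <= C * Rpower (norm x) (- (INR n - 2)) /\
      C1 * Rpower (norm x) (- (2 / (p - 1))) <= v x /\
      v x <= C2 * Rpower (norm x) (- (2 / (p - 1))).

Definition semi_singular_at_infty (n : nat) (p : R) (u v : point n -> R) : Prop :=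
  semi_sing_pair p u v \/ semi_sing_pair p v u.

(* Main.v *)
(* Both nonlinearities increase in [u] and [v] and are subcritical, so the method of moving spheres applies to every
   sphere around a nonzero centre [x] with radius smaller than [|x|]: the Kelvin transforms stay below [u] and [v]
   outside the sphere. Since the Kelvin transforms are strict subsolutions there, the maximum principle with the
   barriers [|y|^(2-n)] and [|y-x|^(2-n)] suffices to start and to continue. Spheres that exchange two given points of
   equal norm, with centre going to infinity, show that [u] and [v] are radial.
   In the variable [t = ln r] the functions [r^(2/(p-1)) u] and [r^(2/(p-1)) v] solve an autonomous system with
   negative damping. They are bounded, the energy is monotone, and Barbalat's lemma shows that they approach the
   equilibria. Levels close to 0 are not equilibria because [q <> 1] in every dimension, which leaves four
   alternatives: both functions tend to 0, then at the rate of the fundamental solution; both stay away from 0; or exactly one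
   tends to 0. The last case is semi-singular if [q > 1], and for [q < 1], that is [n >= 4], it is excluded because
   the sublinear coupling term would make the small component oscillate. *)
From HB Require Import structures.
From mathcomp Require Import ssreflect ssrfun ssrbool eqtype ssrnat seq fintype bigop.
From Stdlib Require Import Reals Lra FunctionalExtensionality ClassicalEpsilon.
From Coquelicot Require Import Coquelicot.
Require Import Defs.
Set Implicit Arguments.
Unset Strict Implicit.
Open Scope R_scope.

(** * Calculus on the line *)

(** The two ends of the domain shape the proof: the solution may be singular at the puncture, and no
    decay is assumed at infinity. A sphere whose radius is below the distance from its centre to 0
    reflects the exterior into a ball that avoids the puncture, so only [u] and [v] themselves,
    never their Kelvin transforms, can misbehave there; nonnegativity of the gap and a small
    multiple of the fundamental solution at 0 deal with that point. Infinity is brought back by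
    inversion: after multiplication by [|y - a|^(n-2)], an escaping sequence is read off at its
    bounded image. With [al = 2/(p-1) = 1/q], the condition [p > n/(n-2)] is [al < n-2], which makes
    the linear coefficient positive, and [p < (n+2)/(n-2)] is [n-2 < 2 al], which makes the damping
    negative. For [q < 1] the power [a^q] has unbounded slope at 0, so derivatives are bounded
    relative to the function, as in [|U'| <= C U]. The data are partial derivatives along coordinate
    lines; differentiability along curves has to be obtained from their continuity. *)

Lemma mvt (f df : R -> R) a b : a < b ->
  (forall x, a <= x <= b -> is_derive f x (df x)) ->
  exists c, a < c < b /\ f b - f a = df c * (b - a).
Proof.
move=> ab H.
have [c [E Hc]] : exists c, f b - f a = df c * (b - a) /\ a < c < b.
  by apply: MVT_cor2 => // c Hc; apply/is_derive_Reals/H.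
by exists c.
Qed.

Lemma derive_nondecr (f df : R -> R) a b : a <= b ->
  (forall x, a <= x <= b -> is_derive f x (df x)) ->
  (forall x, a <= x <= b -> 0 <= df x) -> f a <= f b.
Proof.
case=> [ab|->]; last lra.
move=> H1 H2; have [c [Hc E]] := mvt ab H1.
have := H2 c; nra.
Qed.

Lemma is_derive_Rpower (f : R -> R) (df s t : R) : 0 < f t -> is_derive f t df ->
  is_derive (fun x => Rpower (f x) s) t (s * (df / f t) * Rpower (f t) s).
Proof.
move=> f0 Hf; rewrite /Rpower.
evar_last.
  apply: (is_derive_comp exp); first exact: is_derive_exp.
  apply: is_derive_scal; apply: (is_derive_comp ln); last exact: Hf.
  exact: is_derive_ln.
by rewrite /scal /= /mult /=; field; lra.
Qed.

Lemma is_derive_cont (f : R -> R) x l : is_derive f x l -> continuity_pt f x.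
Proof.
by move=> H; apply/continuity_pt_filterlim; apply: ex_derive_continuous; exists l.
Qed.

Lemma is_derive_cont_eps (f : R -> R) x l : is_derive f x l ->
  forall eps, 0 < eps -> exists d, 0 < d /\ forall y, Rabs (y - x) < d -> Rabs (f y - f x) < eps.
Proof.
move=> H eps e0.
have /continuity_pt_locally /(_ (mkposreal eps e0)) [d Hd] := is_derive_cont H.
exists d; split; first exact: cond_pos.
by move=> y Hy; exact: Hd.
Qed.

Definition tends0 (f : R -> R) := forall eps, 0 < eps -> exists T, forall t, T <= t -> Rabs (f t) < eps.

Lemma tends0_ext f g : (forall t, f t = g t) -> tends0 f -> tends0 g.
Proof. by move=> E H eps e0; have [T HT] := H eps e0; exists T => t Ht; rewrite -E; exact: HT. Qed.

Lemma tends0_scal k f : tends0 f -> tends0 (fun t => k * f t).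
Proof.
move=> H eps e0.
have k1 : 0 < Rabs k + 1 by have := Rabs_pos k; lra.
have [T HT] := H (eps / (Rabs k + 1)) (Rdiv_lt_0_compat _ _ e0 k1).
exists T => t Ht; rewrite Rabs_mult; have := HT t Ht.
move/(Rmult_lt_compat_l _ _ _ k1); rewrite /Rdiv -(Rmult_comm (/ _)) -Rmult_assoc Rinv_r; last lra.
by have := Rabs_pos (f t); nra.
Qed.

Lemma tends0_plus f g : tends0 f -> tends0 g -> tends0 (fun t => f t + g t).
Proof.
move=> Hf Hg eps e0.
have [|T HT] := Hf (eps / 2); first lra.
have [|S HS] := Hg (eps / 2); first lra.
exists (Rmax T S) => t Ht.
have := HT t (Rle_trans _ _ _ (Rmax_l T S) Ht).
have := HS t (Rle_trans _ _ _ (Rmax_r T S) Ht).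
by have := Rabs_triang (f t) (g t); lra.
Qed.

(** A value [|f1 t| >= eps] persists at size [eps / 2] on an interval of length
    [h = eps / (2 * B1)], because the slope of [f1] is at most [B1]. Over that interval [f] moves by
    at least [h * eps / 2], too much for a function within [h * eps / 4] of its limit. *)
Lemma barbalat (f f1 f2 : R -> R) l B T0 :
  (forall t, is_derive f t (f1 t)) -> (forall t, is_derive f1 t (f2 t)) ->
  (forall t, T0 <= t -> Rabs (f2 t) <= B) ->
  tends0 (fun t => f t - l) -> tends0 f1.
Proof.
move=> H1 H2 HB Hl eps e0.
pose B1 := Rmax B 1.
have HB1 : forall t, T0 <= t -> Rabs (f2 t) <= B1.
  by move=> t Ht; apply: Rle_trans (HB t Ht) (Rmax_l _ _).
have B1p : 1 <= B1 := Rmax_r _ _.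
pose h := eps / (2 * B1).
have hp : 0 < h by apply: Rdiv_lt_0_compat; lra.
have hB : B1 * h = eps / 2 by rewrite /h; field; lra.
have [|T HT] := Hl (h * eps / 4); first nra.
exists (Rmax T0 T) => t Ht.
have t1 : T0 <= t := Rle_trans _ _ _ (Rmax_l _ _) Ht.
have t2 : T <= t := Rle_trans _ _ _ (Rmax_r _ _) Ht.
case: (Rlt_le_dec (Rabs (f1 t)) eps) => // Hbad; exfalso.
have Hth : t < t + h by lra.
have [c [Hc Ec]] := mvt Hth (fun x _ => H1 x).
have Htc : t < c by lra.
have [d [Hd Ed]] := mvt Htc (fun x _ => H2 x).
have A1 := HT t t2.
have A2 : Rabs (f (t + h) - l) < h * eps / 4 by apply: HT; lra.
have A3 : Rabs (f2 d) <= B1 by apply: HB1; lra.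
have A4 : Rabs (f1 c - f1 t) <= eps / 2.
  rewrite Ed Rabs_mult -hB; apply: Rmult_le_compat => //; try exact: Rabs_pos.
  by rewrite Rabs_right; lra.
have A5 : Rabs (f1 c) * h < h * eps / 2.
  have -> : Rabs (f1 c) * h = Rabs (f (t + h) - f t).
    by rewrite Ec Rabs_mult; congr (_ * _); rewrite Rabs_right; lra.
  have := Rabs_triang (f (t + h) - l) (- (f t - l)); rewrite Rabs_Ropp.
  have -> : f (t + h) - l + - (f t - l) = f (t + h) - f t by ring.
  lra.
have A6 : Rabs (f1 c) < eps / 2 by nra.
have := Rabs_triang (f1 c) (- (f1 c - f1 t)); rewrite Rabs_Ropp.
have -> : f1 c + - (f1 c - f1 t) = f1 t by ring.
lra.
Qed.

Lemma nondecr_bounded_lim (E : R -> R) T0 M :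
  (forall s t, T0 <= s -> s <= t -> E s <= E t) -> (forall t, T0 <= t -> E t <= M) ->
  exists l, tends0 (fun t => E t - l).
Proof.
move=> mono bd.
have [||l [Hub Hl]] := completeness (fun y => exists t, T0 <= t /\ y = E t).
- by exists M => y [t [Ht ->]]; exact: bd.
- by exists (E T0), T0; split; lra.
exists l => eps e0.
have [t [Ht1 Ht2]] : exists t, T0 <= t /\ l - eps < E t.
  apply: NNPP => H.
  suff : l <= l - eps by lra.
  apply: Hl => y [t [Ht ->]]; apply: Rnot_lt_le => Hlt; apply: H; by exists t.
exists t => s Hs.
have := mono t s Ht1 Hs.
have : E s <= l by apply: Hub; exists s; split => //; lra.
by move=> *; apply: Rabs_def1; lra.
Qed.

(* [U1 / U] solves a Riccati inequality without equilibrium, so the arctangent of its normalization decreases at a fixed rate. *)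
Lemma oscillation (U U1 U2 : R -> R) d K T :
  d ^ 2 < 4 * K -> (forall t, 0 < U t) ->
  (forall t, is_derive U t (U1 t)) -> (forall t, is_derive U1 t (U2 t)) ->
  (forall t, T <= t -> U2 t - d * U1 t + K * U t <= 0) -> False.
Proof.
move=> HK U0 H1 H2 Hineq.
pose w := sqrt (K - d ^ 2 / 4).
have w2 : w * w = K - d ^ 2 / 4 by apply: sqrt_sqrt; lra.
have w0 : 0 < w by apply: sqrt_lt_R0; lra.
pose z t := (U1 t / U t - d / 2) / w.
pose dz t := ((U2 t * U t - U1 t * U1 t) / (U t ^ 2)) / w.
have Hz : forall t, is_derive z t (dz t).
  move=> t; rewrite /z /dz; have Ut := U0 t.
  have := H1 t; have := H2 t => D2 D1.
  evar_last.
    apply: (is_derive_ext (fun t => / w * (U1 t / U t - d / 2))).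
      by move=> s; rewrite Rmult_comm.
    apply: is_derive_scal; apply: is_derive_minus; last exact: is_derive_const.
    apply: is_derive_div; [exact: D2 | exact: D1 | lra].
  rewrite /minus /plus /opp /zero /=; field; lra.
pose f t := - atan (z t) - w * t.
have Hf : forall t, T <= t -> 0 <= - (/ (1 + (z t) ^ 2) * dz t) - w.
  move=> t Ht; have Ut := U0 t; have := Hineq t Ht => Hi.
  have s2 : 0 < 1 + (z t) ^ 2 by have := pow2_ge_0 (z t); lra.
  suff : 0 <= (- dz t - w * (1 + (z t) ^ 2)) * / (1 + z t ^ 2).
    suff -> : (- dz t - w * (1 + (z t) ^ 2)) * / (1 + z t ^ 2) = - (/ (1 + (z t) ^ 2) * dz t) - w by [].
    by field; lra.
  apply: Rmult_le_pos; last by apply: Rlt_le; apply: Rinv_0_lt_compat.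
  have -> : - dz t - w * (1 + z t ^ 2) =
     ((- (U2 t * U t - U1 t * U1 t)) / U t ^ 2 - (w * w + (U1 t / U t - d / 2) ^ 2)) / w.
    by rewrite /dz /z; field; lra.
  apply: Rdiv_le_0_compat => //.
  have -> : - (U2 t * U t - U1 t * U1 t) / U t ^ 2 - (w * w + (U1 t / U t - d / 2) ^ 2)
     = - (U2 t - d * U1 t + K * U t) / U t.
    by rewrite w2; field; lra.
  by apply: Rdiv_le_0_compat; lra.
pose t1 := Rmax T 0.
have T1 : T <= t1 := Rmax_l _ _.
have t12 : t1 <= t1 + 2 * PI / w by have := PI_RGT_0 => pi0; have := Rdiv_lt_0_compat (2 * PI) w; lra.
(* Within time [2 * PI / w] the arctangent would lose [2 * PI], twice the length of its range. *)
have : f t1 <= f (t1 + 2 * PI / w).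
  apply: (@derive_nondecr f (fun t => - (/ (1 + (z t) ^ 2) * dz t) - w)) => //; last by move=> x Hx; apply: Hf; lra.
  move=> x Hx; rewrite /f.
  apply: is_derive_minus.
    apply: is_derive_opp.
    evar_last.
      by apply: (is_derive_comp atan); [exact: is_derive_atan | exact: Hz].
    rewrite /scal /= /mult /= /Rsqr /Rdiv; field.
    have := pow2_ge_0 (z x); have := Rle_0_sqr (z x); rewrite /Rsqr; nra.
  evar_last.
    by apply: is_derive_scal; exact: is_derive_id.
  by rewrite /one /= Rmult_1_r.
rewrite /f.
have := atan_bound (z t1); have := atan_bound (z (t1 + 2 * PI / w)).
have -> : w * (t1 + 2 * PI / w) = w * t1 + 2 * PI by field; lra.
have := PI_RGT_0; lra.
Qed.

Lemma is_derive_exp_scal k t : is_derive (fun s => exp (k * s)) t (k * exp (k * t)).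
Proof.
evar_last.
  apply: (is_derive_comp exp); first exact: is_derive_exp.
  by apply: is_derive_scal; exact: is_derive_id.
by rewrite /scal /one /= /mult /= Rmult_1_r.
Qed.

(** * The Emden-Fowler system *)

Lemma Rpower_le_l s a b : 0 <= s -> 0 < a -> a <= b -> Rpower a s <= Rpower b s.
Proof. by move=> *; apply: Rle_Rpower_l. Qed.

Section OneEquation.
Variables (N al : R) (U U1 H : R -> R).
Hypotheses (al0 : 0 < al) (alN : al < N).
Hypotheses (U0 : forall t, 0 < U t) (H0 : forall t, 0 < H t).
Hypotheses (dU : forall t, is_derive U t (U1 t))
  (dU1 : forall t, is_derive U1 t ((2 * al - N) * U1 t + al * (N - al) * U t - H t)).

(* [exp (- al * t) * U] undoes the Emden-Fowler change of variables; its derivative carries the sign of the radial derivative. *)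
Let Q t := U1 t - al * U t.
Let G t := exp ((N - al) * t) * Q t.
Let F t := exp (- al * t) * U t.

(** [G] is the flux [r^(N+1) phi'(r)] of the radial function [phi = r^(-al) U]; the divergence form
    of the radial Laplacian leaves only the source [H]. *)
Lemma ef_dG t : is_derive G t (- (exp ((N - al) * t) * H t)).
Proof.
evar_last.
  apply: is_derive_mult; [exact: is_derive_exp_scal | | by move=> *; exact: Rmult_comm].
  apply: is_derive_minus; first exact: dU1.
  by apply: is_derive_scal; exact: dU.
by rewrite /Q /minus /plus /opp /mult /=; ring.
Qed.

Lemma ef_dF t : is_derive F t (exp (- al * t) * Q t).
Proof.
evar_last.
  by apply: is_derive_mult; [exact: is_derive_exp_scal | exact: dU | move=> *; exact: Rmult_comm].
by rewrite /Q /minus /plus /opp /mult /=; ring.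
Qed.

Lemma ef_G_decr s t : s <= t -> G t <= G s.
Proof.
move=> st.
suff : - G s <= - G t by lra.
apply: (derive_nondecr (f := fun t => - G t) (df := fun t => exp ((N - al) * t) * H t)) => // x _.
  evar_last; first by apply: is_derive_opp; exact: ef_dG.
  by rewrite /opp /=; ring.
by apply: Rmult_le_pos; apply: Rlt_le => //; exact: exp_pos.
Qed.

(** A positive value of [Q] at [t] would keep the flux at least [G t > 0] on all of [(-oo, t]],
    where [F' x = exp (- N * x) * G x >= c]. Followed back far enough towards the puncture, [F]
    would become negative. *)
Lemma ef_Q_neg t : U1 t <= al * U t.
Proof.
case: (Rle_lt_dec (U1 t) (al * U t)) => // Qp; exfalso.
have Gp : 0 < G t by apply: Rmult_lt_0_compat; [exact: exp_pos | rewrite /Q; lra].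
have N0 : 0 < N by lra.
pose c := exp (- N * t) * G t.
have cp : 0 < c by apply: Rmult_lt_0_compat => //; exact: exp_pos.
(* The line of slope [c] through [(t, F t)] has the value [- c] at [s]. *)
pose s := t - F t / c - 1.
have Fp : 0 < F t by apply: Rmult_lt_0_compat => //; exact: exp_pos.
have st : s <= t by rewrite /s; have := Rdiv_lt_0_compat _ _ Fp cp; lra.
have : F s - c * s <= F t - c * t.
  apply: (derive_nondecr (f := fun t => F t - c * t) (df := fun t => exp (- al * t) * Q t - c)) => // x Hx.
    apply: is_derive_minus; first exact: ef_dF.
    evar_last; first by apply: is_derive_scal; exact: is_derive_id.
    by rewrite /one /= Rmult_1_r.
  have -> : exp (- al * x) * Q x = exp (- N * x) * G x.
    by rewrite /G -Rmult_assoc -exp_plus; congr (exp _ * _); ring.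
  have E : exp (- N * t) <= exp (- N * x).
    by case: (proj2 Hx) => [h|->]; [apply: Rlt_le; apply: exp_increasing; nra | lra].
  have := ef_G_decr (proj2 Hx); have := exp_pos (- N * t); rewrite /c; nra.
have Fs : 0 < F s by apply: Rmult_lt_0_compat => //; exact: exp_pos.
have : c * s = c * t - F t - c by rewrite /s; field; lra.
nra.
Qed.

Lemma ef_F_decr s t : s <= t -> F t <= F s.
Proof.
move=> st.
suff : - F s <= - F t by lra.
apply: (derive_nondecr (f := fun t => - F t) (df := fun t => exp (- al * t) * - Q t)) => // x _.
  evar_last; first by apply: is_derive_opp; exact: ef_dF.
  by rewrite /opp /=; ring.
by apply: Rmult_le_pos; [exact/Rlt_le/exp_pos | have := ef_Q_neg x; rewrite /Q; lra].
Qed.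

(** A gradient bound of Harnack type. The upper side is [ef_Q_neg]. For the lower side, the
    decreasing flux propagates a steep descent at [t] over [[t, t + 1]], which is incompatible with
    [F (t + 1) > 0]; [exp N] is the loss of the weight in unit time. *)
Lemma ef_lipschitz t : Rabs (U1 t) <= (al + exp N) * U t.
Proof.
have Qt := ef_Q_neg t; have eN := exp_pos N; have Ut := U0 t.
suff : - (exp N * U t) <= Q t by move=> h; apply: Rabs_le; rewrite /Q in h; nra.
have t1 : t < t + 1 by lra.
have [c [Hc E]] := mvt t1 (fun x _ => ef_dF x).
have Fp : 0 < F (t + 1) by apply: Rmult_lt_0_compat => //; exact: exp_pos.
have tc : t <= c by lra.
have := ef_G_decr tc; rewrite /G => Gc.
have Qc : Q c <= exp ((N - al) * (t - c)) * Q t.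
  have e1 := exp_pos ((N - al) * c).
  apply: (Rmult_le_reg_l _ _ _ e1).
  rewrite -Rmult_assoc -exp_plus.
  by have -> : (N - al) * c + (N - al) * (t - c) = (N - al) * t by ring.
have E2 : - F t <= exp (- al * c) * (exp ((N - al) * (t - c)) * Q t).
  by have e1 := exp_pos (- al * c); nra.
move: E2; rewrite -Rmult_assoc -exp_plus /F => E2.
have E3 : exp (- N + - al * t) * - Q t <= exp (- al * c + (N - al) * (t - c)) * - Q t.
  apply: Rmult_le_compat_r; first by rewrite /Q; lra.
  have -> : - al * c + (N - al) * (t - c) = - N * (c - t) + - al * t by ring.
  case: (Req_dec c (t + 1)) => [->|ne]; first by apply: Req_le; congr exp; ring.
  by apply: Rlt_le; apply: exp_increasing; nra.
rewrite exp_plus in E3.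
have e1 := exp_pos (- al * t).
have E4 : exp (- N) * - Q t <= U t by apply: (Rmult_le_reg_l _ _ _ e1); nra.
have : exp N * (exp (- N) * - Q t) <= exp N * U t by apply: Rmult_le_compat_l; lra.
rewrite -Rmult_assoc -exp_plus (_ : N + - N = 0) ?exp_0; [lra | ring].
Qed.

(** The flux at [t] is at most minus the source collected on [[t - 1, t]], where
    [U >= exp (- al) * U t] because [F] decreases. The constant gathers the losses
    [exp (- (N - al))] and [exp (- al)] over that unit of time. *)
Lemma ef_dissipative mu p : 0 < mu -> 0 < p -> (forall t, mu * Rpower (U t) p <= H t) ->
  exists c, 0 < c /\ forall t, U1 t <= al * U t - c * Rpower (U t) p.
Proof.
move=> mu0 p0 HH.
exists (exp (- (N - al)) * mu * Rpower (exp (- al)) p); split.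
  by do 2?apply: Rmult_lt_0_compat => //; exact: exp_pos.
move=> t.
have t1 : t - 1 < t by lra.
have [c [Hc E]] := mvt t1 (fun x _ => ef_dG x).
have Gn : G (t - 1) <= 0.
  by have := exp_pos ((N - al) * (t - 1)); have := ef_Q_neg (t - 1); rewrite /G /Q; nra.
have Uc : exp (- al) * U t <= U c.
  have ct : c <= t by lra.
  have := ef_F_decr ct; rewrite /F => Fc.
  have e1 := exp_pos (- al * c).
  apply: (Rmult_le_reg_l _ _ _ e1); rewrite -Rmult_assoc -exp_plus.
  apply: Rle_trans Fc; apply: Rmult_le_compat_r; first exact/Rlt_le.
  case: (Req_dec c (t - 1)) => [->|ne]; first by apply: Req_le; congr exp; ring.
  by apply: Rlt_le; apply: exp_increasing; nra.
have e2 := exp_pos (- al).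
have Hc2 : mu * Rpower (exp (- al)) p * Rpower (U t) p <= H c.
  apply: Rle_trans (HH c); rewrite Rmult_assoc Rpower_mult_distr //.
  apply: Rmult_le_compat_l; first lra.
  by apply: Rpower_le_l => //; [lra | apply: Rmult_lt_0_compat].
have e3 : exp (- (N - al)) * exp ((N - al) * t) <= exp ((N - al) * c).
  rewrite -exp_plus.
  case: (Req_dec c (t - 1)) => [->|ne]; first by apply: Req_le; congr exp; ring.
  by apply: Rlt_le; apply: exp_increasing; nra.
have e4 := exp_pos ((N - al) * t).
have Gt : exp ((N - al) * t) * Q t <= - (exp ((N - al) * c) * H c).
  by move: E; rewrite /G in Gn *; nra.
have X0 : 0 < mu * Rpower (exp (- al)) p * Rpower (U t) p.
  by do 2?apply: Rmult_lt_0_compat => //; exact: exp_pos.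
set X := mu * _ * _ in Hc2 X0.
suff : Q t <= - (exp (- (N - al)) * X) by rewrite /Q /X; lra.
apply: (Rmult_le_reg_l _ _ _ e4); apply: Rle_trans Gt _.
have e5 := exp_pos (- (N - al)).
have : exp (- (N - al)) * exp ((N - al) * t) * X <= exp ((N - al) * c) * H c by apply: Rmult_le_compat; nra.
nra.
Qed.

(** By [ef_dissipative] the nonlinear loss exceeds the growth [al * U] once [U] passes
    [M = (al / c)^(1/(p-1))], so [U] cannot rise above the larger of [M] and [U 0]. *)
Lemma ef_bounded mu p : 0 < mu -> 1 < p -> (forall t, mu * Rpower (U t) p <= H t) ->
  exists M, forall t, 0 <= t -> U t <= M.
Proof.
move=> mu0 p1 HH.
have [|c [c0 Hc]] := ef_dissipative mu0 _ HH; first lra.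
pose M := Rpower (al / c) (/ (p - 1)).
have neg : forall t, M < U t -> U1 t <= 0.
  move=> t Mt; apply: Rle_trans (Hc t) _.
  have -> : Rpower (U t) p = Rpower (U t) (p - 1) * U t.
    by rewrite -{3}(Rpower_1 (U t)) // -Rpower_plus; congr Rpower; ring.
  have : Rpower M (p - 1) <= Rpower (U t) (p - 1).
    by apply: Rpower_le_l; [lra | exact: exp_pos | lra].
  rewrite /M Rpower_mult Rinv_l; last lra.
  rewrite Rpower_1; last exact: Rdiv_lt_0_compat.
  move=> h; have Ut := U0 t.
  have : c * (al / c) <= c * Rpower (U t) (p - 1) by apply: Rmult_le_compat_l; lra.
  have -> : c * (al / c) = al by field; lra.
  nra.
pose K := Rmax (U 0) M.
exists K => t t0; case: (Rle_lt_dec (U t) K) => // UK; exfalso.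
(* The last time in [[0, t]] with [U <= K]. After it [U1 <= 0], so [U] cannot climb to [U t > K]. *)
have [||s [ub lb]] := completeness (fun s => 0 <= s <= t /\ U s <= K).
- by exists t => s [[_ h] _].
- by exists 0; split; [lra | exact: Rmax_l].
have s0 : 0 <= s by apply: ub; split; [lra | exact: Rmax_l].
have st : s <= t by apply: lb => r [[_ h] _].
have Us : U s <= K.
  apply: Rnot_lt_le => h.
  have [|d [d0 Hd]] := is_derive_cont_eps (dU s) (eps := U s - K); first lra.
  suff : s <= s - d by lra.
  apply: lb => r [[r0 rt] Ur]; apply: Rnot_lt_le => rs.
  have rs2 : r <= s by apply: ub.
  have /Rabs_def2 : Rabs (U r - U s) < U s - K by apply: Hd; apply: Rabs_def1; lra.
  lra.
have {}st : s < t by case: st => // E; rewrite E in Us; lra.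
have [r [Hr E]] := mvt st (fun x _ => dU x).
have Ur : K < U r.
  apply: Rnot_le_lt => h; have : r <= s by apply: ub; split => //; lra.
  lra.
have := neg r (Rle_lt_trans _ _ _ (Rmax_r _ _) Ur).
nra.
Qed.

End OneEquation.

(** * The nonlinearity and bounds for the coupled system *)

Definition nonlin (q mu be a b : R) : R :=
  mu * Rpower a (2 * q + 1) + be * Rpower a q * Rpower b (q + 1).

Lemma nonlin_gt0 q mu be a b : 0 < mu -> 0 < be -> 0 < nonlin q mu be a b.
Proof.
move=> mu0 be0; apply: Rplus_lt_0_compat; first by apply: Rmult_lt_0_compat => //; exact: exp_pos.
by do 2?apply: Rmult_lt_0_compat => //; exact: exp_pos.
Qed.

Lemma nonlin_le q mu be a b a' b' : 0 < q -> 0 < mu -> 0 < be -> 0 < a -> 0 < b -> a <= a' -> b <= b' ->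
  nonlin q mu be a b <= nonlin q mu be a' b'.
Proof.
move=> q0 mu0 be0 a0 b0 aa bb; apply: Rplus_le_compat.
  by apply: Rmult_le_compat_l; [lra | apply: Rpower_le_l; lra].
rewrite !Rmult_assoc; apply: Rmult_le_compat_l; first lra.
by apply: Rmult_le_compat; [exact/Rlt_le/exp_pos | exact/Rlt_le/exp_pos | |]; apply: Rpower_le_l; lra.
Qed.

Lemma nonlin_derive q mu be (U V : R -> R) U1 V1 t : 0 < U t -> 0 < V t ->
  is_derive U t U1 -> is_derive V t V1 ->
  is_derive (fun t => nonlin q mu be (U t) (V t)) t
    (mu * Rpower (U t) (2 * q + 1) * ((2 * q + 1) * (U1 / U t)) +
     be * Rpower (U t) q * Rpower (V t) (q + 1) * (q * (U1 / U t) + (q + 1) * (V1 / V t))).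
Proof.
move=> Up Vp dU dV; rewrite /nonlin.
have D1 := is_derive_Rpower (2 * q + 1) Up dU.
have D2 := is_derive_Rpower q Up dU.
have D3 := is_derive_Rpower (q + 1) Vp dV.
evar_last.
  apply: is_derive_plus; first by apply: is_derive_scal; exact: D1.
  apply: is_derive_mult; [by apply: is_derive_scal; exact: D2 | exact: D3 | by move=> *; exact: Rmult_comm].
by rewrite /plus /mult /=; ring.
Qed.

(** Both monomials have total degree [2 * q + 1], so relative rates at most [C] of the arguments
    give a relative rate at most [(2 * q + 1) * C]. Absolute bounds on the partial derivatives would
    break down for [q < 1], where [a^(q-1)] blows up at 0. *)
Lemma nonlin_derive_bound q mu be a b a1 b1 C : 0 < q -> 0 < mu -> 0 < be -> 0 < a -> 0 < b ->
  Rabs a1 <= C * a -> Rabs b1 <= C * b ->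
  Rabs (mu * Rpower a (2 * q + 1) * ((2 * q + 1) * (a1 / a)) +
     be * Rpower a q * Rpower b (q + 1) * (q * (a1 / a) + (q + 1) * (b1 / b)))
  <= (2 * q + 1) * C * nonlin q mu be a b.
Proof.
move=> q0 mu0 be0 a0 b0 A1 B1.
have quo : forall x y, 0 < x -> Rabs y <= C * x -> - C <= y / x <= C.
  move=> x y x0 /Rabs_le_between h.
  have {}h : - (C * x) <= y <= C * x by lra.
  by split; [apply/Rle_div_r => //; nra | apply/Rle_div_l => //; nra].
have [A2 A3] := quo a a1 a0 A1.
have [B2 B3] := quo b b1 b0 B1.
set X := mu * _; set Y := be * _ * _.
have X0 : 0 < X by apply: Rmult_lt_0_compat => //; exact: exp_pos.
have Y0 : 0 < Y by do 2?apply: Rmult_lt_0_compat => //; exact: exp_pos.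
rewrite /nonlin -/X -/Y.
have P1 : forall x, - C <= x <= C -> - ((2 * q + 1) * C) <= (2 * q + 1) * x <= (2 * q + 1) * C.
  by move=> x Hx; split; nra.
have [h1 h2] := P1 _ (conj A2 A3).
have h3 : - ((2 * q + 1) * C) <= q * (a1 / a) + (q + 1) * (b1 / b) <= (2 * q + 1) * C by split; nra.
move: h1 h2 h3; set x := (2 * q + 1) * (a1 / a); set y := q * _ + _; set Z := (2 * q + 1) * C.
by move=> h1 h2 [h3 h4]; apply/Rabs_le_between; split; nra.
Qed.

(* The system for [r ^ al * u] and [r ^ al * v] as functions of [t = ln r], with [N = n - 2]; [U1] and [V1] are the derivatives. *)
Definition emden_fowler (N al q mu1 mu2 be : R) (U U1 V V1 : R -> R) : Prop :=
  [/\ [/\ 0 < al, al < N & N < 2 * al], [/\ 0 < q, 0 < mu1, 0 < mu2 & 0 < be],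
    forall t, 0 < U t /\ 0 < V t,
    forall t, is_derive U t (U1 t) /\
      is_derive U1 t ((2 * al - N) * U1 t + al * (N - al) * U t - nonlin q mu1 be (U t) (V t)) &
    forall t, is_derive V t (V1 t) /\
      is_derive V1 t ((2 * al - N) * V1 t + al * (N - al) * V t - nonlin q mu2 be (V t) (U t))].

Lemma emden_fowler_sym N al q mu1 mu2 be U U1 V V1 :
  emden_fowler N al q mu1 mu2 be U U1 V V1 -> emden_fowler N al q mu2 mu1 be V V1 U U1.
Proof. by case=> ? [? ? ? ?] P ? ?; split => // t; case: (P t). Qed.

Lemma ef_bound1 N al q mu1 mu2 be U U1 V V1 : emden_fowler N al q mu1 mu2 be U U1 V V1 ->
  exists M, forall t, 0 <= t -> U t <= M.
Proof.
case=> [[al0 alN _]] [q0 m1 m2 b0] P dU dV.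
apply: (@ef_bounded N al U U1 (fun t => nonlin q mu1 be (U t) (V t)) _ _ _ _ _ _ mu1 (2 * q + 1)) => //; try lra.
- by move=> t; case: (P t).
- by move=> t; exact: nonlin_gt0.
- by move=> t; case: (dU t).
- by move=> t; case: (dU t).
- move=> t; rewrite /nonlin.
  suff : 0 < be * Rpower (U t) q * Rpower (V t) (q + 1) by lra.
  by do 2?apply: Rmult_lt_0_compat => //; exact: exp_pos.
Qed.

Lemma ef_lip1 N al q mu1 mu2 be U U1 V V1 : emden_fowler N al q mu1 mu2 be U U1 V V1 ->
  forall t, Rabs (U1 t) <= (al + exp N) * U t.
Proof.
case=> [[al0 alN _]] [q0 m1 m2 b0] P dU dV.
apply: (@ef_lipschitz N al U U1 (fun t => nonlin q mu1 be (U t) (V t))) => //.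
- by move=> t; case: (P t).
- by move=> t; exact: nonlin_gt0.
- by move=> t; case: (dU t).
- by move=> t; case: (dU t).
Qed.

Lemma ef_bound N al q mu1 mu2 be U U1 V V1 : emden_fowler N al q mu1 mu2 be U U1 V V1 ->
  exists M, 1 <= M /\ forall t, 0 <= t -> U t <= M /\ V t <= M.
Proof.
move=> H; have [A HA] := ef_bound1 H; have [B HB] := ef_bound1 (emden_fowler_sym H).
exists (Rmax 1 (Rmax A B)); split; first exact: Rmax_l.
move=> t t0; split.
  by apply: Rle_trans (HA t t0) _; apply: Rle_trans (Rmax_r _ _); exact: Rmax_l.
by apply: Rle_trans (HB t t0) _; apply: Rle_trans (Rmax_r _ _); exact: Rmax_r.
Qed.

Section Dynamics.
Variables (N al q mu1 mu2 be : R) (U U1 V V1 : R -> R).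
Hypothesis ef : emden_fowler N al q mu1 mu2 be U U1 V V1.

Let h1 t := nonlin q mu1 be (U t) (V t).
Let h2 t := nonlin q mu2 be (V t) (U t).
Let U2 t := (2 * al - N) * U1 t + al * (N - al) * U t - h1 t.
Let V2 t := (2 * al - N) * V1 t + al * (N - al) * V t - h2 t.

Lemma ef_second_bound : exists B, 0 < B /\ forall t, 0 <= t ->
  [/\ Rabs (U1 t) <= B, Rabs (U2 t) <= B & h1 t <= B].
Proof.
have [M [M1 HM]] := ef_bound ef.
have [[al0 alN alN2] [q0 m1 m2 b0] P dU dV] := ef.
have Lip := ef_lip1 ef.
have e0 := exp_pos N.
pose K := (al + exp N) * M; pose h := nonlin q mu1 be M M.
have K0 : 0 < K by apply: Rmult_lt_0_compat; lra.
have h0 : 0 < h by exact: nonlin_gt0.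
have X0 : 0 < (2 * al - N) * K by apply: Rmult_lt_0_compat; lra.
have Y0 : 0 < al * (N - al) * M by do 2?apply: Rmult_lt_0_compat; lra.
exists (K + (2 * al - N) * K + al * (N - al) * M + h); split; first lra.
move=> t t0.
have [UM VM] := HM t t0; have [Up Vp] := P t.
have A1 : Rabs (U1 t) <= K by apply: Rle_trans (Lip t) _; apply: Rmult_le_compat_l; lra.
have A2 : h1 t <= h by apply: nonlin_le.
have A3 : 0 < h1 t by exact: nonlin_gt0.
split; try lra.
have /Rabs_le_between [B1 B2] := A1.
have C1 : 0 < al * (N - al) by apply: Rmult_lt_0_compat; lra.
have C2 : 0 <= al * (N - al) * U t <= al * (N - al) * M by split; [apply: Rmult_le_pos; lra | apply: Rmult_le_compat_l; lra].
have C3 : (2 * al - N) * U1 t <= (2 * al - N) * K by apply: Rmult_le_compat_l; lra.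
have C4 : (2 * al - N) * (- K) <= (2 * al - N) * U1 t by apply: Rmult_le_compat_l; lra.
by apply/Rabs_le_between; rewrite /U2; lra.
Qed.

(** Differentiating the equation once more bounds the third derivative, so [barbalat] applied to
    [U1] gives [U2 -> 0]; the equation then leaves the equilibrium defect. *)
Lemma ef_second_tends0 : tends0 U1 -> tends0 (fun t => al * (N - al) * U t - h1 t).
Proof.
move=> U10.
have [B [B0 HB]] := ef_second_bound.
have [[al0 alN alN2] [q0 m1 m2 b0] P dU dV] := ef.
have L1 := ef_lip1 ef; have L2 := ef_lip1 (emden_fowler_sym ef).
have e0 := exp_pos N.
pose U3 t := (2 * al - N) * U2 t + al * (N - al) * U1 t -
  (mu1 * Rpower (U t) (2 * q + 1) * ((2 * q + 1) * (U1 t / U t)) +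
   be * Rpower (U t) q * Rpower (V t) (q + 1) * (q * (U1 t / U t) + (q + 1) * (V1 t / V t))).
have k0 : 0 < al * (N - al) by apply: Rmult_lt_0_compat; lra.
have U20 : tends0 U2.
  apply: (@barbalat U1 U2 U3 0 ((2 * al - N) * B + al * (N - al) * B + (2 * q + 1) * (al + exp N) * B) 0).
  - by move=> t; case: (dU t).
  - move=> t; have [Up Vp] := P t; have [D1 D2] := dU t; have [D3 D4] := dV t.
    apply: is_derive_minus; last exact: nonlin_derive.
    by apply: is_derive_plus; apply: is_derive_scal.
  - move=> t t0; have [Up Vp] := P t; have [A1 A2 A3] := HB t t0.
    have := nonlin_derive_bound q0 m1 b0 Up Vp (L1 t) (L2 t); rewrite -/(h1 t).
    rewrite /U3; set W := mu1 * _ * _ + _ => HW.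
    have HW2 : Rabs W <= (2 * q + 1) * (al + exp N) * B.
      by apply: Rle_trans HW _; apply: Rmult_le_compat_l => //; apply: Rmult_le_pos; lra.
    have /Rabs_le_between [w1 w2] := HW2.
    have /Rabs_le_between [a1 a2] := A1.
    have /Rabs_le_between [c1 c2] := A2.
    have d1 : (2 * al - N) * U2 t <= (2 * al - N) * B by apply: Rmult_le_compat_l; lra.
    have d2 : (2 * al - N) * (- B) <= (2 * al - N) * U2 t by apply: Rmult_le_compat_l; lra.
    have d3 : al * (N - al) * U1 t <= al * (N - al) * B by apply: Rmult_le_compat_l; lra.
    have d4 : al * (N - al) * (- B) <= al * (N - al) * U1 t by apply: Rmult_le_compat_l; lra.
    by apply/Rabs_le_between; lra.
  - by apply: tends0_ext U10 => t; rewrite Rminus_0_r.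
apply: tends0_ext (tends0_plus U20 (tends0_scal (- (2 * al - N)) U10)) => t.
by rewrite /U2; ring.
Qed.

End Dynamics.

(** * Energy and approach to the equilibria *)

Section Energy.
Variables (N al q mu1 mu2 be : R) (U U1 V V1 : R -> R).
Hypothesis ef : emden_fowler N al q mu1 mu2 be U U1 V V1.

Let E t := (U1 t * U1 t + V1 t * V1 t) / 2 - al * (N - al) / 2 * (U t * U t + V t * V t) +
  (mu1 * Rpower (U t) (2 * q + 2) + 2 * be * (Rpower (U t) (q + 1) * Rpower (V t) (q + 1))
   + mu2 * Rpower (V t) (2 * q + 2)) / (2 * q + 2).

Lemma is_derive_square (f : R -> R) df t : is_derive f t df -> is_derive (fun s => f s * f s) t (2 * f t * df).
Proof.
move=> H; evar_last; first by apply: is_derive_mult; [exact: H | exact: H | move=> *; exact: Rmult_comm].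
by rewrite /plus /mult /=; ring.
Qed.

Lemma Rpower_succ x s : 0 < x -> Rpower x (s + 1) = Rpower x s * x.
Proof. by move=> x0; rewrite Rpower_plus Rpower_1. Qed.

(** The coupling is variational: with the same [be] in both equations, the mixed terms are the two
    partial derivatives of [be / (q + 1) * U^(q+1) * V^(q+1)]. Everything but the damping
    cancels. *)
Lemma ef_energy_derive t : is_derive E t ((2 * al - N) * (U1 t * U1 t + V1 t * V1 t)).
Proof.
have [[al0 alN alN2] [q0 m1 m2 b0] P dU dV] := ef.
have [Up Vp] := P t; have [D1 D2] := dU t; have [D3 D4] := dV t.
rewrite /E /Rdiv.
evar_last.
  apply: is_derive_plus.
    apply: is_derive_minus.
      apply: (is_derive_ext (fun t => / 2 * (U1 t * U1 t + V1 t * V1 t))); first by move=> s; rewrite Rmult_comm.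
      by apply: is_derive_scal; apply: is_derive_plus; apply: is_derive_square; [exact: D2 | exact: D4].
    by apply: is_derive_scal; apply: is_derive_plus; apply: is_derive_square; [exact: D1 | exact: D3].
  apply: (is_derive_ext (fun t => / (2 * q + 2) * (mu1 * Rpower (U t) (2 * q + 2) + 2 * be * (Rpower (U t) (q + 1) * Rpower (V t) (q + 1))
   + mu2 * Rpower (V t) (2 * q + 2)))); first by move=> s; rewrite Rmult_comm.
  apply: is_derive_scal; apply: is_derive_plus; first apply: is_derive_plus.
  - by apply: is_derive_scal; apply: is_derive_Rpower => //; exact: D1.
  - apply: is_derive_scal; apply: is_derive_mult; last by move=> *; exact: Rmult_comm.
    + by apply: is_derive_Rpower => //; exact: D1.
    + by apply: is_derive_Rpower => //; exact: D3.
  - by apply: is_derive_scal; apply: is_derive_Rpower => //; exact: D3.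
rewrite /plus /minus /opp /plus /mult /= /nonlin.
have E1 : forall x, 0 < x -> Rpower x (2 * q + 2) = Rpower x (2 * q + 1) * x.
  by move=> x x0; rewrite -Rpower_succ //; congr Rpower; ring.
rewrite !E1 // !(Rpower_succ q) //; field; lra.
Qed.

Lemma ef_velocity_tends0 : tends0 U1 /\ tends0 V1.
Proof.
have [[al0 alN alN2] [q0 m1 m2 b0] P dU dV] := ef.
have [B [B0 HB]] := ef_second_bound ef.
have [B' [B'0 HB']] := ef_second_bound (emden_fowler_sym ef).
have [M [M1 HM]] := ef_bound ef.
have d0 : 0 < 2 * al - N by lra.
have [l Hl] : exists l, tends0 (fun t => E t - l).
  apply: (@nondecr_bounded_lim _ 0 (B * B + B' * B' +
    (mu1 * Rpower M (2 * q + 2) + 2 * be * (Rpower M (q + 1) * Rpower M (q + 1)) + mu2 * Rpower M (2 * q + 2)) / (2 * q + 2))).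
    move=> s t _ st; apply: derive_nondecr st _ _; first by move=> x _; exact: ef_energy_derive.
    by move=> x _; nra.
  move=> t t0; have [Up Vp] := P t; have [UM VM] := HM t t0.
  have [/Rabs_le_between A1 _ _] := HB t t0; have [/Rabs_le_between A2 _ _] := HB' t t0.
  have k0 : 0 < al * (N - al) by apply: Rmult_lt_0_compat; lra.
  have S0 : 0 <= U t * U t + V t * V t by nra.
  have S1 : U1 t * U1 t <= B * B by nra.
  have S2 : V1 t * V1 t <= B' * B' by nra.
  have X1 : Rpower (U t) (2 * q + 2) <= Rpower M (2 * q + 2) by apply: Rpower_le_l; lra.
  have X2 : Rpower (V t) (2 * q + 2) <= Rpower M (2 * q + 2) by apply: Rpower_le_l; lra.
  have X3 : Rpower (U t) (q + 1) * Rpower (V t) (q + 1) <= Rpower M (q + 1) * Rpower M (q + 1).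
    by apply: Rmult_le_compat; try exact/Rlt_le/exp_pos; apply: Rpower_le_l; lra.
  have i0 : 0 < / (2 * q + 2) by apply: Rinv_0_lt_compat; lra.
  rewrite /E; apply: Rplus_le_compat; first by nra.
  by apply: Rmult_le_compat_r; [lra | nra].
have HE : tends0 (fun t => (2 * al - N) * (U1 t * U1 t + V1 t * V1 t)).
  apply: (@barbalat E _ (fun t => (2 * al - N) * (2 * U1 t * ((2 * al - N) * U1 t + al * (N - al) * U t - nonlin q mu1 be (U t) (V t))
     + 2 * V1 t * ((2 * al - N) * V1 t + al * (N - al) * V t - nonlin q mu2 be (V t) (U t)))) l
     ((2 * al - N) * (2 * B * B + 2 * B' * B')) 0) => //.
  - exact: ef_energy_derive.
  - move=> t; have [D1 D2] := dU t; have [D3 D4] := dV t.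
    by apply: is_derive_scal; apply: is_derive_plus; apply: is_derive_square.
  - move=> t t0; have [A1 A2 _] := HB t t0; have [A3 A4 _] := HB' t t0.
    rewrite Rabs_mult (Rabs_right (2 * al - N)); last lra.
    apply: Rmult_le_compat_l; first lra.
    apply: Rle_trans (Rabs_triang _ _) _; rewrite !Rabs_mult (Rabs_right 2); last lra.
    apply: Rplus_le_compat; apply: Rmult_le_compat => //; try exact: Rabs_pos;
      try (by apply: Rmult_le_pos; [lra | exact: Rabs_pos]); by apply: Rmult_le_compat_l; lra.
split=> eps e0.
- have [|T HT] := HE ((2 * al - N) * (eps * eps)); first by do 2?apply: Rmult_lt_0_compat.
  exists T => t Ht; have := HT t Ht; rewrite Rabs_mult (Rabs_right (2 * al - N)); last lra.
  move/(Rmult_lt_reg_l _ _ _ d0) => /Rabs_def2 [h _].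
  by apply: Rabs_def1; nra.
- have [|T HT] := HE ((2 * al - N) * (eps * eps)); first by do 2?apply: Rmult_lt_0_compat.
  exists T => t Ht; have := HT t Ht; rewrite Rabs_mult (Rabs_right (2 * al - N)); last lra.
  move/(Rmult_lt_reg_l _ _ _ d0) => /Rabs_def2 [h _].
  by apply: Rabs_def1; nra.
Qed.

Lemma ef_equilibrium :
  tends0 (fun t => al * (N - al) * U t - nonlin q mu1 be (U t) (V t)) /\
  tends0 (fun t => al * (N - al) * V t - nonlin q mu2 be (V t) (U t)).
Proof.
have [A B] := ef_velocity_tends0.
by split; [exact: (ef_second_tends0 ef) | exact: (ef_second_tends0 (emden_fowler_sym ef))].
Qed.

End Energy.

(** * Asymptotics of the Emden-Fowler system *)

Lemma is_derive_sign (f : R -> R) x l : is_derive f x l -> l < 0 ->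
  exists d, 0 < d /\ (forall y, x < y < x + d -> f y < f x) /\ (forall y, x - d < y < x -> f x < f y).
Proof.
move=> /is_derive_Reals H l0.
have [|d Hd] := H (- l / 2); first lra.
exists d; split; first exact: cond_pos.
have key : forall y, y <> x -> Rabs (y - x) < d -> (f y - f x) / (y - x) < 0.
  move=> y yx yd; have := Hd (y - x); have -> : x + (y - x) = y by ring.
  by move=> /(_ ltac:(lra) yd) /Rabs_def2; lra.
split=> y Hy.
  have := key y ltac:(lra) ltac:(apply: Rabs_def1; lra).
  have yx0 : y - x > 0 by lra.
  move/(Rlt_div_l _ _ _ yx0); lra.
have := key y ltac:(lra) ltac:(apply: Rabs_def1; lra).
have -> : (f y - f x) / (y - x) = (f x - f y) / (x - y) by field; lra.
have xy0 : x - y > 0 by lra.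
move/(Rlt_div_l _ _ _ xy0); lra.
Qed.

(** If [l < 0], then [f1] lies above [f1 x] just left of [x] and below it just right. Whatever the
    sign of [f1 x], the mean value theorem finds a smaller value of [f] on one side. *)
Lemma second_derivative_at_min (f f1 : R -> R) x l d : 0 < d ->
  (forall y, Rabs (y - x) < d -> is_derive f y (f1 y) /\ f x <= f y) ->
  is_derive f1 x l -> 0 <= l.
Proof.
move=> d0 H H1; apply: Rnot_lt_le => l0.
have [e [e0 [He1 He2]]] := is_derive_sign H1 l0.
pose r := Rmin d e / 2.
have rd : 0 < r < d by rewrite /r; have := Rmin_l d e; have := Rmin_glb_lt _ _ _ d0 e0; lra.
have re : r < e by rewrite /r; have := Rmin_r d e; have := Rmin_glb_lt _ _ _ d0 e0; lra.
case: (Rle_lt_dec (f1 x) 0) => f1x.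
  have xr : x < x + r by lra.
  have [y Hy|c [Hc E]] := mvt (f := f) (df := f1) xr.
    by have [] := H y ltac:(apply: Rabs_def1; lra).
  have := He1 c ltac:(lra); have [_] := H (x + r) ltac:(apply: Rabs_def1; lra); nra.
have xr : x - r < x by lra.
have [y Hy|c [Hc E]] := mvt (f := f) (df := f1) xr.
  by have [] := H y ltac:(apply: Rabs_def1; lra).
have := He2 c ltac:(lra); have [_] := H (x - r) ltac:(apply: Rabs_def1; lra); nra.
Qed.

Lemma tends0_exp k : 0 < k -> tends0 (fun t => exp (- k * t)).
Proof.
move=> k0 eps e0; exists (- ln eps / k + 1) => t Ht.
rewrite Rabs_right; last exact/Rle_ge/Rlt_le/exp_pos.
rewrite -[X in _ < X](exp_ln eps) //; apply: exp_increasing.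
have : - ln eps / k < t by lra.
move/(Rlt_div_l _ _ _ (k0 : k > 0)); lra.
Qed.

(** A negative value of [Z - Y] would produce a negative minimum, attained because the difference
    tends to 0. There the first derivatives agree and the second derivative of [Z - Y] is
    nonnegative, against the sign of [k - c]. The nonlinear term is frozen into the coefficient [c],
    common to both functions. *)
Lemma comparison (Y Y1 Y2 Z Z1 Z2 c : R -> R) d k T :
  (forall t, is_derive Y t (Y1 t)) -> (forall t, is_derive Y1 t (Y2 t)) ->
  (forall t, is_derive Z t (Z1 t)) -> (forall t, is_derive Z1 t (Z2 t)) ->
  (forall t, T <= t -> c t < k) ->
  (forall t, T <= t -> 0 <= Y2 t - d * Y1 t - (k - c t) * Y t) ->
  (forall t, T <= t -> Z2 t - d * Z1 t - (k - c t) * Z t <= 0) ->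
  tends0 Y -> tends0 Z -> Y T <= Z T -> forall t, T <= t -> Y t <= Z t.
Proof.
move=> dY dY1 dZ dZ1 ck HY HZ Y0 Z0 YT t0 Tt0; apply: Rnot_lt_le => Hbad.
pose D t := Z t - Y t; pose D1 t := Z1 t - Y1 t.
have dD t : is_derive D t (D1 t) by apply: is_derive_minus.
have dD1 t : is_derive D1 t (Z2 t - Y2 t) by apply: is_derive_minus.
have D0 : tends0 D.
  by apply: tends0_ext (tends0_plus Z0 (tends0_scal (- 1) Y0)) => t; rewrite /D; ring.
have [|S HS] := D0 (- D t0); first by rewrite /D; lra.
pose S' := Rmax S t0 + 1.
have S1 : S <= S' by have := Rmax_l S t0; rewrite /S'; lra.
have S2 : t0 < S' by have := Rmax_r S t0; rewrite /S'; lra.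
have [|u _|m [Hm1 Hm2]] := continuity_ab_min D T S'; first lra.
  exact: is_derive_cont (dD u).
have Dm : D m <= D t0 by apply: Hm1; lra.
have mT : m <> T by move=> E; rewrite E /D in Dm; lra.
have mS : m <> S'.
  by move=> E; have /Rabs_def2 [_] := HS S' S1; rewrite -E; lra.
have pr : derivable_pt D m by exists (D1 m); apply/is_derive_Reals.
have E1 : D1 m = 0.
  have [h1 h2] : T < m /\ m < S' by lra.
  have h3 u : T < u -> u < S' -> D m <= D u by move=> *; apply: Hm1; lra.
  rewrite -(deriv_minimum D T S' m pr h1 h2 h3); apply/esym/derive_pt_eq_0/is_derive_Reals; exact: dD.
have r0 : 0 < Rmin (m - T) (S' - m) by apply: Rmin_glb_lt; lra.
have := second_derivative_at_min (f := D) (f1 := D1) (x := m) (l := Z2 m - Y2 m) r0.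
have h : forall y : R, Rabs (y - m) < Rmin (m - T) (S' - m) -> is_derive D y (D1 y) /\ D m <= D y.
  move=> y /Rabs_def2 Hy; split => //; apply: Hm1.
  have := Rmin_l (m - T) (S' - m); have := Rmin_r (m - T) (S' - m); lra.
move=> /(_ h (dD1 m)) h4.
have Tm : T <= m by lra.
have := HY m Tm; have := HZ m Tm; have cm := ck m Tm.
have -> : Z1 m = Y1 m by move: E1; rewrite /D1; lra.
have kc : 0 < k - c m by lra.
have YZ : 0 < Y m - Z m by move: Dm Hbad; rewrite /D; lra.
by have := Rmult_lt_0_compat _ _ kc YZ; lra.
Qed.

(* The exponents are the roots [al] and [- (N - al)] of [x^2 - (2 al - N) x - al (N - al)]; comparison with
   [exp (- (N - al) t) - exp (- (N - al + e) t) / 2] upgrades a rough exponential decay to the exact rate. *)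
Lemma exact_decay (N al K s T0 : R) (Y Y1 Y2 : R -> R) :
  0 < al -> al < N -> 0 < K -> 0 < s -> (forall t, 0 < Y t) ->
  (forall t, is_derive Y t (Y1 t)) -> (forall t, is_derive Y1 t (Y2 t)) ->
  (forall t, T0 <= t ->
     0 <= Y2 t - (2 * al - N) * Y1 t - (al * (N - al) - K * Rpower (Y t) s) * Y t) ->
  tends0 Y -> exists C T, 0 < C /\ forall t, T <= t -> Y t <= C * exp (- (N - al) * t).
Proof.
move=> al0 alN K0 s0 Yp dY dY1 HY Y0.
pose m := N - al; have m0 : 0 < m by rewrite /m; lra.
(* The characteristic polynomial takes the value [- (m / 2 * (al + m / 2))] at [- m / 2], so a
   coefficient up to the first bound keeps [exp (- (m / 2) * t)] a supersolution. The second bound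
   keeps the coefficient below [al * m], as [comparison] asks. *)
pose k1 := Rmin (m / 2 * (al + m / 2)) (al * m / 2).
have k10 : 0 < k1 by apply: Rmin_glb_lt; nra.
have k1a : k1 <= m / 2 * (al + m / 2) := Rmin_l _ _.
have k1b : k1 <= al * m / 2 := Rmin_r _ _.
have [|T1 HT1] := Y0 (Rpower (k1 / K) (/ s)); first exact: exp_pos.
have csmall t : T1 <= t -> K * Rpower (Y t) s <= k1.
  move=> Ht; have := HT1 t Ht; rewrite Rabs_right => [h|]; last exact/Rle_ge/Rlt_le.
  have : Rpower (Y t) s <= Rpower (Rpower (k1 / K) (/ s)) s by apply: Rpower_le_l; [lra | exact: Yp | lra].
  rewrite Rpower_mult Rinv_l ?Rpower_1; [|exact: Rdiv_lt_0_compat|lra].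
  by move/(Rmult_le_compat_l K _ _ (Rlt_le _ _ K0)); have -> : K * (k1 / K) = k1 by field; lra.
have dexp A r t : is_derive (fun t => A * exp (- r * t)) t (- r * A * exp (- r * t)).
  evar_last; first by apply: is_derive_scal; exact: is_derive_exp_scal.
  by rewrite /=; ring.
pose T := Rmax T0 (Rmax T1 0).
have TT0 : T0 <= T := Rmax_l _ _.
have TT1 : T1 <= T by apply: Rle_trans (Rmax_r _ _); exact: Rmax_l.
have T00 : 0 <= T by apply: Rle_trans (Rmax_r _ _); exact: Rmax_r.
pose A := Y T * exp (m / 2 * T).
have A0 : 0 < A by apply: Rmult_lt_0_compat => //; exact: exp_pos.
have step1 t : T <= t -> Y t <= A * exp (- (m / 2) * t).
  apply: (comparison (c := fun t => K * Rpower (Y t) s) (k := al * m) (d := 2 * al - N) dY dY1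
     (dexp A (m / 2)) (Z2 := fun t => - (m / 2) * (- (m / 2) * A) * exp (- (m / 2) * t))) => {t}.
  - by move=> t; exact: dexp.
  - by move=> t Ht; have := csmall t ltac:(lra); nra.
  - by move=> t Ht; apply: HY; lra.
  - move=> t Ht; have c1 := csmall t ltac:(lra); set c := K * _ in c1 *.
    have -> : - (m / 2) * (- (m / 2) * A) * exp (- (m / 2) * t) - (2 * al - N) * (- (m / 2) * A * exp (- (m / 2) * t))
      - (al * m - c) * (A * exp (- (m / 2) * t)) = (c - m / 2 * (al + m / 2)) * (A * exp (- (m / 2) * t)).
      by rewrite /m; field.
    have : 0 < A * exp (- (m / 2) * t) by apply: Rmult_lt_0_compat => //; exact: exp_pos.
    nra.
  - exact: Y0.
  - by apply: tends0_scal; apply: tends0_exp; lra.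
  - by rewrite /A Rmult_assoc -exp_plus (_ : m / 2 * T + - (m / 2) * T = 0) ?exp_0; [lra | ring].
(* [Y^s] decays like [exp (- 2 * e * t)]. One factor [exp (- e * t)] absorbs the constants, the
   other is matched by the correction term, since the polynomial equals [e * (m + al + e)] at
   [- (m + e)]. *)
pose e := s * (m / 2) / 2.
have e0 : 0 < e by rewrite /e; nra.
pose X := e * (m + al + e) / 2 / (K * Rpower A s).
have As := exp_pos (s * ln A); rewrite -/(Rpower A s) in As.
have X0 : 0 < X by apply: Rdiv_lt_0_compat; nra.
have [S HS] := tends0_exp e0 X0.
pose T' := Rmax T S.
have TT' : T <= T' := Rmax_l _ _.
have cfast t : T' <= t -> K * Rpower (Y t) s <= e * (m + al + e) / 2 * exp (- e * t).
  move=> Ht; have tT : T <= t by lra.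
  have : Rpower (Y t) s <= Rpower (A * exp (- (m / 2) * t)) s by apply: Rpower_le_l; [lra | exact: Yp | exact: step1].
  rewrite -Rpower_mult_distr //; last exact: exp_pos.
  have -> : Rpower (exp (- (m / 2) * t)) s = exp (- e * t) * exp (- e * t).
    by rewrite /Rpower ln_exp -exp_plus; congr exp; rewrite /e; field.
  have tS : S <= t by have := Rmax_r T S; rewrite -/T'; lra.
  have := HS t tS; rewrite Rabs_right; last exact/Rle_ge/Rlt_le/exp_pos.
  have ee := exp_pos (- e * t); set E := exp _ in ee *.
  move=> h1 h2.
  have h3 : K * Rpower A s * E <= e * (m + al + e) / 2.
    have -> : e * (m + al + e) / 2 = K * Rpower A s * X by rewrite /X; field; split; lra.
    by apply: Rmult_le_compat_l; nra.
  have : K * Rpower (Y t) s <= K * (Rpower A s * (E * E)) by apply: Rmult_le_compat_l; lra.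
  nra.
(* The factor 2 pays for the correction, which removes at most half of the leading term because
   [T' >= 0]; hence [Y T' <= Z T']. *)
pose B := 2 * Y T' * exp (m * T').
have B0 : 0 < B by do 2?apply: Rmult_lt_0_compat => //; [lra | exact: exp_pos].
pose Z t := B * exp (- m * t) - B / 2 * exp (- (m + e) * t).
exists B, T'; split => // t Ht.
have Zle u : Z u <= B * exp (- m * u).
  have : 0 < B / 2 * exp (- (m + e) * u) by apply: Rmult_lt_0_compat; [lra | exact: exp_pos].
  by rewrite /Z; lra.
apply: Rle_trans (Zle t).
move: t Ht.
apply: (comparison (c := fun t => K * Rpower (Y t) s) (k := al * m) (d := 2 * al - N) dY dY1
   (Z1 := fun t => - m * B * exp (- m * t) - (- (m + e) * (B / 2) * exp (- (m + e) * t)))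
   (Z2 := fun t => - m * (- m * B) * exp (- m * t) - (- (m + e) * (- (m + e) * (B / 2)) * exp (- (m + e) * t)))).
- by move=> t; apply: is_derive_minus; exact: dexp.
- by move=> t; apply: is_derive_minus; exact: dexp.
- by move=> t Ht; have := csmall t ltac:(lra); nra.
- by move=> t Ht; apply: HY; lra.
- move=> t Ht; have := cfast t Ht; set c := K * _ => c1.
  have c0 : 0 < c by apply: Rmult_lt_0_compat => //; exact: exp_pos.
  have -> : - m * (- m * B) * exp (- m * t) - - (m + e) * (- (m + e) * (B / 2)) * exp (- (m + e) * t) -
    (2 * al - N) * (- m * B * exp (- m * t) - - (m + e) * (B / 2) * exp (- (m + e) * t)) - (al * m - c) * Z t
    = c * Z t - e * (m + al + e) / 2 * exp (- (m + e) * t) * B.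
    by rewrite /Z /m; field.
  have : c * Z t <= c * (B * exp (- m * t)) by apply: Rmult_le_compat_l; [lra | exact: Zle].
  have -> : - (m + e) * t = - e * t + - m * t by ring.
  rewrite exp_plus; have em := exp_pos (- m * t).
  have : c * (B * exp (- m * t)) <= e * (m + al + e) / 2 * exp (- e * t) * (B * exp (- m * t)).
    by apply: Rmult_le_compat_r => //; nra.
  lra.
- exact: Y0.
- apply: tends0_ext (tends0_plus (tends0_scal B (tends0_exp m0)) (tends0_scal (- (B / 2)) (tends0_exp (_ : 0 < m + e)))).
    by move=> t; rewrite /Z; ring.
  lra.
- have -> : Z T' = Y T' * (2 - exp (- e * T')).
    rewrite /Z /B; have -> : - (m + e) * T' = - m * T' + - e * T' by ring.
    rewrite exp_plus.
    have E : exp (m * T') * exp (- m * T') = 1 by rewrite -exp_plus (_ : m * T' + - m * T' = 0) ?exp_0 //; ring.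
    have -> : 2 * Y T' * exp (m * T') * exp (- m * T') - 2 * Y T' * exp (m * T') / 2 * (exp (- m * T') * exp (- e * T'))
     = Y T' * (exp (m * T') * exp (- m * T')) * (2 - exp (- e * T')) by field.
    by rewrite E; ring.
  have : exp (- e * T') <= exp 0.
    have : - e * T' <= 0 by nra.
    by case=> [h|->]; [exact/Rlt_le/exp_increasing | lra].
  rewrite exp_0; have := Yp T'; nra.
Qed.

Lemma forbidden_level (f : R -> R) T l : (forall t, continuity_pt f t) ->
  (forall t, T <= t -> f t <> l) ->
  (forall t, T <= t -> f t < l) \/ (forall t, T <= t -> l < f t).
Proof.
move=> cf Hl.
have cross a b : T <= a -> T <= b -> f a < l -> l < f b -> False.
  move=> Ta Tb fa fb.
  have [x [Hx E]] := IVT_gen f a b l (fun x => cf x) (conj (Rle_trans _ _ _ (Rmin_l _ _) (Rlt_le _ _ fa)) (Rle_trans _ _ _ (Rlt_le _ _ fb) (Rmax_r _ _))).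
  apply: (Hl x) => //; have := Rmin_glb _ _ _ Ta Tb; lra.
have ne : f T <> l by apply: Hl; lra.
case: (Rdichotomy _ _ ne) => h; [left | right] => t Ht.
  case: (Rdichotomy _ _ (Hl t Ht)) => // h2; exfalso; apply: (@cross T t) => //; lra.
case: (Rdichotomy _ _ (Hl t Ht)) => // h2; exfalso; apply: (@cross t T) => //; lra.
Qed.

(** By the intermediate value theorem [f] ends on one side of each small level: above one of them,
    or below all of them. The time after which a level is avoided may depend on the level. *)
Lemma zero_or_away (f : R -> R) e0 : 0 < e0 -> (forall t, continuity_pt f t) -> (forall t, 0 < f t) ->
  (forall e, 0 < e <= e0 -> exists T, forall t, T <= t -> f t <> e) ->
  tends0 f \/ exists e T, 0 < e <= e0 /\ forall t, T <= t -> e < f t.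
Proof.
move=> e00 cf fp H.
case: (classic (exists e T, 0 < e <= e0 /\ forall t, T <= t -> e < f t)) => [|nex]; first by right.
left=> e ep; pose e' := Rmin e e0.
have e'p : 0 < e' <= e0 by split; [exact: Rmin_glb_lt | exact: Rmin_r].
have [T HT] := H e' e'p.
case: (forbidden_level cf HT) => h.
  exists T => t Ht; rewrite Rabs_right; last exact/Rle_ge/Rlt_le.
  by apply: Rlt_le_trans (h t Ht) (Rmin_l _ _).
by case: nex; exists e', T.
Qed.

Lemma Rpower_small s x e : 0 < s -> 0 < x -> 0 < e -> e <= Rpower x (/ s) -> Rpower e s <= x.
Proof.
move=> s0 x0 e0 h.
have : Rpower e s <= Rpower (Rpower x (/ s)) s by apply: Rpower_le_l; lra.
by rewrite Rpower_mult Rinv_l ?Rpower_1 //; lra.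
Qed.

(** Makes [U + V] satisfy one scalar inequality with a superlinear loss: by monotonicity every
    argument may be raised to [a + b]. *)
Lemma nonlin_sum_le q mu1 mu2 be a b : 0 < q -> 0 < mu1 -> 0 < mu2 -> 0 < be -> 0 < a -> 0 < b ->
  nonlin q mu1 be a b + nonlin q mu2 be b a <= (mu1 + mu2 + 2 * be) * Rpower (a + b) (2 * q) * (a + b).
Proof.
move=> q0 m1 m2 b0 ap bp.
have -> : (mu1 + mu2 + 2 * be) * Rpower (a + b) (2 * q) * (a + b) = (mu1 + mu2 + 2 * be) * Rpower (a + b) (2 * q + 1).
  by rewrite Rpower_succ; [ring | lra].
have aux mu x y : 0 < mu -> 0 < x -> 0 < y -> x <= a + b -> y <= a + b ->
    nonlin q mu be x y <= (mu + be) * Rpower (a + b) (2 * q + 1).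
  move=> mu0 x0 y0 xw yw; apply: Rle_trans (nonlin_le q0 mu0 b0 x0 y0 xw yw) _.
  rewrite /nonlin Rmult_assoc -Rpower_plus (_ : q + (q + 1) = 2 * q + 1); [lra | ring].
have h1 := aux mu1 a b m1 ap bp ltac:(lra) ltac:(lra).
have h2 := aux mu2 b a m2 bp ap ltac:(lra) ltac:(lra).
lra.
Qed.

(** * Alternatives at infinity for the coupled system *)

Section Alternatives.
Variables (N al q mu1 mu2 be : R) (U U1 V V1 : R -> R).
Hypothesis ef : emden_fowler N al q mu1 mu2 be U U1 V V1.

Lemma ef_continuous t : continuity_pt U t /\ continuity_pt V t.
Proof.
have [_ _ P dU dV] := ef.
by split; [have [h _] := dU t | have [h _] := dV t]; exact: is_derive_cont h.
Qed.

Lemma ef_no_semi s T : q < 1 -> 0 < s -> tends0 U -> (forall t, T <= t -> s <= V t) -> False.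
Proof.
move=> q1 s0 U0 HV.
have [[al0 alN alN2] [q0 m1 m2 b0] P dU dV] := ef.
(* [oscillation] asks for [d ^ 2 < 4 * K]; the choice [K = d ^ 2] satisfies it since [d > 0]. *)
pose d := 2 * al - N; pose k := al * (N - al); pose K := d ^ 2.
have d0 : 0 < d by rewrite /d; lra.
have k0 : 0 < k by apply: Rmult_lt_0_compat; lra.
have K0 : 0 < K by apply: pow_lt.
have bs : 0 < be * Rpower s (q + 1) by apply: Rmult_lt_0_compat => //; exact: exp_pos.
(* Where [U^(1-q) <= x], the coupling term is at least [(K + k) * U]: it cancels the growth [k * U]
   and still leaves [K * U]. *)
pose x := be * Rpower s (q + 1) / (K + k).
have x0 : 0 < x by apply: Rdiv_lt_0_compat; lra.
have [|S HS] := U0 (Rpower x (/ (1 - q))); first exact: exp_pos.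
apply: (@oscillation U U1 (fun t => d * U1 t + k * U t - nonlin q mu1 be (U t) (V t)) d K (Rmax T S)).
- by move: K0; rewrite /K; lra.
- by move=> t; case: (P t).
- by move=> t; case: (dU t).
- by move=> t; case: (dU t).
move=> t Ht; have [Up Vp] := P t.
have tT : T <= t by have := Rmax_l T S; lra.
have tS : S <= t by have := Rmax_r T S; lra.
have := HS t tS; rewrite Rabs_right; last exact/Rle_ge/Rlt_le.
move=> Ux; have Us : Rpower (U t) (1 - q) <= x by apply: Rpower_small => //; lra.
have Vs : Rpower s (q + 1) <= Rpower (V t) (q + 1) by apply: Rpower_le_l; [lra | lra | exact: HV].
have E : U t = Rpower (U t) (1 - q) * Rpower (U t) q.
  by rewrite -Rpower_plus (_ : 1 - q + q = 1) ?Rpower_1 //; ring.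
have Uq := exp_pos (q * ln (U t)); rewrite -/(Rpower (U t) q) in Uq.
have h1 : (K + k) * U t <= be * Rpower s (q + 1) * Rpower (U t) q.
  have -> : be * Rpower s (q + 1) = (K + k) * x by rewrite /x; field; lra.
  rewrite {1}E Rmult_assoc; apply: Rmult_le_compat_l; first lra.
  by apply: Rmult_le_compat_r; lra.
have h2 : be * Rpower s (q + 1) * Rpower (U t) q <= be * Rpower (V t) (q + 1) * Rpower (U t) q.
  by apply: Rmult_le_compat_r; [lra | apply: Rmult_le_compat_l; lra].
have h3 : 0 < mu1 * Rpower (U t) (2 * q + 1) by apply: Rmult_lt_0_compat => //; exact: exp_pos.
by rewrite /nonlin; lra.
Qed.

Lemma ef_fast : tends0 (fun t => U t + V t) -> exists C T, 0 < C /\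
  forall t, T <= t -> U t <= C * exp (- (N - al) * t) /\ V t <= C * exp (- (N - al) * t).
Proof.
move=> W0.
have [[al0 alN alN2] [q0 m1 m2 b0] P dU dV] := ef.
have [|||||||||C [T [C0 HC]]] := @exact_decay N al (mu1 + mu2 + 2 * be) (2 * q) 0 (fun t => U t + V t) (fun t => U1 t + V1 t)
  (fun t => ((2 * al - N) * U1 t + al * (N - al) * U t - nonlin q mu1 be (U t) (V t)) +
            ((2 * al - N) * V1 t + al * (N - al) * V t - nonlin q mu2 be (V t) (U t))) => //; try lra.
- by move=> t; case: (P t); lra.
- by move=> t; case: (dU t) => A _; case: (dV t) => B _; exact: is_derive_plus.
- by move=> t; case: (dU t) => _ A; case: (dV t) => _ B; exact: is_derive_plus.
- move=> t _; have [Up Vp] := P t.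
  have := nonlin_sum_le q0 m1 m2 b0 Up Vp; lra.
exists C, T; split => // t Ht; have := HC t Ht; have := P t; lra.
Qed.

(** Since [U] and [V] are bounded by [M], the whole nonlinearity is at most a constant times
    [U^(q-1) * U]. For [q > 1] the factor [U^(q-1)] vanishes with [U], so [exact_decay] applies with
    [s = q - 1]. *)
Lemma ef_semi_fast : 1 < q -> tends0 U -> exists C T, 0 < C /\
  forall t, T <= t -> U t <= C * exp (- (N - al) * t).
Proof.
move=> q1 U0.
have [[al0 alN alN2] [q0 m1 m2 b0] P dU dV] := ef.
have [M [M1 HM]] := ef_bound ef.
have Mp := exp_pos ((q + 1) * ln M); rewrite -/(Rpower M (q + 1)) in Mp.
apply: (@exact_decay N al ((mu1 + be) * Rpower M (q + 1)) (q - 1) 0 U U1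
  (fun t => (2 * al - N) * U1 t + al * (N - al) * U t - nonlin q mu1 be (U t) (V t))) => //; try lra.
- by apply: Rmult_lt_0_compat; lra.
- by move=> t; case: (P t).
- by move=> t; case: (dU t).
- by move=> t; case: (dU t).
move=> t t0; have [Up Vp] := P t; have [UM VM] := HM t t0.
have h1 : Rpower (U t) (q + 1) <= Rpower M (q + 1) by apply: Rpower_le_l; lra.
have h2 : Rpower (V t) (q + 1) <= Rpower M (q + 1) by apply: Rpower_le_l; lra.
suff : nonlin q mu1 be (U t) (V t) <= (mu1 + be) * Rpower M (q + 1) * (Rpower (U t) (q - 1) * U t) by lra.
rewrite -Rpower_succ // (_ : q - 1 + 1 = q); last ring.
have Uq := exp_pos (q * ln (U t)); rewrite -/(Rpower (U t) q) in Uq.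
rewrite /nonlin (_ : 2 * q + 1 = q + (q + 1)) ?(Rpower_plus q (q + 1)); last ring.
have h3 : mu1 * Rpower (U t) (q + 1) <= mu1 * Rpower M (q + 1) by apply: Rmult_le_compat_l; lra.
have h4 : be * Rpower (V t) (q + 1) <= be * Rpower M (q + 1) by apply: Rmult_le_compat_l; lra.
have : Rpower (U t) q * (mu1 * Rpower (U t) (q + 1) + be * Rpower (V t) (q + 1)) <=
  Rpower (U t) q * (mu1 * Rpower M (q + 1) + be * Rpower M (q + 1)) by apply: Rmult_le_compat_l; lra.
lra.
Qed.

(** With [k = al * (N - al)], on a small level [U + V = e] the nonlinearities sum to at most
    [k * e / 2], so the two equilibrium defects sum to at least [k * e / 2]; but they tend to 0. *)
Lemma ef_total_alternative : tends0 (fun t => U t + V t) \/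
  exists s T, 0 < s /\ forall t, T <= t -> s < U t + V t.
Proof.
have [[al0 alN alN2] [q0 m1 m2 b0] P dU dV] := ef.
have [g1 g2] := ef_equilibrium ef.
have k0 : 0 < al * (N - al) by apply: Rmult_lt_0_compat; lra.
set k := al * (N - al) in k0 g1 g2.
pose K := mu1 + mu2 + 2 * be; have K0 : 0 < K by rewrite /K; lra.
have x0 : 0 < k / (2 * K) by apply: Rdiv_lt_0_compat; lra.
have [||||h|[e [T [[e0 _] h]]]] := @zero_or_away (fun t => U t + V t) (Rpower (k / (2 * K)) (/ (2 * q))).
- exact: exp_pos.
- by move=> t; have [A B] := ef_continuous t; exact: continuity_pt_plus.
- by move=> t; case: (P t); lra.
- move=> e [e0 He].
  have [|T HT] := tends0_plus g1 g2 (eps := k * e / 2); first by have := Rmult_lt_0_compat _ _ k0 e0; lra.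
  exists T => t Ht E.
  have [Up Vp] := P t.
  have := HT t Ht; have := nonlin_sum_le q0 m1 m2 b0 Up Vp; rewrite -/K E.
  have : Rpower e (2 * q) <= k / (2 * K) by apply: Rpower_small => //; lra.
  move/(Rmult_le_compat_l K _ _ (Rlt_le _ _ K0)).
  have -> : K * (k / (2 * K)) = k / 2 by field; lra.
  move/(Rmult_le_compat_r e _ _ (Rlt_le _ _ e0)) => h1 h2 /Rabs_def2 [h3 _].
  have : k * U t + k * V t = k * e by rewrite -E; ring.
  lra.
- by left.
- by right; exists e, T.
Qed.

(** On a small level [U = e] the coupling has order [e^q], the linear term order [e]. For [q < 1]
    the coupling wins, because [e <= s / 2] forces [V >= s / 2]; for [q > 1] the linear term wins,
    because [V] is bounded. Either way the equilibrium defect cannot be close to 0 on that level. *)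
Lemma ef_component_alternative s T : q <> 1 -> 0 < s -> (forall t, T <= t -> s < U t + V t) ->
  tends0 U \/ exists e T, 0 < e /\ forall t, T <= t -> e < U t.
Proof.
move=> qn1 s0 HW.
have [[al0 alN alN2] [q0 m1 m2 b0] P dU dV] := ef.
have [g1 _] := ef_equilibrium ef.
have k0 : 0 < al * (N - al) by apply: Rmult_lt_0_compat; lra.
set k := al * (N - al) in k0 g1.
suff [e0 [e00 He]] : exists e0, 0 < e0 /\ forall e, 0 < e <= e0 -> exists T, forall t, T <= t -> U t <> e.
  have [||h|[e [T' [[e1 _] h]]]] := zero_or_away e00 _ _ He.
  - by move=> t; case: (ef_continuous t).
  - by move=> t; case: (P t).
  - by left.
  - by right; exists e, T'.
case: (Rdichotomy _ _ qn1) => q1.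
- have bs : 0 < be * Rpower (s / 2) (q + 1) by apply: Rmult_lt_0_compat => //; exact: exp_pos.
  pose x := be * Rpower (s / 2) (q + 1) / (2 * k).
  have x0 : 0 < x by apply: Rdiv_lt_0_compat; lra.
  exists (Rmin (s / 2) (Rpower x (/ (1 - q)))); split; first by apply: Rmin_glb_lt; [lra | exact: exp_pos].
  move=> e [e0 He].
  have es : e <= s / 2 := Rle_trans _ _ _ He (Rmin_l _ _).
  have ex : Rpower e (1 - q) <= x.
    by apply: Rpower_small => //; [lra | exact: Rle_trans He (Rmin_r _ _)].
  have [|S HS] := g1 (k * e); first exact: Rmult_lt_0_compat.
  exists (Rmax T S) => t Ht E.
  have [Up Vp] := P t.
  have tT : T <= t by have := Rmax_l T S; lra.
  have tS : S <= t by have := Rmax_r T S; lra.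
  have Vs : s / 2 <= V t by have := HW t tT; rewrite E; lra.
  have h1 : Rpower (s / 2) (q + 1) <= Rpower (V t) (q + 1) by apply: Rpower_le_l; lra.
  have Ee : e = Rpower e (1 - q) * Rpower e q.
    by rewrite -Rpower_plus (_ : 1 - q + q = 1) ?Rpower_1 //; ring.
  have eq := exp_pos (q * ln e); rewrite -/(Rpower e q) in eq.
  have h2 : 2 * k * e <= be * Rpower (s / 2) (q + 1) * Rpower e q.
    have -> : be * Rpower (s / 2) (q + 1) = 2 * k * x by rewrite /x; field; lra.
    rewrite (Rmult_assoc _ x) {1}Ee; apply: Rmult_le_compat_l; first lra.
    by apply: Rmult_le_compat_r; lra.
  have h3 : be * Rpower (s / 2) (q + 1) * Rpower e q <= be * Rpower (V t) (q + 1) * Rpower e q.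
    by apply: Rmult_le_compat_r; [lra | apply: Rmult_le_compat_l; lra].
  have h4 : 0 < mu1 * Rpower e (2 * q + 1) by apply: Rmult_lt_0_compat => //; exact: exp_pos.
  have /Rabs_def2 [_] := HS t tS; rewrite /nonlin E; lra.
- have [M [M1 HM]] := ef_bound ef.
  have Mp := exp_pos ((q + 1) * ln M); rewrite -/(Rpower M (q + 1)) in Mp.
  pose K := (mu1 + be) * Rpower M (q + 1).
  have K0 : 0 < K by apply: Rmult_lt_0_compat; lra.
  have x0 : 0 < k / (2 * K) by apply: Rdiv_lt_0_compat; lra.
  exists (Rpower (k / (2 * K)) (/ (q - 1))); split; first exact: exp_pos.
  move=> e [e0 He].
  have ex : Rpower e (q - 1) <= k / (2 * K) by apply: Rpower_small => //; lra.
  have [|S HS] := g1 (k * e / 2); first by have := Rmult_lt_0_compat _ _ k0 e0; lra.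
  exists (Rmax 0 S) => t Ht E.
  have [Up Vp] := P t.
  have t0 : 0 <= t by have := Rmax_l 0 S; lra.
  have tS : S <= t by have := Rmax_r 0 S; lra.
  have [UM VM] := HM t t0.
  have /Rabs_def2 [h _] := HS t tS; move: h; rewrite /nonlin E.
  have h1 : Rpower e (q + 1) <= Rpower M (q + 1) by apply: Rpower_le_l; lra.
  have h2 : Rpower (V t) (q + 1) <= Rpower M (q + 1) by apply: Rpower_le_l; lra.
  have Uq := exp_pos (q * ln e); rewrite -/(Rpower e q) in Uq.
  rewrite (_ : 2 * q + 1 = q + (q + 1)) ?(Rpower_plus q (q + 1)); last ring.
  have h3 : mu1 * Rpower e (q + 1) <= mu1 * Rpower M (q + 1) by apply: Rmult_le_compat_l; lra.
  have h4 : be * Rpower (V t) (q + 1) <= be * Rpower M (q + 1) by apply: Rmult_le_compat_l; lra.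
  have h5 : Rpower e q * (mu1 * Rpower e (q + 1) + be * Rpower (V t) (q + 1)) <= Rpower e q * K.
    by apply: Rmult_le_compat_l; rewrite /K; lra.
  have h6 : Rpower e q * K <= k * e / 2.
    have -> : Rpower e q = Rpower e (q - 1) * e by rewrite -Rpower_succ //; congr Rpower; ring.
    have := Rmult_le_compat_l (K * e) _ _ ltac:(nra) ex.
    have -> : K * e * (k / (2 * K)) = k * e / 2 by field; lra.
    lra.
  lra.
Qed.

End Alternatives.

Lemma ef_alternatives N al q mu1 mu2 be U U1 V V1 : emden_fowler N al q mu1 mu2 be U U1 V V1 -> q <> 1 ->
  [\/ exists C T, 0 < C /\ forall t, T <= t -> U t <= C * exp (- (N - al) * t) /\ V t <= C * exp (- (N - al) * t),
      exists c T, 0 < c /\ forall t, T <= t -> c < U t /\ c < V t,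
      exists C c T, [/\ 0 < C, 0 < c & forall t, T <= t -> U t <= C * exp (- (N - al) * t) /\ c < V t] |
      exists C c T, [/\ 0 < C, 0 < c & forall t, T <= t -> V t <= C * exp (- (N - al) * t) /\ c < U t]].
Proof.
move=> ef q1; have fe := emden_fowler_sym ef.
case: (ef_total_alternative ef) => [/(ef_fast ef)|[s [T [s0 HW]]]]; first by constructor 1.
have HW' t : T <= t -> s < V t + U t by move/HW; lra.
have semi N' al' q' mu1' mu2' be' X X1 Y Y1 : emden_fowler N' al' q' mu1' mu2' be' X X1 Y Y1 -> q' <> 1 -> tends0 X ->
  (forall t, T <= t -> s < X t + Y t) ->
  exists C c T, [/\ 0 < C, 0 < c & forall t, T <= t -> X t <= C * exp (- (N' - al') * t) /\ c < Y t].
  move=> {HW HW' ef fe} ef q1' X0 HW.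
  have [|S HS] := X0 (s / 2); first lra.
  have HY t : Rmax T S <= t -> s / 2 < Y t.
    move=> Ht; have := HW t (Rle_trans _ _ _ (Rmax_l _ _) Ht).
    have /Rabs_def2 := HS t (Rle_trans _ _ _ (Rmax_r _ _) Ht); lra.
  case: (Rdichotomy _ _ q1') => q2.
    have s2 : 0 < s / 2 by lra.
    by case: (ef_no_semi ef q2 s2 X0 (T := Rmax T S)) => t /HY /Rlt_le.
  have [C [T' [C0 HC]]] := ef_semi_fast ef q2 X0.
  exists C, (s / 2), (Rmax (Rmax T S) T'); split => //; first lra.
  move=> t Ht; split; first exact: HC (Rle_trans _ _ _ (Rmax_r _ _) Ht).
  exact: HY (Rle_trans _ _ _ (Rmax_l _ _) Ht).
case: (ef_component_alternative ef q1 s0 HW) => [U0|[e [S [e0 HU]]]].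
  by constructor 3; exact: semi ef q1 U0 HW.
case: (ef_component_alternative fe q1 s0 HW') => [V0|[e' [S' [e'0 HV]]]].
  by constructor 4; exact: semi fe q1 V0 HW'.
constructor 2; exists (Rmin e e'), (Rmax S S'); split; first exact: Rmin_glb_lt.
move=> t Ht; split.
  by apply: Rle_lt_trans (Rmin_l _ _) (HU t (Rle_trans _ _ _ (Rmax_l _ _) Ht)).
by apply: Rle_lt_trans (Rmin_r _ _) (HV t (Rle_trans _ _ _ (Rmax_r _ _) Ht)).
Qed.

(** * Coordinates and Laplacians *)

HB.instance Definition _ := Monoid.isComLaw.Build R 0 Rplus
  (fun x y z => esym (Rplus_assoc x y z)) Rplus_comm Rplus_0_l.

Lemma sumR_ext n (F G : 'I_n -> R) : (forall i, F i = G i) -> sumR F = sumR G.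
Proof. by move=> H; apply: eq_bigr => i _. Qed.

Lemma sumR_plus n (F G : 'I_n -> R) : sumR (fun i => F i + G i) = sumR F + sumR G.
Proof. by rewrite /sumR big_split. Qed.

Lemma sumR_scal n c (F : 'I_n -> R) : sumR (fun i => c * F i) = c * sumR F.
Proof.
rewrite /sumR; apply: (big_ind2 (fun a b => a = c * b)) => //; first by rewrite Rmult_0_r.
by move=> x1 x2 y1 y2 -> ->; rewrite Rmult_plus_distr_l.
Qed.

Lemma sumR_exchange n m (F : 'I_n -> 'I_m -> R) :
  sumR (fun i => sumR (fun j => F i j)) = sumR (fun j => sumR (fun i => F i j)).
Proof. exact: exchange_big. Qed.

Lemma sumR_delta n (i : 'I_n) (F : 'I_n -> R) : sumR (fun j => (if j == i then 1 else 0) * F j) = F i.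
Proof.
rewrite /sumR (bigD1 i) //= eqxx big1; first by ring.
by move=> j /negbTE ->; ring.
Qed.

Lemma sumR_const n c : sumR (fun _ : 'I_n => c) = INR n * c.
Proof.
rewrite /sumR; elim: n => [|n IH]; first by rewrite big_ord0 /=; ring.
by rewrite big_ord_recr /= IH; case: n {IH} => [|n] /=; ring.
Qed.

Lemma sumR_ge0 n (F : 'I_n -> R) : (forall i, 0 <= F i) -> 0 <= sumR F.
Proof. by move=> H; rewrite /sumR; apply: (big_ind (fun x => 0 <= x)) => //; [lra | move=> *; lra]. Qed.

Lemma sumR_term n (F : 'I_n -> R) i : (forall i, 0 <= F i) -> F i <= sumR F.
Proof.
move=> H; rewrite /sumR (bigD1 i) //=.
have : 0 <= \big[Rplus/0]_(j < n | j != i) F j by apply: (big_ind (fun x => 0 <= x)) => //; [lra | move=> *; lra].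
move=> h; rewrite -[X in X <= _]Rplus_0_r; apply: Rplus_le_compat_l; exact: h.
Qed.

(** Squared lengths are quadratic polynomials along coordinate lines, which keeps square roots out
    of the derivatives. *)
Definition nsq n (x : point n) : R := sumR (fun i => x i ^ 2).

Lemma nsq_ge0 n (x : point n) : 0 <= nsq x.
Proof. by apply: sumR_ge0 => i; exact: pow2_ge_0. Qed.

Lemma nsq_coord n (x : point n) i : x i ^ 2 <= nsq x.
Proof. by apply: (sumR_term (F := fun i => x i ^ 2)) => j; exact: pow2_ge_0. Qed.

Lemma norm_nz n (x : point n) : norm x <> 0 <-> 0 < nsq x.
Proof.
rewrite /norm -/(nsq x); split=> h.
  have := nsq_ge0 x => -[] // E; case: h; by rewrite -E sqrt_0.
by have := sqrt_lt_R0 _ h; lra.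
Qed.

Lemma norm_sq n (x : point n) : norm x * norm x = nsq x.
Proof. by apply: sqrt_sqrt; exact: nsq_ge0. Qed.

Lemma nsq_nz n (x : point n) : 0 < nsq x -> exists i, x i <> 0.
Proof.
move=> h; apply: NNPP => H.
suff : nsq x = 0 by lra.
rewrite /nsq (sumR_ext (G := fun _ => 0)); first by rewrite sumR_const; ring.
move=> i; have -> : x i = 0 by apply: NNPP => hi; apply: H; exists i.
by rewrite /=; ring.
Qed.

Lemma nsq_upd n (x : point n) i t : nsq (upd x i t) = nsq x + 2 * t * x i + t ^ 2.
Proof.
rewrite /nsq (sumR_ext (G := fun j => x j ^ 2 + (if j == i then 1 else 0) * (2 * t * x j + t ^ 2))).
  by rewrite sumR_plus sumR_delta; ring.
by move=> j; rewrite /upd; case: (j == i) => /=; ring.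
Qed.

Lemma upd_upd n (x : point n) i s t : upd (upd x i s) i t = upd x i (s + t).
Proof. by apply: functional_extensionality => j; rewrite /upd; case: (j == i) => //; ring. Qed.

Lemma upd0 n (x : point n) i : upd x i 0 = x.
Proof. by apply: functional_extensionality => j; rewrite /upd; case: (j == i) => //; ring. Qed.

Lemma psub_upd n (x a : point n) i t : psub (upd x i t) a = upd (psub x a) i t.
Proof. by apply: functional_extensionality => j; rewrite /upd /psub; case: (j == i) => //; ring. Qed.

(** * Sequential continuity, jets and pointwise Laplacians *)

Definition conv n (y : nat -> point n) (x : point n) : Prop :=
  forall j, is_lim_seq (fun k => y k j) (x j).

Definition cont_seq n (g : point n -> R) (x : point n) : Prop :=
  forall y, conv y x -> is_lim_seq (fun k => g (y k)) (g x).

Lemma is_lim_seq_sumR n (F : 'I_n -> nat -> R) (l : 'I_n -> R) :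
  (forall i, is_lim_seq (F i) (l i)) -> is_lim_seq (fun k => sumR (fun i => F i k)) (sumR l).
Proof.
move=> H; rewrite /sumR; elim: (index_enum _) => [|i s IH].
  by apply: (is_lim_seq_ext (fun _ => 0)); [move=> k; rewrite big_nil | rewrite big_nil; exact: is_lim_seq_const].
apply: (is_lim_seq_ext (fun k => F i k + \big[Rplus/0]_(j <- s) F j k)).
  by move=> k; rewrite big_cons.
by rewrite big_cons; exact: is_lim_seq_plus'.
Qed.

Lemma is_lim_seq_eps (u : nat -> R) (l : R) : is_lim_seq u l <->
  forall eps, 0 < eps -> exists K, forall k, (K <= k)%coq_nat -> Rabs (u k - l) < eps.
Proof.
split=> [/is_lim_seq_spec H eps e0|H]; first exact: (H (mkposreal eps e0)).
by apply/is_lim_seq_spec => eps; exact: (H eps (cond_pos eps)).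
Qed.

Lemma conv_nsq n (y : nat -> point n) x a : conv y x ->
  is_lim_seq (fun k => nsq (psub (y k) a)) (nsq (psub x a)).
Proof.
move=> H; apply: is_lim_seq_sumR => i.
have h : is_lim_seq (fun k => y k i - a i) (x i - a i) by apply: is_lim_seq_minus' => //; exact: is_lim_seq_const.
apply: (is_lim_seq_ext (fun k => (y k i - a i) * (y k i - a i))); first by move=> k; rewrite /psub /=; ring.
have -> : psub x a i ^ 2 = (x i - a i) * (x i - a i) by rewrite /psub; ring.
exact: is_lim_seq_mult'.
Qed.

Definition origin n : point n := fun _ => 0.
Arguments origin n : clear implicits.

Lemma psub0 n (x : point n) : psub x (origin n) = x.
Proof. by apply: functional_extensionality => j; rewrite /psub /origin; ring. Qed.

Lemma cont_at_seq n (g : point n -> R) x : cont_at g x -> cont_seq g x.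
Proof.
move=> H y Hy; apply/is_lim_seq_eps => eps e0.
have [d [d0 Hd]] := H eps e0.
have := conv_nsq (a := x) Hy.
have -> : nsq (psub x x) = 0.
  rewrite /nsq (sumR_ext (G := fun _ => 0)); first by rewrite sumR_const; ring.
  by move=> i; rewrite /psub; ring.
move/is_lim_seq_eps => /(_ (d ^ 2) (pow_lt _ _ d0)) [K HK]; exists K => k /HK.
rewrite Rminus_0_r Rabs_right; last exact/Rle_ge/nsq_ge0.
move=> h; apply: Hd; rewrite /norm -/(nsq _).
by apply: Rsqr_incrst_0; [rewrite Rsqr_sqrt ?/Rsqr; [lra | exact: nsq_ge0] | exact: sqrt_pos | lra].
Qed.

(* First and second derivative at 0; the function itself is only required to be smooth near 0. *)
Definition jet (g : R -> R) (a b : R) : Prop :=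
  exists g1, [/\ locally 0 (fun t => is_derive g t (g1 t)), g1 0 = a & is_derive g1 0 b].

Lemma jet_ext g h a b : (forall t, g t = h t) -> jet g a b -> jet h a b.
Proof.
move=> E [g1 [H1 H2 H3]]; exists g1; split => //.
by apply: filter_imp H1 => t; apply: is_derive_ext.
Qed.

Lemma jet_derive g a b : jet g a b -> is_derive g 0 a.
Proof. by case=> g1 [H1 <- _]; exact: locally_singleton H1. Qed.

Lemma jet_const c : jet (fun _ => c) 0 0.
Proof.
exists (fun _ => 0); split => //; last exact: is_derive_const.
by apply: filter_forall => t; exact: is_derive_const.
Qed.

Lemma jet_poly2 a b c : jet (fun t => a + b * t + c * t ^ 2) b (2 * c).
Proof.
exists (fun t => b + 2 * c * t); split.
- by apply: filter_forall => t; auto_derive => //; ring.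
- by rewrite Rmult_0_r Rplus_0_r.
- by auto_derive => //; ring.
Qed.

Lemma jet_plus g h a b c d : jet g a b -> jet h c d -> jet (fun t => g t + h t) (a + c) (b + d).
Proof.
move=> [g1 [A1 A2 A3]] [h1 [B1 B2 B3]]; exists (fun t => g1 t + h1 t); split.
- by apply: filter_imp (filter_and _ _ A1 B1) => t [? ?]; exact: is_derive_plus.
- by rewrite A2 B2.
- exact: is_derive_plus.
Qed.

Lemma is_derive_prod (f g : R -> R) t a b : is_derive f t a -> is_derive g t b ->
  is_derive (fun s => f s * g s) t (a * g t + f t * b).
Proof. by move=> A B; apply: is_derive_mult => // *; exact: Rmult_comm. Qed.

Lemma jet_mult g h a b c d : jet g a b -> jet h c d ->
  jet (fun t => g t * h t) (a * h 0 + g 0 * c) (b * h 0 + 2 * a * c + g 0 * d).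
Proof.
move=> [g1 [A1 A2 A3]] [h1 [B1 B2 B3]]; exists (fun t => g1 t * h t + g t * h1 t); split.
- by apply: filter_imp (filter_and _ _ A1 B1) => t [? ?]; exact: is_derive_prod.
- by rewrite A2 B2.
- evar_last.
    apply: is_derive_plus; apply: is_derive_prod; [exact: A3 | | | exact: B3].
      exact: locally_singleton B1.
    exact: locally_singleton A1.
  by rewrite /plus /= A2 B2; ring.
Qed.

Lemma jet_scal k g a b : jet g a b -> jet (fun t => k * g t) (k * a) (k * b).
Proof.
move=> H; have := jet_mult (jet_const k) H.
have -> : 0 * g 0 + k * a = k * a by ring.
by have -> : 0 * g 0 + 2 * 0 * a + k * b = k * b by ring.
Qed.

Lemma locally_pos (g : R -> R) x l : is_derive g x l -> 0 < g x -> locally x (fun t => 0 < g t).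
Proof.
move=> H g0; have [d [d0 Hd]] := is_derive_cont_eps H g0.
by exists (mkposreal d d0) => t /Hd /Rabs_def2; lra.
Qed.

Lemma jet_Rpower r g a b : 0 < g 0 -> jet g a b ->
  jet (fun t => Rpower (g t) r) (r * (a / g 0) * Rpower (g 0) r)
    (r * (b / g 0 + (r - 1) * (a / g 0) ^ 2) * Rpower (g 0) r).
Proof.
move=> g0 [g1 [A1 A2 A3]].
have D0 := locally_singleton _ _ A1.
exists (fun t => r * (g1 t / g t) * Rpower (g t) r); split.
- apply: filter_imp (filter_and _ _ A1 (locally_pos D0 g0)) => t [? ?].
  exact: is_derive_Rpower.
- by rewrite A2.
- evar_last.
    apply: is_derive_prod; last by apply: is_derive_Rpower => //; exact: D0.
    by apply: is_derive_scal; apply: is_derive_div; [exact: A3 | exact: D0 | lra].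
  by rewrite /= A2; field; lra.
Qed.

Lemma jet_inv g a b : 0 < g 0 -> jet g a b ->
  jet (fun t => / g t) (- a / g 0 ^ 2) (- b / g 0 ^ 2 + 2 * a ^ 2 / g 0 ^ 3).
Proof.
move=> g0 [g1 [A1 A2 A3]].
have D0 := locally_singleton _ _ A1.
exists (fun t => - g1 t / g t ^ 2); split.
- apply: filter_imp (filter_and _ _ A1 (locally_pos D0 g0)) => t [? ?].
  by apply: is_derive_inv => //; lra.
- by rewrite A2.
- evar_last.
    apply: is_derive_div; [by apply: is_derive_opp; exact: A3 | by apply: is_derive_pow; exact: D0 | have := pow_lt _ 2 g0; lra].
  by rewrite /opp /= A2; field; lra.
Qed.

(** A Laplacian at a single point, read off from jets along the axes: solutions, Kelvin transforms
    and barriers can be added without a common domain or mixed derivatives. *)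
Definition has_lap n (w : point n -> R) (y : point n) (L : R) : Prop :=
  exists a b : 'I_n -> R, (forall i, jet (fun t => w (upd y i t)) (a i) (b i)) /\ L = sumR b.

Lemma lap_plus n (v w : point n -> R) y L M : has_lap v y L -> has_lap w y M ->
  has_lap (fun x => v x + w x) y (L + M).
Proof.
move=> [a [b [H ->]]] [c [d [K ->]]].
exists (fun i => a i + c i), (fun i => b i + d i); split; last by rewrite sumR_plus.
by move=> i; exact: jet_plus.
Qed.

Lemma lap_scal n k (w : point n -> R) y L : has_lap w y L -> has_lap (fun x => k * w x) y (k * L).
Proof.
move=> [a [b [H ->]]]; exists (fun i => k * a i), (fun i => k * b i); split; last by rewrite sumR_scal.
by move=> i; exact: jet_scal.
Qed.

Lemma lap_const n c (y : point n) : has_lap (fun _ => c) y 0.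
Proof.
exists (fun _ => 0), (fun _ => 0); split; last by rewrite sumR_const; ring.
by move=> i; exact: jet_const.
Qed.

Lemma lap_min n (w : point n -> R) y L : has_lap w y L ->
  (forall i, locally 0 (fun t => w y <= w (upd y i t))) -> 0 <= L.
Proof.
move=> [a [b [H ->]]] Hmin; apply: sumR_ge0 => i.
have [g1 [A1 A2 A3]] := H i.
have [d Hd] := filter_and _ _ A1 (Hmin i).
apply: (second_derivative_at_min (f := fun t => w (upd y i t)) (f1 := g1) (x := 0) (d := d)) => //; first exact: cond_pos.
by move=> t Ht; rewrite upd0; apply: Hd.
Qed.

(** With [s] the squared distance, the second derivatives sum to
    [2 * r * s^(r-1) * (n + 2 * (r - 1))], and [r - 1 = - n / 2]. *)
Lemma lap_fundamental n (a y : point n) r : 0 < nsq (psub y a) -> r = - (INR n - 2) / 2 ->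
  has_lap (fun x => Rpower (nsq (psub x a)) r) y 0.
Proof.
move=> s0 Er; pose xi := psub y a; pose s := nsq xi.
exists (fun i => r * (2 * xi i / s) * Rpower s r),
  (fun i => r * (2 / s + (r - 1) * (2 * xi i / s) ^ 2) * Rpower s r); split.
  move=> i; apply: (jet_ext (g := fun t => Rpower (s + 2 * xi i * t + 1 * t ^ 2) r)).
    by move=> t; rewrite psub_upd nsq_upd; congr Rpower; rewrite -/xi -/s; ring.
  have J := jet_poly2 s (2 * xi i) 1; rewrite Rmult_1_r in J.
  have := jet_Rpower r _ J.
  have -> : s + 2 * xi i * 0 + 1 * 0 ^ 2 = s by ring.
  by apply.
rewrite (sumR_ext (G := fun i => Rpower s r * r * (2 / s) + 4 * r * (r - 1) / s ^ 2 * Rpower s r * xi i ^ 2)).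
  rewrite sumR_plus sumR_const sumR_scal -/(nsq xi) -/s Er; field; rewrite -/xi -/s in s0; lra.
by move=> i; field; rewrite -/xi -/s in s0; lra.
Qed.

(** * Chain rule from continuous partial derivatives *)

Lemma choice_fun (A B : Type) (P : A -> B -> Prop) : (forall a, exists b, P a b) -> exists f, forall a, P a (f a).
Proof.
move=> H; exists (fun a => proj1_sig (constructive_indefinite_description _ (H a))) => a.
exact: proj2_sig (constructive_indefinite_description _ (H a)).
Qed.

Lemma sumR_telescope n (g : nat -> R) : sumR (fun i : 'I_n => g i.+1 - g i) = g n - g 0%nat.
Proof.
rewrite /sumR; elim: n => [|n IH]; first by rewrite big_ord0; ring.
by rewrite big_ord_recr /= IH; ring.
Qed.

Lemma line_derive n (g : point n -> R) (y : point n) i t l : has_partial g i (upd y i t) l ->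
  is_derive (fun s => g (upd y i s)) t l.
Proof.
move=> /is_derive_Reals K.
apply: (is_derive_ext (fun s => g (upd (upd y i t) i (s - t)))).
  by move=> s; rewrite upd_upd; congr (g (upd _ _ _)); ring.
evar_last.
  apply: (is_derive_comp (fun s => g (upd (upd y i t) i s)) (fun s => s - t)).
    by rewrite Rminus_diag; exact: K.
  by auto_derive.
by rewrite /scal /= /mult /=; ring.
Qed.

Lemma increment_coord n (f : point n -> R) (D : point n -> R) (x : point n) i h :
  (forall t, Rabs t <= Rabs h -> has_partial f i (upd x i t) (D (upd x i t))) ->
  exists t, Rabs t <= Rabs h /\ f (upd x i h) - f x = D (upd x i t) * h.
Proof.
move=> H.
have bd t : Rmin 0 h <= t <= Rmax 0 h -> Rabs t <= Rabs h.
  rewrite /Rmin /Rmax; case: Rle_dec => h0 Ht.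
    by rewrite !Rabs_right; lra.
  by rewrite !Rabs_left1; lra.
have der t : Rabs t <= Rabs h -> is_derive (fun t => f (upd x i t)) t (D (upd x i t)).
  by move=> /H; exact: line_derive.
have [||t [Ht E]] := MVT_gen (fun t => f (upd x i t)) 0 h (fun t => D (upd x i t)).
- by move=> t Ht; apply: der; apply: bd; lra.
- by move=> t Ht; apply: is_derive_cont (der t _); exact: bd.
exists t; split; first exact: bd.
by rewrite -[X in _ - f X](upd0 x i) E; ring.
Qed.

(** The path from [x] to [y] that changes one coordinate at a time stays in the box spanned by the
    two points; the mean value theorem on the [i]-th edge gives [xi i]. *)
Lemma increments n (f : point n -> R) (D : 'I_n -> point n -> R) (x y : point n) :
  (forall z, (forall j, Rabs (z j - x j) <= Rabs (y j - x j)) -> forall i, has_partial f i z (D i z)) ->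
  exists xi : 'I_n -> point n, (forall i j, Rabs (xi i j - x j) <= Rabs (y j - x j)) /\
    f y - f x = sumR (fun i => D i (xi i) * (y i - x i)).
Proof.
move=> H; pose part k : point n := fun j => if (j < k)%nat then y j else x j.
have box i t : Rabs t <= Rabs (y i - x i) -> forall j, Rabs (upd (part i) i t j - x j) <= Rabs (y j - x j).
  move=> Ht j; rewrite /upd /part; case: eqP => [->|_].
    by rewrite ltnn; have -> : x i + t - x i = t by ring.
  by case: (j < i)%nat; [lra | rewrite Rminus_diag Rabs_R0; exact: Rabs_pos].
have [xi Hxi] : exists xi : 'I_n -> point n, forall i, (forall j, Rabs (xi i j - x j) <= Rabs (y j - x j)) /\
    f (part i.+1) - f (part i) = D i (xi i) * (y i - x i).
  apply: (choice_fun (P := fun (i : 'I_n) (z : point n) => (forall j, Rabs (z j - x j) <= Rabs (y j - x j)) /\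
    f (part i.+1) - f (part i) = D i z * (y i - x i))) => i.
  have -> : part i.+1 = upd (part i) i (y i - x i).
    apply: functional_extensionality => j; rewrite /upd /part ltnS.
    case: eqP => [->|/eqP ne]; first by rewrite leqnn ltnn; ring.
    by rewrite leq_eqVlt; have /negbTE -> : (nat_of_ord j != nat_of_ord i) by [].
  have [t [Ht E]] := @increment_coord n f (D i) (part i) i (y i - x i) (fun t Ht => H _ (box i t Ht) i).
  by exists (upd (part i) i t); split => //; exact: box.
exists xi; split; first by move=> i; exact: (proj1 (Hxi i)).
have En : part n = y by apply: functional_extensionality => j; rewrite /part ltn_ord.
have E0 : part 0%nat = x by apply: functional_extensionality => j.
rewrite -En -E0 -(sumR_telescope n (fun k => f (part k))) En E0.
by apply: sumR_ext => i; have [_ ->] := Hxi i.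
Qed.

(** Links derivatives to [cont_seq]: difference quotients become sequences, for which intermediate
    points can be chosen term by term. *)
Lemma is_derive_seqP (g : R -> R) t l : is_derive g t l <->
  (forall h : nat -> R, (forall k, h k <> 0) -> is_lim_seq h 0 ->
     is_lim_seq (fun k => (g (t + h k) - g t) / h k) l).
Proof.
split=> [/is_derive_Reals H h h0 hl|H].
  apply/is_lim_seq_eps => eps e0; have [d Hd] := H eps e0.
  have /is_lim_seq_eps /(_ d (cond_pos d)) [K HK] := hl.
  by exists K => k /HK; rewrite Rminus_0_r => hk; exact: Hd.
apply/is_derive_Reals => eps e0; apply: NNPP => Hn.
have ex (k : nat) : exists h, [/\ h <> 0, Rabs h < / (INR k + 1) & eps <= Rabs ((g (t + h) - g t) / h - l)].
  apply: NNPP => Hk; apply: Hn.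
  have p : 0 < / (INR k + 1) by apply: Rinv_0_lt_compat; have := pos_INR k; lra.
  exists (mkposreal _ p) => h h0 hd; apply: Rnot_le_lt => hh; apply: Hk; by exists h.
have [h Hh] := choice_fun ex.
have hl : is_lim_seq h 0.
  apply/is_lim_seq_eps => e ep; have [K HK] := archimed_cor1 e ep.
  exists K => k Kk; rewrite Rminus_0_r; have [_ h1 _] := Hh k.
  have Kp : 0 < INR K by have := lt_INR 0 K (proj2 HK).
  have := Rinv_le_contravar (INR K) (INR k + 1) Kp.
  have := le_INR _ _ Kk; case: HK => HK _ ? h2; have : / (INR k + 1) <= / INR K by apply: h2; lra.
  lra.
have /is_lim_seq_eps /(_ eps e0) [K HK] := H h (fun k => let: And3 a _ _ := Hh k in a) hl.
have [_ _] := Hh K; have := HK K (le_n K); lra.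
Qed.

Lemma is_derive_seq_lim (g : R -> R) t l (h : nat -> R) : is_derive g t l -> is_lim_seq h 0 ->
  is_lim_seq (fun k => g (t + h k)) (g t).
Proof.
move=> /is_derive_cont_eps H hl; apply/is_lim_seq_eps => eps e0.
have [d [d0 Hd]] := H eps e0.
have /is_lim_seq_eps /(_ d d0) [K HK] := hl.
exists K => k /HK; rewrite Rminus_0_r => hk; apply: Hd.
by have -> : t + h k - t = h k by ring.
Qed.

Definition C1_punct n (f : point n -> R) (D : 'I_n -> point n -> R) : Prop :=
  forall z, 0 < nsq z -> forall i, has_partial f i z (D i z) /\ cont_seq (D i) z.

(** [increments] turns the difference quotient into a sum of partial derivatives at intermediate
    points; these converge to [g t], where the partial derivatives are continuous. *)
Lemma chain_rule n (f : point n -> R) (D : 'I_n -> point n -> R) (g : R -> point n) (g1 : 'I_n -> R) t :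
  C1_punct f D -> 0 < nsq (g t) -> (forall j, is_derive (fun s => g s j) t (g1 j)) ->
  is_derive (fun s => f (g s)) t (sumR (fun i => D i (g t) * g1 i)).
Proof.
move=> HD nz dg; apply/is_derive_seqP => h h0 hl.
pose x := g t; pose y k := g (t + h k).
have yx : conv y x by move=> j; exact: (is_derive_seq_lim (dg j) hl).
have [i0 xi0] := nsq_nz nz.
(* A nonzero coordinate of [x] keeps the whole box between [x] and [y k] off the origin for large
   [k]. *)
have [K HK] : exists K, forall k, (K <= k)%coq_nat -> Rabs (y k i0 - x i0) < Rabs (x i0).
  have /is_lim_seq_eps := yx i0; apply; exact: Rabs_pos_lt.
have ex k : exists xi : 'I_n -> point n, (forall i j, Rabs (xi i j - x j) <= Rabs (y k j - x j)) /\
   ((K <= k)%coq_nat -> f (y k) - f x = sumR (fun i => D i (xi i) * (y k i - x i))).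
  case: (excluded_middle_informative (K <= k)%coq_nat) => Kk; last first.
    (* Below [K] the intermediate points are set to [x], so that the bound giving their convergence
       holds for every [k]. *)
    by exists (fun _ => x); split => // i j; rewrite Rminus_diag Rabs_R0; exact: Rabs_pos.
  have [|xi [X1 X2]] := @increments n f D x (y k); last by exists xi.
  move=> z Hz i; suff nzz : 0 < nsq z by have [] := HD z nzz i.
  have := nsq_coord z i0.
  have : z i0 <> 0.
    move=> E; have := Hz i0; have := HK k Kk; rewrite E /Rminus Rplus_0_l Rabs_Ropp; lra.
  move=> /pow2_gt_0; lra.
have [xi Hxi] := choice_fun ex.
have cxi i : conv (fun k => xi k i) x.
  move=> j; apply/is_lim_seq_eps => e e0.
  have /is_lim_seq_eps /(_ e e0) [L HL] := yx j.
  by exists L => k /HL; have [/(_ i j) ? _] := Hxi k; lra.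
apply: (is_lim_seq_ext_loc (fun k => sumR (fun i => D i (xi k i) * ((y k i - x i) / h k)))).
  exists K => k Kk; have [_ /(_ Kk) E] := Hxi k; rewrite -/(y k) -/x E.
  rewrite /Rdiv Rmult_comm -sumR_scal; apply: sumR_ext => i; rewrite /Rdiv; ring.
apply: is_lim_seq_sumR => i; apply: is_lim_seq_mult'.
  by have [_ /(_ _ (cxi i))] := HD x nz i.
by have /is_derive_seqP /(_ h h0 hl) := dg i.
Qed.

Lemma is_derive_sumR n (F : 'I_n -> R -> R) (l : 'I_n -> R) t :
  (forall i, is_derive (F i) t (l i)) -> is_derive (fun s => sumR (fun i => F i s)) t (sumR l).
Proof.
move=> H; rewrite /sumR; elim: (index_enum _) => [|i s IH].
  by apply: (is_derive_ext (fun _ => 0)); [move=> k; rewrite big_nil | rewrite big_nil; exact: is_derive_const].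
apply: (is_derive_ext (fun k => F i k + \big[Rplus/0]_(j <- s) F j k)); first by move=> k; rewrite big_cons.
by rewrite big_cons; exact: (is_derive_plus (F i)).
Qed.

Lemma locally_forall_ord n (P : 'I_n -> R -> Prop) x :
  (forall i, locally x (P i)) -> locally x (fun t => forall i, P i t).
Proof.
move=> H.
have {}H (s : seq 'I_n) : locally x (fun t => forall i, i \in s -> P i t).
  elim: s => [|i s IH]; first by apply: filter_forall.
  apply: filter_imp (filter_and _ _ (H i) IH) => t [A B] j; rewrite in_cons => /orP [/eqP ->|] //; exact: B.
by apply: filter_imp (H (enum 'I_n)) => t A i; apply: A; rewrite mem_enum.
Qed.

Lemma jet_chain n (f : point n -> R) (D1 : 'I_n -> point n -> R) (D2 : 'I_n -> 'I_n -> point n -> R)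
   (g : R -> point n) (a b : 'I_n -> R) :
  C1_punct f D1 -> (forall i, C1_punct (D1 i) (D2 i)) -> 0 < nsq (g 0) ->
  (forall j, jet (fun t => g t j) (a j) (b j)) ->
  jet (fun t => f (g t)) (sumR (fun i => D1 i (g 0) * a i))
    (sumR (fun i => sumR (fun j => D2 i j (g 0) * a j) * a i + D1 i (g 0) * b i)).
Proof.
move=> H1 H2 nz J.
have [g1 Hg1] : exists g1 : 'I_n -> R -> R, forall j,
   [/\ locally 0 (fun t => is_derive (fun s => g s j) t (g1 j t)), g1 j 0 = a j & is_derive (g1 j) 0 (b j)].
  exact: choice_fun J.
exists (fun t => sumR (fun i => D1 i (g t) * g1 i t)); split.
- have [i0 xi0] := nsq_nz nz.
  have di0 := jet_derive (J i0).
  have [d [d0 Hd]] := is_derive_cont_eps di0 (Rabs_pos_lt _ xi0).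
  have L1 : locally 0 (fun t => 0 < nsq (g t)).
    exists (mkposreal d d0) => t /Hd Ht; apply: Rlt_le_trans (nsq_coord (g t) i0).
    apply: pow2_gt_0 => E; move: Ht; rewrite E /Rminus Rplus_0_l Rabs_Ropp; lra.
  have L2 : locally 0 (fun t => forall j, is_derive (fun s => g s j) t (g1 j t)).
    by apply: locally_forall_ord => j; have [] := Hg1 j.
  by apply: filter_imp (filter_and _ _ L1 L2) => t [A B]; exact: chain_rule.
- by apply: sumR_ext => i; have [_ -> _] := Hg1 i.
- apply: is_derive_sumR => i; have [_ <- di] := Hg1 i.
  apply: is_derive_prod di; apply: (chain_rule (H2 i) nz) => j.
  exact: jet_derive (J j).
Qed.

(** * The Kelvin transform *)

Lemma jet_ext_loc g h a b : locally 0 (fun t => g t = h t) -> jet g a b -> jet h a b.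
Proof.
move=> /locally_locally E [g1 [H1 H2 H3]]; exists g1; split => //.
by apply: filter_imp (filter_and _ _ E H1) => t [A B]; exact: is_derive_ext_loc A B.
Qed.

Lemma jet_eq g a b a' b' : jet g a b -> a = a' -> b = b' -> jet g a' b'.
Proof. by move=> H <- <-. Qed.

Lemma Rpower_div x y r : 0 < x -> 0 < y -> Rpower (x / y) r = Rpower x r * Rpower y (- r).
Proof.
move=> x0 y0; rewrite /Rdiv -Rpower_mult_distr //; last exact: Rinv_0_lt_compat.
by rewrite /Rpower ln_Rinv //; congr (_ * exp _); ring.
Qed.

(* Here and below [l] is the squared radius of the sphere. *)
Definition inversion n (a : point n) (l : R) (y : point n) : point n :=
  fun j => a j + l / nsq (psub y a) * (y j - a j).

Definition kelvin n (f : point n -> R) (a : point n) (l : R) (y : point n) : R :=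
  Rpower (l / nsq (psub y a)) ((INR n - 2) / 2) * f (inversion a l y).

Definition kron n (i j : 'I_n) : R := if j == i then 1 else 0.

Lemma sumR_kron n (j : 'I_n) (F : 'I_n -> R) : sumR (fun i => kron i j * F i) = F j.
Proof. by rewrite -[RHS](sumR_delta j); apply: sumR_ext => i; rewrite /kron eq_sym. Qed.

Section Kelvin.
Variables (n : nat) (a y : point n) (l : R).
Hypotheses (l0 : 0 < l) (s0 : 0 < nsq (psub y a)).
Let xi := psub y a.
Let s := nsq xi.
Let r := - (INR n - 2) / 2.
Let W := Rpower l (- r) * Rpower s r.

(** [A1 i j] and [A2 i j] are the first and second derivatives along the [i]-th axis of the [j]-th
    component of the inversion at [y]; [w1 i] and [w2 i] are those of the Kelvin weight, whose value
    is [W]. *)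
Let A1 (i j : 'I_n) := l * (kron i j / s - 2 * xi i * xi j / s ^ 2).
Let A2 (i j : 'I_n) := l * ((- 2 / s ^ 2 + 8 * xi i ^ 2 / s ^ 3) * xi j - 4 * xi i * kron i j / s ^ 2).
Let w1 (i : 'I_n) := W * (r * (2 * xi i / s)).
Let w2 (i : 'I_n) := W * (r * (2 / s + (r - 1) * (2 * xi i / s) ^ 2)).

Lemma line_nsq i t : nsq (psub (upd y i t) a) = s + 2 * xi i * t + 1 * t ^ 2.
Proof. by rewrite psub_upd nsq_upd -/xi -/s; ring. Qed.

Lemma line_jet i : jet (fun t => s + 2 * xi i * t + 1 * t ^ 2) (2 * xi i) 2.
Proof. by have := jet_poly2 s (2 * xi i) 1; rewrite Rmult_1_r. Qed.

Lemma line_value i : s + 2 * xi i * 0 + 1 * 0 ^ 2 = s.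
Proof. by ring. Qed.

Lemma s_pos : 0 < s. Proof. exact: s0. Qed.

Lemma kelvin_weight_jet i : jet (fun t => Rpower (l / nsq (psub (upd y i t) a)) ((INR n - 2) / 2)) (w1 i) (w2 i).
Proof.
have sp := s_pos.
pose p t := s + 2 * xi i * t + 1 * t ^ 2.
apply: (jet_ext_loc (g := fun t => Rpower l (- r) * Rpower (p t) r)).
  have p0 : 0 < p 0 by rewrite /p line_value.
  apply: filter_imp (locally_pos (jet_derive (line_jet i)) p0) => t pt.
  rewrite line_nsq Rpower_div //; congr (Rpower _ _ * Rpower _ _); rewrite /r; field.
have := jet_scal (Rpower l (- r)) (jet_Rpower r _ (line_jet i)).
rewrite line_value => /(_ sp) J; apply: jet_eq J _ _; rewrite /w1 /w2 /W; field; lra.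
Qed.

Lemma inversion_jet i j : jet (fun t => inversion a l (upd y i t) j) (A1 i j) (A2 i j).
Proof.
have sp := s_pos.
apply: (jet_ext (g := fun t => a j + l * / (s + 2 * xi i * t + 1 * t ^ 2) * (xi j + kron i j * t + 0 * t ^ 2))).
  move=> t; rewrite /inversion line_nsq /Rdiv; congr (_ + _ * _).
  by rewrite /xi /psub /upd /kron; case: eqP => _; ring.
have J1 := jet_inv (g := fun t => s + 2 * xi i * t + 1 * t ^ 2) _ (line_jet i).
rewrite line_value in J1.
have := jet_plus (jet_const (a j)) (jet_mult (jet_scal l (J1 sp)) (jet_poly2 (xi j) (kron i j) 0)).
rewrite line_value => J; apply: jet_eq J _ _; rewrite /A1 /A2; field; lra.
Qed.

(** The weight is a constant multiple of the fundamental solution with pole [a]. *)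
Lemma kelvin_weight_sum : sumR w2 = 0.
Proof.
have sp := s_pos.
rewrite (sumR_ext (G := fun i => W * r * (2 / s) + 4 * r * (r - 1) / s ^ 2 * W * xi i ^ 2)).
  by rewrite sumR_plus sumR_const sumR_scal -/(nsq xi) -/s /r; field; lra.
by move=> i; rewrite /w2; field; lra.
Qed.

(** The coefficient of [D1 j] in the Laplacian of the Kelvin transform. Its contributions add up to
    a multiple of [4 - 4 * r - 2 * n], which is 0 for the exponent [r = - (n - 2) / 2]. *)
Lemma kelvin_first_order j : sumR (fun i => 2 * w1 i * A1 i j + W * A2 i j) = 0.
Proof.
have sp := s_pos.
rewrite (sumR_ext (G := fun i => kron i j * (W * l * (4 * r - 4) / s ^ 2 * xi i) +
   (W * l * xi j * (8 - 8 * r) / s ^ 3 * xi i ^ 2 + - 2 * W * l * xi j / s ^ 2))).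
  rewrite sumR_plus sumR_kron sumR_plus sumR_scal sumR_const -/(nsq xi) -/s /r; field; lra.
by move=> i; rewrite /w1 /A1 /A2; field; lra.
Qed.

(** The differential of the inversion is [l / s] times the reflection in the hyperplane orthogonal
    to [xi]. *)
Lemma inversion_conformal j k : sumR (fun i => A1 i k * A1 i j) = kron j k * (l / s) ^ 2.
Proof.
have sp := s_pos.
rewrite (sumR_ext (G := fun i => kron i j * (l ^ 2 * (kron i k / s ^ 2 - 2 * xi i * xi k / s ^ 3)) +
   (kron i k * (- 2 * l ^ 2 / s ^ 3 * xi j * xi i) + 4 * l ^ 2 / s ^ 4 * xi j * xi k * xi i ^ 2))).
  rewrite sumR_plus sumR_kron sumR_plus sumR_kron sumR_scal -/(nsq xi) -/s; field; lra.
by move=> i; rewrite /A1; field; lra.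
Qed.

(** The Laplacian of the product splits by the order of the derivatives of [f]: order 0 vanishes by
    harmonicity of the weight, order 1 by [kelvin_first_order], and conformality reduces order 2 to
    the trace of [D2]. *)
Lemma kelvin_lap (f : point n -> R) D1 D2 : C1_punct f D1 -> (forall i, C1_punct (D1 i) (D2 i)) ->
  0 < nsq (inversion a l y) ->
  has_lap (kelvin f a l) y (Rpower (l / s) ((INR n - 2) / 2 + 2) * laplacian_with D2 (inversion a l y)).
Proof.
move=> H1 H2 nz; have sp := s_pos.
pose x := inversion a l y.
pose F1 i := sumR (fun j => D1 j x * A1 i j).
pose F2 i := sumR (fun j => sumR (fun k => D2 j k x * A1 i k) * A1 i j + D1 j x * A2 i j).
have EW : Rpower (l / s) ((INR n - 2) / 2) = W.
  by rewrite Rpower_div // /W; congr (Rpower _ _ * Rpower _ _); rewrite /r; field.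
exists (fun i => w1 i * f x + W * F1 i), (fun i => w2 i * f x + 2 * w1 i * F1 i + W * F2 i); split.
  move=> i.
  have nz0 : 0 < nsq (inversion a l (upd y i 0)) by rewrite upd0.
  have J := jet_chain H1 H2 nz0 (inversion_jet i).
  have := jet_mult (kelvin_weight_jet i) J.
  by rewrite !upd0 -/xi -/s EW.
rewrite sumR_plus sumR_plus.
rewrite (sumR_ext (F := fun i => w2 i * f x) (G := fun i => f x * w2 i)); last by move=> i; ring.
rewrite sumR_scal kelvin_weight_sum Rmult_0_r Rplus_0_l -sumR_plus.
rewrite (sumR_ext (G := fun i => sumR (fun j => D1 j x * (2 * w1 i * A1 i j + W * A2 i j)) +
   W * sumR (fun j => sumR (fun k => D2 j k x * (A1 i k * A1 i j))))).
  rewrite sumR_plus sumR_exchange.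
  rewrite (sumR_ext (G := fun _ => 0)); last first.
    by move=> j; rewrite sumR_scal kelvin_first_order; ring.
  rewrite sumR_const Rmult_0_r Rplus_0_l sumR_scal sumR_exchange.
  rewrite (sumR_ext (G := fun j => (l / s) ^ 2 * D2 j j x)); last first.
    move=> j; rewrite sumR_exchange.
    rewrite (sumR_ext (G := fun k => (if k == j then 1 else 0) * (D2 j k x * (l / s) ^ 2))); last first.
      by move=> k; rewrite sumR_scal inversion_conformal /kron; ring.
    by rewrite sumR_delta; ring.
  rewrite sumR_scal Rpower_plus EW (Rpower_pow 2); last by apply: Rdiv_lt_0_compat.
  by rewrite /laplacian_with -/x; ring.
move=> i; rewrite /F1 /F2 -!sumR_scal -!sumR_plus; apply: sumR_ext => j.
rewrite (sumR_ext (F := fun k => D2 j k x * (A1 i k * A1 i j)) (G := fun k => A1 i j * (D2 j k x * A1 i k))); last by move=> k; ring.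
by rewrite sumR_scal; ring.
Qed.

End Kelvin.

Lemma lap_punct n (f : point n -> R) D1 D2 y : C1_punct f D1 -> (forall i, C1_punct (D1 i) (D2 i)) ->
  0 < nsq y -> has_lap f y (laplacian_with D2 y).
Proof.
move=> H1 H2 nz.
exists (fun i => D1 i y), (fun i => D2 i i y); split => // i.
have J := jet_chain (g := fun t => upd y i t) (a := fun j => kron i j) (b := fun _ => 0) H1 H2.
rewrite upd0 in J; have {J} := J nz.
have Jc j : jet (fun t => upd y i t j) (kron i j) 0.
  have := jet_poly2 (y j) (kron i j) 0; rewrite Rmult_0_r; apply: jet_ext => t.
  by rewrite /upd /kron; case: eqP => _; ring.
move=> /(_ Jc) J; apply: jet_eq J _ _.
  by rewrite -(sumR_delta i (fun j => D1 j y)); apply: sumR_ext => j; rewrite /kron; ring.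
rewrite -(sumR_delta i (fun j => D2 j i y)); apply: sumR_ext => j.
rewrite -(sumR_delta i (fun k => D2 j k y)) (sumR_ext (G := fun k => (if k == i then 1 else 0) * D2 j k y)); last by move=> k; rewrite /kron; ring.
by rewrite /kron; ring.
Qed.

(** * Compactness and minimum principles *)

Lemma lim_subseq (u : nat -> R) (l : R) (phi : nat -> nat) : (forall k, (k <= phi k)%coq_nat) ->
  is_lim_seq u l -> is_lim_seq (fun k => u (phi k)) l.
Proof.
move=> H /is_lim_seq_eps Hu; apply/is_lim_seq_eps => eps /Hu [K HK]; exists K => k Kk.
by apply: HK; exact: PeanoNat.Nat.le_trans Kk (H k).
Qed.

Lemma inv_nat_lim : is_lim_seq (fun k => / (INR k + 1)) 0.
Proof.
apply/is_lim_seq_eps => e ep; have [K [HK K0]] := archimed_cor1 e ep.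
exists K => k Kk; rewrite Rminus_0_r.
have Kp := lt_INR 0 K K0; rewrite /= in Kp.
have kK := le_INR _ _ Kk.
have p : 0 < / (INR k + 1) by apply: Rinv_0_lt_compat; lra.
rewrite Rabs_right; last lra.
have := Rinv_le_contravar (INR K) (INR k + 1) Kp ltac:(lra); lra.
Qed.

Lemma bolzano_1d (u : nat -> R) M : (forall k, Rabs (u k) <= M) ->
  exists phi : nat -> nat, (forall k, (k <= phi k)%coq_nat) /\ exists l : R, is_lim_seq (fun k => u (phi k)) l.
Proof.
move=> H.
have [|l Hl] := Bolzano_Weierstrass u _ (compact_P3 (- M) M).
  by move=> k; have /Rabs_le_between := H k.
have ex (k : nat) : exists p, (k <= p)%coq_nat /\ Rabs (u p - l) < / (INR k + 1).
  have p0 : 0 < / (INR k + 1) by apply: Rinv_0_lt_compat; have := pos_INR k; lra.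
  have [|p [Hp1 Hp2]] := Hl (disc l (mkposreal _ p0)) k; last by exists p.
  by exists (mkposreal _ p0).
have [phi Hphi] := choice_fun ex.
exists phi; split; first by move=> k; case: (Hphi k).
exists l; apply/is_lim_seq_eps => eps e0.
have /is_lim_seq_eps /(_ eps e0) [K HK] := inv_nat_lim.
exists K => k /HK; rewrite Rminus_0_r => /Rabs_def2 [h _]; have [_] := Hphi k; lra.
Qed.

Lemma bolzano_weierstrass n (y : nat -> point n) M : (forall k j, Rabs (y k j) <= M) ->
  exists phi : nat -> nat, (forall k, (k <= phi k)%coq_nat) /\ exists x, conv (fun k => y (phi k)) x.
Proof.
move=> H.
suff [phi [P1 P2]] : exists phi : nat -> nat, (forall k, (k <= phi k)%coq_nat) /\
    forall j, j \in enum 'I_n -> exists l : R, is_lim_seq (fun k => y (phi k) j) l.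
  exists phi; split => //.
  have [x Hx] : exists x : 'I_n -> R, forall j, is_lim_seq (fun k => y (phi k) j) (x j).
    by apply: (choice_fun (P := fun (j : 'I_n) (l : R) => is_lim_seq (fun k => y (phi k) j) l)) => j; apply: P2; rewrite mem_enum.
  by exists x.
elim: (enum _) => [|i s [phi [P1 P2]]]; first by exists (fun k => k).
have [psi [Q1 [l Q2]]] := @bolzano_1d (fun k => y (phi k) i) M (fun k => H _ _).
exists (fun k => phi (psi k)); split.
  by move=> k; exact: PeanoNat.Nat.le_trans (Q1 k) (P1 _).
move=> j; rewrite in_cons => /orP [/eqP ->|/P2 [l' Hl']]; first by exists l.
by exists l'; exact: lim_subseq Q1 Hl'.
Qed.

Definition seq_closed n (K : point n -> Prop) : Prop :=
  forall y x, (forall k, K (y k)) -> conv y x -> K x.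

(** Composition with the arctangent makes the values bounded, so the extremum exists before [w] is
    known to be bounded below; monotonicity brings the inequality back to [w]. *)
Lemma compact_min n (K : point n -> Prop) (w : point n -> R) M : seq_closed K ->
  (forall y, K y -> forall j, Rabs (y j) <= M) -> (forall y, K y -> cont_seq w y) ->
  (exists y, K y) -> exists y, K y /\ forall z, K z -> w y <= w z.
Proof.
move=> Kc Kb wc [y0 Ky0].
have [||m [m1 m2]] := completeness (fun r => exists y, K y /\ r = - atan (w y)).
- by exists (PI / 2) => r [y [_ ->]]; have := atan_bound (w y); lra.
- by exists (- atan (w y0)), y0.
have ex (k : nat) : exists y, K y /\ m - / (INR k + 1) < - atan (w y).
  apply: NNPP => Hn.
  have p0 : 0 < / (INR k + 1) by apply: Rinv_0_lt_compat; have := pos_INR k; lra.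
  suff : m <= m - / (INR k + 1) by lra.
  apply: m2 => r [y [Ky ->]]; apply: Rnot_lt_le => h; apply: Hn; by exists y.
have [y Hy] := choice_fun ex.
have [|phi [P1 [x Hx]]] := @bolzano_weierstrass n y M.
  by move=> k j; apply: Kb; case: (Hy k).
have Kx : K x by apply: Kc Hx => k; case: (Hy (phi k)).
exists x; split => // z Kz.
have lz : - atan (w z) <= m by apply: m1; exists z.
suff lx : m <= - atan (w x).
  apply: Rnot_lt_le => /atan_increasing; lra.
have L1 : is_lim_seq (fun k => m - / (INR (phi k) + 1)) m.
  have := is_lim_seq_minus' _ _ _ _ (is_lim_seq_const m) (lim_subseq P1 inv_nat_lim).
  by rewrite Rminus_0_r.
have L2 : is_lim_seq (fun k => - atan (w (y (phi k)))) (- atan (w x)).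
  apply: (is_lim_seq_continuous (fun r => - atan r) (fun k => w (y (phi k))) (w x)); last exact: wc.
  by apply: continuity_pt_opp; apply: derivable_continuous_pt; exact: derivable_pt_atan.
have := is_lim_seq_le _ _ m (- atan (w x)) _ L1 L2; apply => k.
by have [_] := Hy (phi k); lra.
Qed.

Lemma closed_nsq_le n (a : point n) r : seq_closed (fun y => nsq (psub y a) <= r).
Proof.
move=> y x H /(conv_nsq (a := a)) L.
exact: (is_lim_seq_le _ _ (nsq (psub x a)) r H L (is_lim_seq_const r)).
Qed.

Lemma closed_nsq_ge n (a : point n) r : seq_closed (fun y => r <= nsq (psub y a)).
Proof.
move=> y x H /(conv_nsq (a := a)) L.
exact: (is_lim_seq_le _ _ r (nsq (psub x a)) H (is_lim_seq_const r) L).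
Qed.

Lemma closed_and n (K L : point n -> Prop) : seq_closed K -> seq_closed L -> seq_closed (fun y => K y /\ L y).
Proof.
by move=> HK HL y x H c; split; [apply: HK c => k | apply: HL c => k]; case: (H k).
Qed.

Lemma ball_bounded n (a : point n) r y j : nsq (psub y a) <= r -> Rabs (y j) <= r + 1 + sumR (fun i => Rabs (a i)).
Proof.
move=> h; have h2 : (y j - a j) ^ 2 <= nsq (psub y a) := nsq_coord (psub y a) j.
have h3 : Rabs (y j - a j) <= r + 1.
  have h5 : (y j - a j) * (y j - a j) <= r by lra.
  set d := y j - a j in h5 *; have := pow2_ge_0 (d - 1); have := pow2_ge_0 (d + 1).
  by move=> *; apply/Rabs_le_between; split; nra.
have h4 := sumR_term (F := fun i => Rabs (a i)) j (fun i => Rabs_pos _).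
have := Rabs_triang (y j - a j) (a j); rewrite /= in h4.
have -> : y j - a j + a j = y j by ring.
lra.
Qed.

Lemma locally_nsq_gt n (a y : point n) i r : r < nsq (psub y a) -> locally 0 (fun t => r < nsq (psub (upd y i t) a)).
Proof.
move=> h; have J := jet_poly2 (nsq (psub y a) - r) (2 * psub y a i) 1.
have := locally_pos (jet_derive J); have -> : nsq (psub y a) - r + 2 * psub y a i * 0 + 1 * 0 ^ 2 = nsq (psub y a) - r by ring.
by move=> /(_ ltac:(lra)); apply: filter_imp => t; rewrite psub_upd nsq_upd; lra.
Qed.

Lemma locally_nsq_lt n (a y : point n) i r : nsq (psub y a) < r -> locally 0 (fun t => nsq (psub (upd y i t) a) < r).
Proof.
move=> h; have J := jet_poly2 (r - nsq (psub y a)) (- 2 * psub y a i) (- 1).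
have := locally_pos (jet_derive J); have -> : r - nsq (psub y a) + - 2 * psub y a i * 0 + - 1 * 0 ^ 2 = r - nsq (psub y a) by ring.
by move=> /(_ ltac:(lra)); apply: filter_imp => t; rewrite psub_upd nsq_upd; lra.
Qed.

(** A negative minimum would be interior along every axis and carry a negative Laplacian, against
    [lap_min]. Boundary points enter through the premise [w y < 0]: in the applications [w] is shown
    nonnegative there. *)
Lemma min_principle n (K : point n -> Prop) (w : point n -> R) M : seq_closed K ->
  (forall y, K y -> forall j, Rabs (y j) <= M) -> (forall y, K y -> cont_seq w y) ->
  (forall y, K y -> w y < 0 -> (forall i, locally 0 (fun t => K (upd y i t))) /\ exists L, L < 0 /\ has_lap w y L) ->
  forall y, K y -> 0 <= w y.
Proof.
move=> Kc Kb wc H y Ky; apply: Rnot_lt_le => wy.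
have [|z [Kz Hz]] := compact_min Kc Kb wc; first by exists y.
have wz : w z < 0 by have := Hz y Ky; lra.
have [loc [L [L0 HL]]] := H z Kz wz.
suff : 0 <= L by lra.
by apply: (lap_min HL) => i; apply: filter_imp (loc i) => t; exact: Hz.
Qed.

Lemma cont_seq_plus n (f g : point n -> R) x : cont_seq f x -> cont_seq g x -> cont_seq (fun y => f y + g y) x.
Proof. by move=> Hf Hg y Hy; apply: is_lim_seq_plus'; [exact: Hf | exact: Hg]. Qed.

Lemma cont_seq_mult n (f g : point n -> R) x : cont_seq f x -> cont_seq g x -> cont_seq (fun y => f y * g y) x.
Proof. by move=> Hf Hg y Hy; apply: is_lim_seq_mult'; [exact: Hf | exact: Hg]. Qed.

Lemma cont_seq_const n c (x : point n) : cont_seq (fun _ => c) x.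
Proof. by move=> y _; exact: is_lim_seq_const. Qed.

Lemma lim_Rpower (u : nat -> R) (l r : R) : 0 < l -> is_lim_seq u l -> is_lim_seq (fun k => Rpower (u k) r) (Rpower l r).
Proof.
move=> l0 H; apply: (is_lim_seq_continuous (fun x => Rpower x r) u l) => //.
exact: is_derive_cont (is_derive_Rpower (f := fun x => x) r l0 (is_derive_id l)).
Qed.

Lemma cont_seq_nsq_Rpower n (a x : point n) r : 0 < nsq (psub x a) -> cont_seq (fun y => Rpower (nsq (psub y a)) r) x.
Proof. by move=> h y Hy; apply: lim_Rpower => //; exact: conv_nsq. Qed.

Lemma Rpower_neg_le r x y : r <= 0 -> 0 < x -> x <= y -> Rpower y r <= Rpower x r.
Proof.
move=> r0 x0 xy; rewrite -(Ropp_involutive r) !(Rpower_Ropp _ (- r)).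
apply: Rinv_le_contravar; first exact: exp_pos.
by apply: Rpower_le_l; lra.
Qed.

Lemma Rpower_neg_small r e : r < 0 -> 0 < e -> exists X, 0 < X /\ forall x, X <= x -> Rpower x r <= e.
Proof.
move=> r0 e0; exists (Rpower e (/ r)); split; first exact: exp_pos.
move=> x Hx; apply: Rle_trans (Rpower_neg_le _ _ Hx) _; [lra | exact: exp_pos |].
by rewrite Rpower_mult Rinv_l ?Rpower_1; lra.
Qed.

Lemma Rpower_neg_large r e : r < 0 -> 0 < e -> exists X, 0 < X /\ forall x, 0 < x -> x <= X -> e <= Rpower x r.
Proof.
move=> r0 e0; exists (Rpower e (/ r)); split; first exact: exp_pos.
move=> x x0 Hx; apply: Rle_trans (Rpower_neg_le _ _ Hx); [|lra|exact: x0].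
by rewrite Rpower_mult Rinv_l ?Rpower_1; lra.
Qed.

(** The strict sign of [L] lets the second derivative test stand in for the strong maximum
    principle. *)
Definition superharmonic_out n (a : point n) (r0 : R) (w : point n -> R) : Prop :=
  forall y, r0 < nsq (psub y a) -> 0 < nsq y -> exists L, L < 0 /\ has_lap w y L.

(* The puncture at the origin is absorbed by adding a small multiple of the fundamental solution. *)
Lemma exterior_min_principle n (a : point n) r0 (w : point n -> R) : 0 < INR n - 2 -> 0 < r0 ->
  (forall y, r0 <= nsq (psub y a) -> 0 < nsq y -> cont_seq w y) ->
  superharmonic_out a r0 w ->
  (forall y, nsq (psub y a) = r0 -> 0 < nsq y -> 0 <= w y) ->
  (exists M, forall y, r0 <= nsq (psub y a) -> 0 < nsq y -> - M <= w y) ->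
  (forall e, 0 < e -> exists X, forall y, X <= nsq (psub y a) -> 0 < nsq y -> - e <= w y) ->
  forall y, r0 <= nsq (psub y a) -> 0 < nsq y -> 0 <= w y.
Proof.
move=> m0 r00 wc wl wb [M HM] winf y0 y0r y0z.
pose r := - (INR n - 2) / 2; have rn : r < 0 by rewrite /r; lra.
have G0 y : 0 < Rpower (nsq (psub y (origin n))) r by exact: exp_pos.
suff key e : 0 < e -> 0 <= w y0 + (e + e * Rpower (nsq (psub y0 (origin n))) r).
  apply: Rnot_lt_le => h; have g := G0 y0; set G := Rpower _ _ in g key *.
  pose e := - w y0 / (2 * (1 + G)).
  have e0 : 0 < e by apply: Rdiv_lt_0_compat; lra.
  have := key e e0; have : e * (1 + G) = - w y0 / 2 by rewrite /e; field; lra.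
  lra.
move=> e0.
have [X HX] := winf e e0.
have M1 : 0 < Rmax M 1 by have := Rmax_r M 1; lra.
(* Below [rho], [e] times the fundamental solution at the origin outweighs the lower bound [- M];
   beyond [X] the constant [e] is enough. [R1] and [rho1] are adjusted so that [y0] belongs to the
   truncated region. *)
have [rho [rho0 Hrho]] := Rpower_neg_large rn (Rdiv_lt_0_compat _ _ M1 e0).
pose R1 := Rmax X (nsq (psub y0 a)); pose rho1 := Rmin rho (nsq y0).
have rho10 : 0 < rho1 by apply: Rmin_glb_lt.
pose K y := (r0 <= nsq (psub y a) /\ nsq (psub y a) <= R1) /\ rho1 <= nsq (psub y (origin n)).
have Kz y : K y -> 0 < nsq y by case=> _; rewrite psub0; lra.
apply: (@min_principle n K (fun y => w y + (e + e * Rpower (nsq (psub y (origin n))) r)) (R1 + 1 + sumR (fun i => Rabs (a i)))).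
- by apply: closed_and; [apply: closed_and; [exact: closed_nsq_ge | exact: closed_nsq_le] | exact: closed_nsq_ge].
- by move=> y [[_ h] _] j; exact: ball_bounded.
- move=> y Ky; have yz := Kz y Ky; apply: cont_seq_plus; first by apply: wc => //; case: Ky; case.
  apply: cont_seq_plus; first exact: cont_seq_const.
  by apply: cont_seq_mult; [exact: cont_seq_const | apply: cont_seq_nsq_Rpower; rewrite psub0].
- move=> y Ky neg; have yz := Kz y Ky; case: Ky => [[y1 y2] y3].
  have g := G0 y; have eg := Rmult_lt_0_compat _ _ e0 g.
  have {}y1 : r0 < nsq (psub y a) by case: y1 => // E; have := wb y (esym E) yz; lra.
  have {}y2 : nsq (psub y a) < R1.
    case: y2 => // E; have := HX y; rewrite E => /(_ (Rmax_l _ _) yz); lra.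
  have {}y3 : rho1 < nsq (psub y (origin n)).
    case: y3 => // E; have := HM y (Rlt_le _ _ y1) yz.
    have := Hrho (nsq (psub y (origin n))) ltac:(rewrite psub0; lra) ltac:(rewrite -E; exact: Rmin_l).
    move/(Rmult_le_compat_l e _ _ (Rlt_le _ _ e0)); have -> : e * (Rmax M 1 / e) = Rmax M 1 by field; lra.
    have := Rmax_l M 1; lra.
  split.
    move=> i; apply: filter_and; [apply: filter_and|].
    + by apply: filter_imp (locally_nsq_gt i y1) => t; lra.
    + by apply: filter_imp (locally_nsq_lt i y2) => t; lra.
    + by apply: filter_imp (locally_nsq_gt i y3) => t; lra.
  have [L [L0 HL]] := wl y y1 yz.
  exists (L + (0 + e * 0)); split; first lra.
  apply: lap_plus => //; apply: lap_plus; first exact: lap_const.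
  by apply: lap_scal; apply: lap_fundamental => //; rewrite psub0.
- split; first by split => //; exact: Rmax_r.
  by rewrite psub0; exact: Rmin_r.
Qed.

Lemma nsq_origin_dist n (a y : point n) : nsq (psub y a) <> nsq a -> 0 < nsq y.
Proof.
move=> h; have := nsq_ge0 y; case=> // E; case: h.
apply: sumR_ext => i; have := nsq_coord y i; rewrite -E /psub => h.
have -> : y i = 0 by have := pow2_ge_0 (y i); nra.
by ring.
Qed.

Lemma sphere_min_pos n (a : point n) r1 (z : point n -> R) : r1 < nsq a ->
  (forall y, nsq (psub y a) = r1 -> cont_seq z y) -> (forall y, nsq (psub y a) = r1 -> 0 < z y) ->
  exists c, 0 < c /\ forall y, nsq (psub y a) = r1 -> c <= z y.
Proof.
move=> ra zc zp.
case: (excluded_middle_informative (exists y, nsq (psub y a) = r1)) => [[y0 Hy0]|none]; last first.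
  by exists 1; split; [lra | move=> y Hy; case: none; exists y].
pose K y := nsq (psub y a) <= r1 /\ r1 <= nsq (psub y a).
have KE y : K y -> nsq (psub y a) = r1 by case; lra.
have [||||y [Ky Hy]] := @compact_min n K z (r1 + 1 + sumR (fun i => Rabs (a i))).
- by apply: closed_and; [exact: closed_nsq_le | exact: closed_nsq_ge].
- by move=> y [h _] j; exact: ball_bounded.
- by move=> y /KE; exact: zc.
- by exists y0; split; lra.
by exists (z y); split; [exact/zp/KE | move=> x Hx; apply: Hy; split; lra].
Qed.

(** The barrier [c * |y - a|^(2-n)] is harmonic off [a], bounded outside the sphere and tends to 0
    at infinity, so [z >= 0] controls the difference at the puncture and at infinity. The minimum of
    [z] on the sphere fixes [c]. *)
Lemma exterior_lower_bound n (a : point n) r1 (z : point n -> R) : 0 < INR n - 2 -> 0 < r1 -> r1 < nsq a ->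
  (forall y, r1 <= nsq (psub y a) -> 0 < nsq y -> cont_seq z y) ->
  superharmonic_out a r1 z ->
  (forall y, nsq (psub y a) = r1 -> 0 < z y) ->
  (forall y, r1 <= nsq (psub y a) -> 0 < nsq y -> 0 <= z y) ->
  exists c, 0 < c /\ forall y, r1 <= nsq (psub y a) -> 0 < nsq y ->
    c * Rpower (nsq (psub y a)) (- (INR n - 2) / 2) <= z y.
Proof.
move=> m0 r10 ra zc zl zs z0.
pose r := - (INR n - 2) / 2; have rn : r < 0 by rewrite /r; lra.
have nz y : nsq (psub y a) = r1 -> 0 < nsq y by move=> E; apply: (@nsq_origin_dist _ a); rewrite E; lra.
have [c0 [c00 Hc0]] := sphere_min_pos ra (fun y E => zc y (Req_le _ _ (esym E)) (nz y E)) zs.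
have p1 : 0 < Rpower r1 r by exact: exp_pos.
pose c := c0 / Rpower r1 r.
have c1 : 0 < c by apply: Rdiv_lt_0_compat.
have c2 : c * Rpower r1 r = c0 by rewrite /c; field; lra.
exists c; split => //.
suff key y : r1 <= nsq (psub y a) -> 0 < nsq y -> 0 <= z y + (- c) * Rpower (nsq (psub y a)) r.
  by move=> y h1 h2; have := key y h1 h2; rewrite -/r; lra.
apply: (@exterior_min_principle n a r1 (fun y => z y + (- c) * Rpower (nsq (psub y a)) r)) => // {y}.
- move=> y h1 h2; apply: cont_seq_plus; first exact: zc.
  by apply: cont_seq_mult; [exact: cont_seq_const | apply: cont_seq_nsq_Rpower; lra].
- move=> y h1 h2; have [L [L0 HL]] := zl y h1 h2.
  exists (L + (- c) * 0); split; first lra.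
  by apply: lap_plus => //; apply: lap_scal; apply: lap_fundamental => //; lra.
- by move=> y E h; rewrite E; have := Hc0 y E; lra.
- exists c0 => y h1 h2; have := z0 y h1 h2.
  have := Rpower_neg_le (Rlt_le _ _ rn) r10 h1 => /(Rmult_le_compat_l c _ _ (Rlt_le _ _ c1)); lra.
- move=> e e0; have [X [X0 HX]] := Rpower_neg_small rn (Rdiv_lt_0_compat _ _ e0 c1).
  exists (Rmax X r1) => y h1 h2.
  have := z0 y (Rle_trans _ _ _ (Rmax_r _ _) h1) h2.
  have := HX _ (Rle_trans _ _ _ (Rmax_l _ _) h1) => /(Rmult_le_compat_l c _ _ (Rlt_le _ _ c1)).
  have -> : c * (e / c) = e by field; lra.
  lra.
Qed.

(** The barrier behind Hopf's lemma: it vanishes on the inner sphere with nonzero slope. With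
    [c = c0 / Rpower l r] it stays below the minimum [c0] of [z] on the outer sphere. *)
Lemma annulus_lower_bound n (a : point n) l r1 (z : point n -> R) : 0 < INR n - 2 -> 0 < l -> l < r1 -> r1 < nsq a ->
  (forall y, l <= nsq (psub y a) -> 0 < nsq y -> cont_seq z y) ->
  superharmonic_out a l z ->
  (forall y, nsq (psub y a) = r1 -> 0 < z y) ->
  (forall y, l <= nsq (psub y a) -> 0 < nsq y -> 0 <= z y) ->
  exists c, 0 < c /\ forall y, l <= nsq (psub y a) -> nsq (psub y a) <= r1 ->
    c * (Rpower l (- (INR n - 2) / 2) - Rpower (nsq (psub y a)) (- (INR n - 2) / 2)) <= z y.
Proof.
move=> m0 l0 lr ra zc zl zs z0.
pose r := - (INR n - 2) / 2; have rn : r < 0 by rewrite /r; lra.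
have nz y : nsq (psub y a) <= r1 -> 0 < nsq y by move=> E; apply: (@nsq_origin_dist _ a); lra.
have [|c0 [c00 Hc0]] := sphere_min_pos ra _ zs.
  by move=> y E; apply: zc; [lra | apply: nz; lra].
have p1 : 0 < Rpower l r by exact: exp_pos.
pose c := c0 / Rpower l r.
have c1 : 0 < c by apply: Rdiv_lt_0_compat.
have c2 : c * Rpower l r = c0 by rewrite /c; field; lra.
exists c; split => //.
pose K y := l <= nsq (psub y a) /\ nsq (psub y a) <= r1.
suff key y : K y -> 0 <= z y + (- c0 + c * Rpower (nsq (psub y a)) r).
  by move=> y h1 h2; have := key y (conj h1 h2); rewrite -/r; lra.
apply: (@min_principle n K (fun y => z y + (- c0 + c * Rpower (nsq (psub y a)) r)) (r1 + 1 + sumR (fun i => Rabs (a i)))) => {y}.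
- by apply: closed_and; [exact: closed_nsq_ge | exact: closed_nsq_le].
- by move=> y [_ h] j; exact: ball_bounded.
- move=> y [h1 h2]; apply: cont_seq_plus; first by apply: zc => //; exact: nz.
  apply: cont_seq_plus; first exact: cont_seq_const.
  by apply: cont_seq_mult; [exact: cont_seq_const | apply: cont_seq_nsq_Rpower; lra].
- move=> y [h1 h2] neg; have yz := nz y h2.
  have {}h1 : l < nsq (psub y a) by case: h1 => // E; move: neg; rewrite -E c2; have := z0 y (Req_le _ _ E) yz; lra.
  have {}h2 : nsq (psub y a) < r1.
    case: h2 => // E; have := Hc0 y E.
    have : 0 < c * Rpower (nsq (psub y a)) r by apply: Rmult_lt_0_compat => //; exact: exp_pos.
    lra.
  split.
    move=> i; apply: filter_and.
    + by apply: filter_imp (locally_nsq_gt i h1) => t; lra.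
    + by apply: filter_imp (locally_nsq_lt i h2) => t; lra.
  have [L [L0 HL]] := zl y h1 yz.
  exists (L + (0 + c * 0)); split; first lra.
  apply: lap_plus => //; apply: lap_plus; first exact: lap_const.
  by apply: lap_scal; apply: lap_fundamental => //; lra.
Qed.

(** A zero would be an interior minimum, where the Laplacian cannot be negative. *)
Lemma strict_positivity n (a : point n) l (z : point n -> R) : superharmonic_out a l z ->
  (forall y, l <= nsq (psub y a) -> 0 < nsq y -> 0 <= z y) ->
  forall y, l < nsq (psub y a) -> 0 < nsq y -> 0 < z y.
Proof.
move=> zl z0 y h1 h2; case: (z0 y (Rlt_le _ _ h1) h2) => // E.
have [L [L0 HL]] := zl y h1 h2.
suff : 0 <= L by lra.
apply: (lap_min HL) => i; rewrite -E.
have h3 : 0 < nsq (psub y (origin n)) by rewrite psub0.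
apply: filter_imp (filter_and _ _ (locally_nsq_gt i h1) (locally_nsq_gt i h3)) => t [A B].
by apply: z0; [lra | rewrite psub0 in B].
Qed.

(** * Moving spheres *)

Definition ray n (a p : point n) (t : R) : point n := fun j => a j + t * (p j - a j).

Lemma nsq_scale n c (x : point n) : nsq (fun j => c * x j) = c ^ 2 * nsq x.
Proof. by rewrite /nsq -sumR_scal; apply: sumR_ext => i; ring. Qed.

Lemma psub_ray n (a p : point n) t : psub (ray a p t) a = fun j => t * psub p a j.
Proof. by apply: functional_extensionality => j; rewrite /psub /ray; ring. Qed.

Lemma nsq_ray n (a p : point n) t : nsq (psub (ray a p t) a) = t ^ 2 * nsq (psub p a).
Proof. by rewrite psub_ray nsq_scale. Qed.

Lemma inversion_ray n (a y : point n) l : inversion a l y = ray a y (l / nsq (psub y a)).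
Proof. by []. Qed.

Lemma nsq_inversion n (a y : point n) l : 0 < nsq (psub y a) ->
  nsq (psub (inversion a l y) a) = l ^ 2 / nsq (psub y a).
Proof. by move=> h; rewrite inversion_ray nsq_ray; field; lra. Qed.

Lemma ray_ray n (a p : point n) s t : ray a (ray a p s) t = ray a p (t * s).
Proof. by apply: functional_extensionality => j; rewrite /ray; ring. Qed.

Lemma ray1 n (a p : point n) : ray a p 1 = p.
Proof. by apply: functional_extensionality => j; rewrite /ray; ring. Qed.

Lemma near_center_nz n (a y : point n) : nsq (psub y a) < nsq a -> 0 < nsq y.
Proof. by move=> h; apply: (@nsq_origin_dist _ a); lra. Qed.

Lemma inversion_near n (a y : point n) l : 0 < l -> l <= nsq (psub y a) -> nsq (psub (inversion a l y) a) <= l.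
Proof.
move=> l0 h; rewrite nsq_inversion; last lra.
by apply/Rle_div_l; [lra | nra].
Qed.

Lemma conv_ray n (a : point n) (y : nat -> point n) (x : point n) (u : nat -> R) (t : R) :
  conv y x -> is_lim_seq u t -> conv (fun k => ray a (y k) (u k)) (ray a x t).
Proof.
move=> cy cu j; apply: is_lim_seq_plus'; first exact: is_lim_seq_const.
apply: is_lim_seq_mult' => //.
by apply: is_lim_seq_minus'; [exact: cy | exact: is_lim_seq_const].
Qed.

Lemma lim_div (u v : nat -> R) (a b : R) : is_lim_seq u a -> is_lim_seq v b -> b <> 0 ->
  is_lim_seq (fun k => u k / v k) (a / b).
Proof.
move=> Hu Hv b0; apply: is_lim_seq_div' => //.
Qed.

Lemma conv_const n (x : point n) : conv (fun _ => x) x.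
Proof. by move=> j; exact: is_lim_seq_const. Qed.

Record smooth_pos n (f : point n -> R) (D1 : 'I_n -> point n -> R) (D2 : 'I_n -> 'I_n -> point n -> R) : Prop := SmoothPos {
  sp_C1 : C1_punct f D1;
  sp_C2 : forall i, C1_punct (D1 i) (D2 i);
  sp_cont : forall y, 0 < nsq y -> cont_seq f y;
  sp_pos : forall y, 0 < nsq y -> 0 < f y }.

Definition kelvin_le n (f : point n -> R) (a : point n) (l : R) : Prop :=
  forall y, l <= nsq (psub y a) -> 0 < nsq y -> kelvin f a l y <= f y.

(* Up to a positive factor, the derivative of [t ^ (m / 2) * f] along the rays from [a], with [m = n - 2]. *)
Definition radial_growth n (f : point n -> R) (D1 : 'I_n -> point n -> R) (a p : point n) : R :=
  (INR n - 2) / 2 * f p + sumR (fun i => D1 i p * (p i - a i)).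

Section MovingSphere.
Variables (n : nat) (f : point n -> R) (D1 : 'I_n -> point n -> R) (D2 : 'I_n -> 'I_n -> point n -> R).
Hypotheses (m0 : 0 < INR n - 2) (sf : smooth_pos f D1 D2).
Variable a : point n.
Let m := INR n - 2.
Let A := nsq a.

Lemma ray_derive p t : 0 < nsq (ray a p t) ->
  is_derive (fun s => f (ray a p s)) t (sumR (fun i => D1 i (ray a p t) * (p i - a i))).
Proof.
move=> nz; apply: (chain_rule (sp_C1 sf) nz) => j.
by rewrite /ray; auto_derive => //; ring.
Qed.

Lemma growth_derive p t : 0 < t -> 0 < nsq (ray a p t) ->
  is_derive (fun s => Rpower s (m / 2) * f (ray a p s)) t (Rpower t (m / 2) / t * radial_growth f D1 a (ray a p t)).
Proof.
move=> t0 nz; evar_last.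
  apply: is_derive_prod; last exact: ray_derive.
  exact: (is_derive_Rpower (f := fun s => s) _ t0 (is_derive_id t)).
rewrite /radial_growth /one /=.
rewrite (sumR_ext (F := fun i => D1 i (ray a p t) * (ray a p t i - a i)) (G := fun i => t * (D1 i (ray a p t) * (p i - a i)))).
  by rewrite sumR_scal /m; field; lra.
by move=> i; rewrite {2}/ray; ring.
Qed.

(** Let [z] be the image of [y], so that [y = ray a z T] with [T = nsq (psub y a) / l]. A violation
    says that [t^(m/2) * f (ray a z t)] is smaller at [T] than at 1, so its derivative is negative
    somewhere between. The bound by [A] keeps this segment off the origin. *)
Lemma ray_violation l y : 0 < l -> l <= nsq (psub y a) -> nsq (psub y a) < A -> f y < kelvin f a l y ->
  exists t, 1 < t < nsq (psub y a) / l /\ radial_growth f D1 a (ray a (inversion a l y) t) < 0.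
Proof.
move=> l0 ly yA viol.
set s := nsq (psub y a) in ly yA *.
pose z := inversion a l y; pose T := s / l.
have T0 : 0 < T by apply: Rdiv_lt_0_compat; lra.
have Ey : y = ray a z T.
  rewrite /z inversion_ray ray_ray -/s (_ : T * (l / s) = 1) ?ray1 //.
  by rewrite /T; field; lra.
have zs : nsq (psub z a) = l ^ 2 / s by apply: nsq_inversion; rewrite -/s; lra.
have v2 : Rpower T (m / 2) * f y < f z.
  have e : Rpower T (m / 2) * Rpower (l / s) (m / 2) = 1.
    rewrite Rpower_mult_distr //; last by apply: Rdiv_lt_0_compat; lra.
    have -> : T * (l / s) = 1 by rewrite /T; field; lra.
    by rewrite /Rpower ln_1 Rmult_0_r exp_0.
  have := Rmult_lt_compat_l _ _ _ (exp_pos (m / 2 * ln T)) viol.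
  by rewrite -/(Rpower T (m / 2)) /kelvin -Rmult_assoc -/m -/s e Rmult_1_l.
have T1 : 1 < T.
  have : 1 <= T by apply/Rle_div_r; lra.
  case=> // E; move: v2; rewrite {1}Ey -E ray1.
  by rewrite /Rpower ln_1 Rmult_0_r exp_0; lra.
have nz t : 1 <= t <= T -> 0 < nsq (ray a z t).
  move=> Ht; apply: (@near_center_nz _ a); rewrite nsq_ray zs.
  apply: Rle_lt_trans yA; apply: Rle_trans (_ : T ^ 2 * (l ^ 2 / s) <= s).
    apply: Rmult_le_compat_r; first by apply: Rdiv_le_0_compat; [apply: pow2_ge_0 | lra].
    by apply: pow_incr; lra.
  by apply: Req_le; rewrite /T; field; lra.
have [t Ht|t [Ht E]] := mvt (f := fun s => Rpower s (m / 2) * f (ray a z s))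
  (df := fun t => Rpower t (m / 2) / t * radial_growth f D1 a (ray a z t)) T1.
  by apply: growth_derive; [lra | exact: nz].
exists t; split => //.
move: E; rewrite -Ey ray1 {2}/Rpower ln_1 Rmult_0_r exp_0 Rmult_1_l => E.
have p0 : 0 < Rpower t (m / 2) / t by apply: Rdiv_lt_0_compat; [exact: exp_pos | lra].
apply: Rnot_le_lt => g0.
have : 0 <= Rpower t (m / 2) / t * radial_growth f D1 a (ray a z t) * (T - 1).
  by apply: Rmult_le_pos; [apply: Rmult_le_pos; [exact: Rlt_le | exact: g0] | lra].
lra.
Qed.

Lemma growth_cont y : 0 < nsq y -> cont_seq (radial_growth f D1 a) y.
Proof.
move=> nz; apply: cont_seq_plus.
  by apply: cont_seq_mult; [exact: cont_seq_const | exact: (sp_cont sf)].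
move=> x cx; apply: is_lim_seq_sumR => i; apply: is_lim_seq_mult'.
  by have [_ /(_ _ cx)] := sp_C1 sf nz i.
by apply: is_lim_seq_minus'; [exact: cx | exact: is_lim_seq_const].
Qed.

Lemma cont_seq_lt (g : point n -> R) x c : cont_seq g x -> g x < c ->
  exists r, 0 < r /\ forall y, nsq (psub y x) <= r -> g y < c.
Proof.
move=> gc gx; apply: NNPP => Hn.
have ex (k : nat) : exists y, nsq (psub y x) <= / (INR k + 1) /\ c <= g y.
  apply: NNPP => Hk; apply: Hn; exists (/ (INR k + 1)); split.
    by apply: Rinv_0_lt_compat; have := pos_INR k; lra.
  by move=> y Hy; apply: Rnot_le_lt => h; apply: Hk; exists y.
have [y Hy] := choice_fun ex.
have cy : conv y x.
  move=> j; apply/is_lim_seq_eps => e e0.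
  have /is_lim_seq_eps /(_ (e ^ 2) (pow_lt _ _ e0)) [K HK] := inv_nat_lim.
  exists K => k /HK; rewrite Rminus_0_r => /Rabs_def2 [h _].
  have [h2 _] := Hy k.
  have h3 : (y k j - x j) ^ 2 <= nsq (psub (y k) x) := nsq_coord (psub (y k) x) j.
  by apply: Rabs_def1; nra.
have := is_lim_seq_le _ _ c (g x) (fun k => proj2 (Hy k)) (is_lim_seq_const c) (gc y cy).
rewrite /=; lra.
Qed.

Lemma fundamental_bound_scaled (z : point n -> R) l c y : 0 < l -> l <= nsq (psub y a) ->
  c * Rpower (nsq (psub y a)) (- m / 2) <= z y ->
  c <= Rpower (nsq (psub y a)) (m / 2) * z y.
Proof.
move=> l0 ly h.
have s0 : 0 < nsq (psub y a) by lra.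
have := Rmult_le_compat_l _ _ _ (Rlt_le _ _ (exp_pos (m / 2 * ln (nsq (psub y a))))) h.
rewrite -/(Rpower _ (m / 2)) Rmult_comm Rmult_assoc -Rpower_plus.
have -> : - m / 2 + m / 2 = 0 by field.
by rewrite Rpower_O // Rmult_1_r.
Qed.

(** After this scaling the Kelvin transform depends on [y] only through its image, which stays
    bounded when [y] runs to infinity. *)
Lemma kelvin_scaled l y : 0 < l -> 0 < nsq (psub y a) ->
  Rpower (nsq (psub y a)) (m / 2) * kelvin f a l y = Rpower l (m / 2) * f (inversion a l y).
Proof.
move=> l0 s0; rewrite /kelvin -/m -Rmult_assoc Rpower_mult_distr //; last by apply: Rdiv_lt_0_compat.
by congr (Rpower _ _ * _); field; lra.
Qed.

(** At the centre [radial_growth] equals [m / 2 * f a > 0], so [ray_violation] excludes violations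
    close to [a]. Farther out [f] is at least [c * |y - a|^(-m)], while the Kelvin transform is
    below [l^(m/2) * (f a + 1) * |y - a|^(-m)], which is smaller for small [l]. *)
Lemma moving_sphere_start : 0 < A -> (forall y, 0 < nsq y -> laplacian_with D2 y < 0) ->
  exists d, 0 < d /\ forall l, 0 < l < d -> kelvin_le f a l.
Proof.
move=> A0 superh.
have an : 0 < nsq a by [].
have aa : nsq (psub a a) = 0.
  rewrite (_ : psub a a = fun j => 0 * a j); first by rewrite nsq_scale; ring.
  by apply: functional_extensionality => j; rewrite /psub; ring.
have fa := sp_pos sf an.
have [||r [r0 Hr]] := @cont_seq_lt (fun y => - 1 * radial_growth f D1 a y) a 0.
- by apply: cont_seq_mult; [exact: cont_seq_const | exact: growth_cont].
- rewrite /radial_growth (sumR_ext (G := fun _ => 0)); last by move=> i; ring.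
  by rewrite sumR_const -/m; have := Rmult_lt_0_compat _ _ m0 fa; rewrite -/m; lra.
have [r' [r'0 Hr']] := @cont_seq_lt f a (f a + 1) (sp_cont sf an) ltac:(lra).
pose r1 := Rmin r (A / 2).
have r10 : 0 < r1 by apply: Rmin_glb_lt; lra.
have r1r : r1 <= r := Rmin_l _ _.
have r1A : r1 < A by have := Rmin_r r (A / 2); rewrite -/r1; lra.
have [||||c [c0 Hc]] := @exterior_lower_bound n a r1 f m0 r10 r1A.
- by move=> y _; exact: (sp_cont sf).
- move=> y _ nz; exists (laplacian_with D2 y); split; first exact: superh.
  exact: (lap_punct (sp_C1 sf) (sp_C2 sf)).
- by move=> y E; apply: (sp_pos sf); apply: (@near_center_nz _ a); rewrite E.
- by move=> y _ nz; apply/Rlt_le/(sp_pos sf).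
(* Solves [d1^(m/2) * (f a + 1) = c]. *)
pose d1 := Rpower (c / (f a + 1)) (/ (m / 2)).
exists (Rmin (Rmin r1 r') d1); split.
  by apply: Rmin_glb_lt; [exact: Rmin_glb_lt | exact: exp_pos].
move=> l [l0 ld] y ly nz.
have lr1 : l < r1 by apply: Rlt_le_trans ld _; apply: Rle_trans (Rmin_l _ _) (Rmin_l _ _).
have lr' : l < r' by apply: Rlt_le_trans ld _; apply: Rle_trans (Rmin_l _ _) (Rmin_r _ _).
have ld1 : l < d1 by apply: Rlt_le_trans ld (Rmin_r _ _).
apply: Rnot_lt_le => viol.
case: (Rlt_le_dec (nsq (psub y a)) r1) => ys.
  have [|t [Ht]] := ray_violation l0 ly _ viol; first lra.
  have sl : 0 < nsq (psub y a) by lra.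
  set p := ray _ _ _ => g.
  have ps : nsq (psub p a) <= r.
    rewrite nsq_ray nsq_inversion //.
    have t2 : t ^ 2 <= (nsq (psub y a) / l) ^ 2 by apply: pow_incr; lra.
    have : t ^ 2 * (l ^ 2 / nsq (psub y a)) <= (nsq (psub y a) / l) ^ 2 * (l ^ 2 / nsq (psub y a)).
      by apply: Rmult_le_compat_r => //; apply: Rdiv_le_0_compat => //; exact: pow2_ge_0.
    have -> : (nsq (psub y a) / l) ^ 2 * (l ^ 2 / nsq (psub y a)) = nsq (psub y a) by field; lra.
    lra.
  by have := Hr p ps; lra.
have sl : 0 < nsq (psub y a) by lra.
have h1 := fundamental_bound_scaled r10 ys (Hc y ys nz).
have h2 : Rpower (nsq (psub y a)) (m / 2) * f y < Rpower l (m / 2) * f (inversion a l y).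
  by rewrite -kelvin_scaled //; apply: Rmult_lt_compat_l => //; exact: exp_pos.
have h3 : f (inversion a l y) < f a + 1.
  by apply: Hr'; have := inversion_near l0 ly; lra.
have h4 : Rpower l (m / 2) * (f a + 1) <= c.
  apply/Rle_div_r; first lra.
  have : Rpower l (m / 2) <= Rpower d1 (m / 2) by apply: Rpower_le_l => //; move: m0; rewrite -/m; lra.
  by rewrite /d1 Rpower_mult Rinv_l ?Rpower_1 //; [apply: Rdiv_lt_0_compat; lra | move: m0; rewrite -/m; lra].
have := Rmult_lt_compat_l _ _ _ (exp_pos (m / 2 * ln l)) h3.
rewrite -/(Rpower l (m / 2)); lra.
Qed.

Lemma moving_sphere_closed l : 0 < l -> l < A -> (forall l', 0 < l' < l -> kelvin_le f a l') -> kelvin_le f a l.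
Proof.
move=> l0 lA H y ly nz.
have s0 : 0 < nsq (psub y a) by lra.
pose u k := l - l / 2 * / (INR k + 1).
have ul : is_lim_seq u l.
  have := is_lim_seq_minus' _ _ _ _ (is_lim_seq_const l) (is_lim_seq_mult' _ _ _ _ (is_lim_seq_const (l / 2)) inv_nat_lim).
  by rewrite Rmult_0_r Rminus_0_r.
have u1 k : 0 < u k < l.
  have k0 := pos_INR k.
  have p : 0 < / (INR k + 1) <= 1.
    split; first by apply: Rinv_0_lt_compat; lra.
    by rewrite -Rinv_1; apply: Rinv_le_contravar; lra.
  by rewrite /u; split; nra.
have L1 : is_lim_seq (fun k => kelvin f a (u k) y) (kelvin f a l y).
  have c1 : is_lim_seq (fun k => u k / nsq (psub y a)) (l / nsq (psub y a)).
    by apply: lim_div => //; [exact: is_lim_seq_const | lra].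
  apply: is_lim_seq_mult'.
    by apply: lim_Rpower => //; exact: Rdiv_lt_0_compat.
  apply: (sp_cont sf); first by apply: (@near_center_nz _ a); have := inversion_near l0 ly; rewrite -/A; lra.
  by apply: conv_ray => //; exact: conv_const.
have := is_lim_seq_le _ _ (kelvin f a l y) (f y) _ L1 (is_lim_seq_const (f y)); apply => k.
by apply: (H _ (u1 k)) => //; have := u1 k; lra.
Qed.

Section Open.
Variable l : R.
Hypotheses (l0 : 0 < l) (lA : l < A) (Hl : kelvin_le f a l).
Let z y := f y + (- 1) * kelvin f a l y.
Hypothesis zsup : superharmonic_out a l z.

Lemma kelvin_cont y : l <= nsq (psub y a) -> cont_seq (kelvin f a l) y.
Proof.
move=> ly; have s0 : 0 < nsq (psub y a) by lra.
move=> x cx.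
have c1 : is_lim_seq (fun k => l / nsq (psub (x k) a)) (l / nsq (psub y a)).
  by apply: lim_div; [exact: is_lim_seq_const | exact: conv_nsq | lra].
apply: is_lim_seq_mult'.
  by apply: lim_Rpower => //; exact: Rdiv_lt_0_compat.
apply: (sp_cont sf); first by apply: (@near_center_nz _ a); have := inversion_near l0 ly; rewrite -/A; lra.
exact: conv_ray.
Qed.

Lemma gap_cont y : l <= nsq (psub y a) -> 0 < nsq y -> cont_seq z y.
Proof.
move=> ly nz; apply: cont_seq_plus; first exact: (sp_cont sf).
by apply: cont_seq_mult; [exact: cont_seq_const | exact: kelvin_cont].
Qed.

Lemma gap_ge0 y : l <= nsq (psub y a) -> 0 < nsq y -> 0 <= z y.
Proof. by move=> ly nz; have := Hl ly nz; rewrite /z; lra. Qed.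

Lemma gap_gt0 y : l < nsq (psub y a) -> 0 < nsq y -> 0 < z y.
Proof. by move=> h1 h2; apply: (strict_positivity zsup) => //; exact: gap_ge0. Qed.

(** Along the ray through [p], [h] is the gap minus the barrier of [annulus_lower_bound]: it
    vanishes at 1 and is nonnegative just outside the sphere. Its slope at 1 is [2 * radial_growth]
    minus a positive constant, so nonpositive growth is impossible. *)
Lemma moving_sphere_hopf p : nsq (psub p a) = l -> 0 < radial_growth f D1 a p.
Proof.
move=> pl.
have pz : 0 < nsq p by apply: (@near_center_nz _ a); rewrite pl.
pose r1 := (l + A) / 2.
have lr1 : l < r1 by rewrite /r1; lra.
have r1A : r1 < A by rewrite /r1; lra.
have [||c [c0 Hc]] := @annulus_lower_bound n a l r1 z m0 l0 lr1 r1A gap_cont zsup.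
- by move=> y E; apply: gap_gt0; [lra | apply: (@near_center_nz _ a); rewrite E].
- exact: gap_ge0.
pose r := - (INR n - 2) / 2; rewrite -/r in Hc.
have lr0 := exp_pos (r * ln l); rewrite -/(Rpower l r) in lr0.
pose h t := f (ray a p t) + (- 1) * (Rpower t (- m) * f (ray a p (/ t))) + (- (c * Rpower l r)) * (1 + (- 1) * Rpower t (- m)).
have nz1 : 0 < nsq (ray a p 1) by rewrite ray1.
have dh : is_derive h 1 (2 * radial_growth f D1 a p - c * Rpower l r * m).
  have E1 : Rpower 1 (- m) = 1 by rewrite /Rpower ln_1 Rmult_0_r exp_0.
  have d1 := ray_derive nz1.
  have d2 : is_derive (fun t => f (ray a p (/ t))) 1 (- sumR (fun i => D1 i (ray a p 1) * (p i - a i))).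
    evar_last.
      apply: (is_derive_comp (fun s => f (ray a p s)) Rinv).
        by rewrite Rinv_1; exact: d1.
      by apply: (is_derive_inv (fun t => t)); [exact: is_derive_id | lra].
    by rewrite /scal /= /mult /one /=; field.
  have d3 := is_derive_Rpower (f := fun s => s) (- m) Rlt_0_1 (is_derive_id 1).
  evar_last.
    apply: is_derive_plus; first apply: is_derive_plus.
    - exact: d1.
    - by apply: is_derive_scal; apply: is_derive_prod; [exact: d3 | exact: d2].
    - by apply: is_derive_scal; apply: is_derive_plus; [exact: is_derive_const | apply: is_derive_scal; exact: d3].
  rewrite /plus /zero /one /= Rinv_1 ray1 E1 /radial_growth -/m; field.
apply: Rnot_le_lt => g0.
have neg : 2 * radial_growth f D1 a p - c * Rpower l r * m < 0.
  have := Rmult_lt_0_compat _ _ (Rmult_lt_0_compat _ _ c0 lr0) m0; rewrite -/m; lra.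
have [d [d0 [Hd _]]] := is_derive_sign dh neg.
have E1 : h 1 = 0.
  rewrite /h Rinv_1 /Rpower ln_1 Rmult_0_r exp_0; ring.
(* The first bound stays where [h] is below [h 1], the second inside the annulus, as
   [t ^ 2 * l <= r1]. *)
pose t := Rmin (1 + d / 2) (sqrt (r1 / l)).
have sq : 1 < sqrt (r1 / l).
  rewrite -sqrt_1; apply: sqrt_lt_1; try lra.
    by apply: Rdiv_le_0_compat; lra.
  by apply/Rlt_div_r; lra.
have t1 : 1 < t by apply: Rmin_glb_lt; lra.
have td : t < 1 + d by have := Rmin_l (1 + d / 2) (sqrt (r1 / l)); rewrite -/t; lra.
have tr : t ^ 2 * l <= r1.
  have : t ^ 2 <= sqrt (r1 / l) ^ 2 by apply: pow_incr; split; [lra | exact: Rmin_r].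
  have -> : sqrt (r1 / l) ^ 2 = r1 / l by rewrite /= Rmult_1_r sqrt_sqrt //; apply: Rdiv_le_0_compat; lra.
  by move/(Rle_div_r _ _ _ l0).
have := Hd t (conj t1 td); rewrite E1.
apply: Rle_not_lt.
clearbody t.
have ny : nsq (psub (ray a p t) a) = t ^ 2 * l by rewrite nsq_ray pl.
have ly : l <= nsq (psub (ray a p t) a).
  by rewrite ny; have t2 : 1 <= t ^ 2 by [nra]; have := Rmult_le_compat_r l _ _ (Rlt_le _ _ l0) t2; lra.
have := Hc (ray a p t) ly; rewrite ny => /(_ tr); rewrite /z /kelvin inversion_ray ray_ray ny.
have -> : l / (t ^ 2 * l) * t = / t by field; lra.
have t0 : 0 < t by lra.
have Et : Rpower t (- 2) = / t ^ 2.
  by rewrite (_ : - 2 = - INR 2) ?Rpower_Ropp ?Rpower_pow //=; lra.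
have -> : l / (t ^ 2 * l) = Rpower t (- 2) by rewrite Et; field; lra.
rewrite Rpower_mult -/m (_ : - 2 * (m / 2) = - m); last by field.
rewrite -Rpower_mult_distr //; last exact: pow_lt.
have -> : Rpower (t ^ 2) r = Rpower t (- m).
  rewrite -(Rpower_pow 2) // Rpower_mult; congr Rpower; rewrite /r /m /=; field.
rewrite /h; lra.
Qed.

(** Violations for values decreasing to [l] are followed through their images, which remain bounded
    even if the violating points run to infinity or to the puncture. A limit image strictly inside
    the sphere contradicts [exterior_lower_bound]; one on the sphere contradicts
    [moving_sphere_hopf]. *)
Lemma moving_sphere_open : exists d, 0 < d /\ forall l', l < l' < l + d -> kelvin_le f a l'.
Proof.
apply: NNPP => Hn.
have ex (k : nat) : exists w : R * point n, [/\ l < w.1, w.1 < A /\ w.1 < l + / (INR k + 1), w.1 <= nsq (psub w.2 a),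
   0 < nsq w.2 & f w.2 < kelvin f a w.1 w.2].
  have k0 : 0 < / (INR k + 1) by apply: Rinv_0_lt_compat; have := pos_INR k; lra.
  apply: NNPP => Hk; apply: Hn; exists (Rmin (A - l) (/ (INR k + 1))); split; first by apply: Rmin_glb_lt; lra.
  move=> l' [l1 l2] y ly nz; apply: Rnot_lt_le => viol; apply: Hk; exists (l', y); split => //=.
  by split; [have := Rmin_l (A - l) (/ (INR k + 1)) | have := Rmin_r (A - l) (/ (INR k + 1))]; lra.
have [w Hw] := choice_fun ex.
pose x k := inversion a (w k).1 (w k).2.
have wpos k : 0 < (w k).1 by have [] := Hw k; lra.
have [|phi [P1 [x0 cx]]] := @bolzano_weierstrass n x (A + 1 + sumR (fun i => Rabs (a i))).
  move=> k j; have [h1 [h2 _] h3 _ _] := Hw k.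
  by apply: ball_bounded; have := inversion_near (wpos k) h3; rewrite -/(x k); lra.
pose L k := (w (phi k)).1; pose Y k := (w (phi k)).2; pose X k := x (phi k).
have cL : is_lim_seq L l.
  apply/is_lim_seq_eps => e e0.
  have /is_lim_seq_eps /(_ e e0) [K HK] := lim_subseq P1 inv_nat_lim.
  exists K => k /HK; rewrite Rminus_0_r => /Rabs_def2 [h _].
  by have [h1 [_ h2] _ _ _] := Hw (phi k); rewrite /L; apply: Rabs_def1; lra.
have cX : conv X x0 by [].
pose S k := nsq (psub (Y k) a).
have HS k : [/\ l < L k, L k < A, L k <= S k, 0 < nsq (Y k) & f (Y k) < kelvin f a (L k) (Y k)].
  by have [? [? _] ? ? ?] := Hw (phi k).
have SX k : nsq (psub (X k) a) = L k ^ 2 / S k.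
  by have [? ? ? _ _] := HS k; apply: nsq_inversion; rewrite -/(Y k) -/(S k); lra.
have XL k : nsq (psub (X k) a) <= L k.
  have [h1 h2 h3 _ _] := HS k; apply: inversion_near; [exact: Rlt_trans l0 h1 | exact: h3].
have cSX := conv_nsq (a := a) cX.
have x0l : nsq (psub x0 a) <= l := is_lim_seq_le _ _ (nsq (psub x0 a)) l XL cSX cL.
have x0z : 0 < nsq x0 by apply: (@near_center_nz _ a); exact: Rle_lt_trans x0l lA.
case: x0l => x0l.
(* Limit inside: the violating points stay beyond a sphere [r1 > l], where the gap has fundamental
   size. In the limit the scaled inequalities would say that a number is at least itself plus
   [c]. *)
- set t := nsq (psub x0 a) in x0l cSX *.
  have t0 : 0 <= t by exact: nsq_ge0.
  (* The second bound gives [r1 * t < l * l], because [(l - t) * (2 * l - t) > 0]. Since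
     [S k = L k ^ 2 / nsq (psub (X k) a)], this places the violating points beyond [r1] for large
     [k]. *)
  pose r1 := Rmin ((l + A) / 2) (l + (l - t) / 2).
  have lr1 : l < r1 by apply: Rmin_glb_lt; lra.
  have r1A : r1 < A by have := Rmin_l ((l + A) / 2) (l + (l - t) / 2); rewrite -/r1; lra.
  have r1t : r1 * t < l * l.
    have : r1 <= l + (l - t) / 2 by exact: Rmin_r.
    move=> h; have : r1 * t <= (l + (l - t) / 2) * t by apply: Rmult_le_compat_r.
    nra.
  have r10 : 0 < r1 by lra.
  have [||||c [c0 Hc]] := @exterior_lower_bound n a r1 z m0 r10 r1A.
  + by move=> y h1 h2; apply: gap_cont => //; lra.
  + by move=> y h1 h2; apply: zsup => //; lra.
  + by move=> y E; apply: gap_gt0; [lra | apply: (@near_center_nz _ a); rewrite E].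
  + by move=> y h1 h2; apply: gap_ge0 => //; lra.
  have cM : is_lim_seq (fun k => L k * L k - r1 * nsq (psub (X k) a)) (l * l - r1 * t).
    apply: is_lim_seq_minus'; first exact: is_lim_seq_mult'.
    by apply: is_lim_seq_mult' => //; exact: is_lim_seq_const.
  have /is_lim_seq_eps /(_ (l * l - r1 * t)) [|K HK] := cM; first lra.
  have far k : (K <= k)%coq_nat -> r1 <= S k.
    move=> /HK /Rabs_def2 [_ h]; have {}h : r1 * nsq (psub (X k) a) < L k * L k by lra.
    have [h1 h2 h3 _ _] := HS k.
    have Sp : 0 < S k by lra.
    move: h; rewrite SX => h.
    have h4 : 0 < L k * L k by nra.
    apply: Rnot_lt_le => h5.
    have h6 : r1 * (L k ^ 2 / S k) = r1 / S k * (L k * L k) by field; lra.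
    have h7 : 1 < r1 / S k by apply/Rlt_div_r; lra.
    nra.
  have bound k : (K <= k)%coq_nat ->
     Rpower l (m / 2) * f (ray a (X k) (l / L k)) + c <= Rpower (L k) (m / 2) * f (X k).
    move=> Kk; have [h1 h2 h3 h4 h5] := HS k.
    have Sp : 0 < nsq (psub (Y k) a) by rewrite -/(S k); lra.
    have lS : l <= nsq (psub (Y k) a) by rewrite -/(S k); lra.
    have g1 := fundamental_bound_scaled l0 lS (Hc (Y k) (far k Kk) h4).
    have g2 : Rpower (nsq (psub (Y k) a)) (m / 2) * f (Y k) < Rpower (nsq (psub (Y k) a)) (m / 2) * kelvin f a (L k) (Y k).
      by apply: Rmult_lt_compat_l => //; exact: exp_pos.
    rewrite kelvin_scaled // in g2; last lra.
    have g3 := kelvin_scaled l0 Sp.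
    have E : inversion a l (Y k) = ray a (X k) (l / L k).
      rewrite /X /x !inversion_ray ray_ray; congr ray; rewrite -/(Y k) -/(L k); field; lra.
    rewrite E in g3; move: g1; rewrite /z.
    have g4 : Rpower (nsq (psub (Y k) a)) (m / 2) * f (Y k) < Rpower (L k) (m / 2) * f (X k) by exact: g2.
    lra.
  have cq : is_lim_seq (fun k => l / L k) 1.
    have -> : 1 = l / l by field; lra.
    by apply: lim_div => //; [exact: is_lim_seq_const | lra].
  have c1 : is_lim_seq (fun k => Rpower l (m / 2) * f (ray a (X k) (l / L k)) + c) (Rpower l (m / 2) * f x0 + c).
    apply: is_lim_seq_plus'; last exact: is_lim_seq_const.
    apply: is_lim_seq_mult'; first exact: is_lim_seq_const.
    by apply: (sp_cont sf x0z); rewrite -[X in conv _ X](ray1 a x0); exact: conv_ray.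
  have c2 : is_lim_seq (fun k => Rpower (L k) (m / 2) * f (X k)) (Rpower l (m / 2) * f x0).
    by apply: is_lim_seq_mult'; [exact: lim_Rpower | exact: (sp_cont sf x0z)].
  have : Rbar_le (Rpower l (m / 2) * f x0 + c) (Rpower l (m / 2) * f x0).
    by apply: (is_lim_seq_le_loc _ _ _ _ _ c1 c2); exists K.
  rewrite /=; lra.
(* Limit on the sphere: the violating points approach it too, so the parameters [t k] found between
   images and points tend to 1, and nonpositive growth passes to [x0]. *)
- have cS : is_lim_seq S l.
    apply: (is_lim_seq_ext (fun k => L k * L k / nsq (psub (X k) a))).
      move=> k; have [h1 h2 h3 _ _] := HS k; rewrite SX; field; lra.
    rewrite x0l in cSX; have -> : l = l * l / l by field; lra.
    by apply: lim_div => //; [exact: is_lim_seq_mult' | lra].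
  have /is_lim_seq_eps /(_ (A - l)) [|K HK] := cS; first lra.
  have ext k : exists t, (K <= k)%coq_nat -> 1 <= t <= S k / L k /\ radial_growth f D1 a (ray a (X k) t) <= 0.
    case: (excluded_middle_informative (K <= k)%coq_nat) => Kk; last by exists 0.
    have /Rabs_def2 [h _] := HK k Kk; have [h1 h2 h3 h4 h5] := HS k.
    have [||t [Ht g]] := @ray_violation (L k) (Y k) _ h3 _ h5; try lra.
      by rewrite -/(S k); lra.
    by exists t => _; split; [rewrite -/(S k) in Ht; lra | apply: Rlt_le; exact: g].
  have [t Ht] := choice_fun ext.
  have ct : is_lim_seq t 1.
    apply: (is_lim_seq_le_le_loc (fun _ => 1) t (fun k => S k / L k)).
    + by exists K => k /(Ht k) [].
    + exact: is_lim_seq_const.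
    + have -> : 1 = l / l by field; lra.
      by apply: lim_div => //; lra.
  have c1 : is_lim_seq (fun k => radial_growth f D1 a (ray a (X k) (t k))) (radial_growth f D1 a x0).
    by apply: (growth_cont x0z); rewrite -[X in conv _ X](ray1 a x0); exact: conv_ray.
  have : Rbar_le (radial_growth f D1 a x0) 0.
    by apply: (is_lim_seq_le_loc _ _ _ _ _ c1 (is_lim_seq_const 0)); exists K => k /(Ht k) [].
  by have := moving_sphere_hopf x0l; rewrite /=; lra.
Qed.

End Open.
End MovingSphere.

(** * Moving spheres for the coupled system and radial symmetry *)

Lemma nonlin_homogeneous q mu be k a b : 0 < k -> 0 < a -> 0 < b ->
  nonlin q mu be (k * a) (k * b) = Rpower k (2 * q + 1) * nonlin q mu be a b.
Proof.
move=> k0 a0 b0; rewrite /nonlin -!Rpower_mult_distr //.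
have -> : 2 * q + 1 = q + (q + 1) by ring.
by rewrite !Rpower_plus; ring.
Qed.

(* Subcriticality enters here: the Kelvin transforms form a strict subsolution outside the sphere. *)
Lemma kelvin_superharmonic n (q mu be : R) (u v : point n -> R) D1u D2u D1v D2v (a : point n) l :
  0 < q -> 0 < mu -> 0 < be -> (INR n - 2) * q < 2 ->
  smooth_pos u D1u D2u -> smooth_pos v D1v D2v ->
  (forall y, 0 < nsq y -> laplacian_with D2u y = - nonlin q mu be (u y) (v y)) ->
  0 < l -> l < nsq a -> kelvin_le u a l -> kelvin_le v a l ->
  superharmonic_out a l (fun y => u y + (- 1) * kelvin u a l y).
Proof.
move=> q0 mu0 be0 sub su sv eqn l0 la Hu Hv y ly nz.
have s0 : 0 < nsq (psub y a) by lra.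
set s := nsq (psub y a) in ly s0.
pose z := inversion a l y.
have zz : 0 < nsq z.
  by apply: (@near_center_nz _ a); apply: Rle_lt_trans la; apply: inversion_near => //; apply: Rlt_le.
exists (laplacian_with D2u y + (- 1) * (Rpower (l / s) ((INR n - 2) / 2 + 2) * laplacian_with D2u z)); split; last first.
  apply: lap_plus; first exact: (lap_punct (sp_C1 su) (sp_C2 su)).
  by apply: lap_scal; exact: (kelvin_lap l0 s0 (sp_C1 su) (sp_C2 su) zz).
rewrite !eqn //.
have uz := sp_pos su zz; have vz := sp_pos sv zz.
have x0 : 0 < l / s by apply: Rdiv_lt_0_compat.
have x1 : l / s < 1 by apply/Rlt_div_l; lra.
pose k := Rpower (l / s) ((INR n - 2) / 2).
have k0 : 0 < k by exact: exp_pos.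
have h1 : nonlin q mu be (k * u z) (k * v z) <= nonlin q mu be (u y) (v y).
  apply: nonlin_le => //; try exact: Rmult_lt_0_compat.
    by apply: Hu => //; apply: Rlt_le.
  by apply: Hv => //; apply: Rlt_le.
rewrite nonlin_homogeneous // in h1.
(* [(n - 2) * q < 2] makes the exponent of [l / s] on the left the larger one, and the base is below
   1. *)
have h2 : Rpower (l / s) ((INR n - 2) / 2 + 2) < Rpower k (2 * q + 1).
  rewrite /k Rpower_mult /Rpower; apply: exp_increasing.
  have : ln (l / s) < ln 1 by apply: ln_increasing.
  rewrite ln_1; nra.
have h3 := nonlin_gt0 q (u z) (v z) mu0 be0.
have := Rmult_lt_compat_r _ _ _ h3 h2; lra.
Qed.

Section SystemSpheres.
Variables (n : nat) (q mu1 mu2 be : R) (u v : point n -> R).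
Variables (D1u D1v : 'I_n -> point n -> R) (D2u D2v : 'I_n -> 'I_n -> point n -> R).
Hypotheses (m0 : 0 < INR n - 2) (q0 : 0 < q) (mu10 : 0 < mu1) (mu20 : 0 < mu2) (be0 : 0 < be)
  (sub : (INR n - 2) * q < 2) (su : smooth_pos u D1u D2u) (sv : smooth_pos v D1v D2v)
  (equ : forall y, 0 < nsq y -> laplacian_with D2u y = - nonlin q mu1 be (u y) (v y))
  (eqv : forall y, 0 < nsq y -> laplacian_with D2v y = - nonlin q mu2 be (v y) (u y)).

(** The two components move together, since superharmonicity of either gap uses both Kelvin
    inequalities. If the supremum [L] of the admissible values were below [nsq a], closedness would
    give the inequalities at [L] and openness would carry them past it. *)
Lemma moving_spheres (a : point n) l : 0 < l -> l < nsq a -> kelvin_le u a l /\ kelvin_le v a l.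
Proof.
move=> l0 la; have a0 : 0 < nsq a by lra.
have [|d1 [d10 S1]] := moving_sphere_start m0 su a0.
  by move=> y /equ ->; have := nonlin_gt0 q (u y) (v y) mu10 be0; lra.
have [|d2 [d20 S2]] := moving_sphere_start m0 sv a0.
  by move=> y /eqv ->; have := nonlin_gt0 q (v y) (u y) mu20 be0; lra.
pose S l := [/\ 0 < l, l < nsq a & forall l', 0 < l' <= l -> kelvin_le u a l' /\ kelvin_le v a l'].
have d0 : 0 < Rmin (Rmin d1 d2) (nsq a) by do 2?apply: Rmin_glb_lt.
have [||L [L1 L2]] := completeness S.
- by exists (nsq a) => x [_ h _]; lra.
- exists (Rmin (Rmin d1 d2) (nsq a) / 2).
  have e1 := Rmin_l (Rmin d1 d2) (nsq a); have e2 := Rmin_r (Rmin d1 d2) (nsq a).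
  have e3 := Rmin_l d1 d2; have e4 := Rmin_r d1 d2.
  by split; [lra | lra | move=> l' Hl'; split; [apply: S1; lra | apply: S2; lra]].
have below l' : 0 < l' < L -> kelvin_le u a l' /\ kelvin_le v a l'.
  move=> [p1 p2]; apply: NNPP => Hn.
  suff : L <= l' by lra.
  apply: L2 => x [x0 xa Hx]; apply: Rnot_lt_le => lx; apply: Hn; apply: Hx; lra.
case: (Rlt_le_dec L (nsq a)) => La; last by apply: below; lra.
exfalso.
have L0 : 0 < L.
  have [e1 [e2 e3]] : exists x, S x /\ 0 < x.
    apply: NNPP => Hn; suff : L <= 0.
      have : 0 < Rmin (Rmin d1 d2) (nsq a) / 2 by lra.
      have e1 := Rmin_l (Rmin d1 d2) (nsq a); have e2 := Rmin_r (Rmin d1 d2) (nsq a).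
      have e3 := Rmin_l d1 d2; have e4 := Rmin_r d1 d2.
      move=> e5; case: Hn; exists (Rmin (Rmin d1 d2) (nsq a) / 2); split => //.
      by split; [lra | lra | move=> l' Hl'; split; [apply: S1; lra | apply: S2; lra]].
    by apply: L2 => x Sx; apply: Rnot_lt_le => x0; apply: Hn; exists x.
  by have := L1 _ e2; lra.
have Cu : kelvin_le u a L by apply: (moving_sphere_closed su L0 La) => l' /below [].
have Cv : kelvin_le v a L by apply: (moving_sphere_closed sv L0 La) => l' /below [].
have [e1 [e10 O1]] := moving_sphere_open m0 su L0 La Cu (kelvin_superharmonic q0 mu10 be0 sub su sv equ L0 La Cu Cv).
have [e2 [e20 O2]] := moving_sphere_open m0 sv L0 La Cv (kelvin_superharmonic q0 mu20 be0 sub sv su eqv L0 La Cv Cu).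
pose e := Rmin (Rmin e1 e2) (nsq a - L).
have e0 : 0 < e by do 2?apply: Rmin_glb_lt; lra.
have f1 : e <= nsq a - L := Rmin_r _ _.
have f2 : e <= e1 := Rle_trans _ _ _ (Rmin_l _ _) (Rmin_l _ _).
have f3 : e <= e2 := Rle_trans _ _ _ (Rmin_l _ _) (Rmin_r _ _).
suff /L1 : S (L + e / 2) by lra.
split; [lra | lra | move=> l' [p1 p2]].
case: (Rtotal_order l' L) => [h|[->|h]] //; first exact: below.
by split; [apply: O1 | apply: O2]; lra.
Qed.

End SystemSpheres.

Lemma nsq_add n (x d : point n) t : nsq (fun j => x j + t * d j) = nsq x + 2 * t * sumR (fun j => x j * d j) + t ^ 2 * nsq d.
Proof.
rewrite /nsq -!sumR_scal -!sumR_plus; apply: sumR_ext => j; ring.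
Qed.

(* The sphere centred at [x = y2 + t (y1 - y2)] whose squared radius is the power of [x] with respect to the sphere
   [nsq = nsq y1] exchanges [y1] and [y2]; the Kelvin factor tends to 1 as [t] grows. *)
Lemma radial_symmetry n (f : point n -> R) : 0 < INR n - 2 -> (forall y, 0 < nsq y -> 0 < f y) ->
  (forall a l, 0 < l -> l < nsq a -> kelvin_le f a l) ->
  forall y1 y2, 0 < nsq y1 -> nsq y1 = nsq y2 -> f y1 = f y2.
Proof.
move=> m0 fp H.
suff key y1 y2 : 0 < nsq y1 -> nsq y1 = nsq y2 -> f y1 <= f y2.
  by move=> y1 y2 h E; apply: Rle_antisym; apply: key => //; rewrite -E.
move=> h E; pose d := psub y1 y2; pose D := nsq d.
have y1E : y1 = fun j => y2 j + 1 * d j by apply: functional_extensionality => j; rewrite /d /psub; ring.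
case: (Req_dec D 0) => D0.
  apply: Req_le; congr f; rewrite y1E; apply: functional_extensionality => j.
  have := nsq_coord d j; rewrite -/D D0 => dj.
  have -> : d j = 0 by have := pow2_ge_0 (d j); nra.
  by ring.
have {D0} : 0 < D by have := nsq_ge0 d; rewrite -/D; lra.
move=> D0.
have Ed : 2 * sumR (fun j => y2 j * d j) = - D.
  by have := nsq_add y2 d 1; rewrite -y1E E -/D; lra.
have key t : 1 < t -> Rpower ((t - 1) / t) ((INR n - 2) / 2) * f y1 <= f y2.
  move=> t1; pose x : point n := fun j => y2 j + t * d j.
  have nx : nsq x = nsq y2 + (t * t - t) * D.
    have e : 2 * t * sumR (fun j => y2 j * d j) = t * (- D) by rewrite -Ed; ring.
    by rewrite nsq_add -/D e; ring.
  pose l := t * (t - 1) * D.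
  have l0 : 0 < l by do 2?apply: Rmult_lt_0_compat; lra.
  have lx : l < nsq x by rewrite nx /l -E; lra.
  have sx : nsq (psub y2 x) = t ^ 2 * D.
    have -> : psub y2 x = fun j => (- t) * d j by apply: functional_extensionality => j; rewrite /psub /x; ring.
    by rewrite nsq_scale -/D; ring.
  have ly : l <= nsq (psub y2 x) by rewrite sx /l; nra.
  have y2z : 0 < nsq y2 by rewrite -E.
  have := H x l l0 lx y2 ly y2z.
  rewrite /kelvin; have -> : inversion x l y2 = y1.
    apply: functional_extensionality => j; rewrite /inversion sx {1}y1E /x /l; field; lra.
  rewrite sx; have -> : l / (t ^ 2 * D) = (t - 1) / t by rewrite /l; field; lra.
  by [].
apply: Rnot_lt_le => bad.
have f1 := fp y1 h; have f2 : 0 < f y2 by apply: fp; rewrite -E.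
pose rho := f y2 / f y1.
have rho0 : 0 < rho by apply: Rdiv_lt_0_compat.
have rho1 : rho < 1 by apply/Rlt_div_l; lra.
have lnr : ln rho < 0 by rewrite -ln_1; apply: ln_increasing.
(* For [t = 1 / (1 - X)] the Kelvin factor is [rho^(1/2)], which exceeds [rho = f y2 / f y1]. *)
pose X := Rpower rho (/ (INR n - 2)).
have i0 : 0 < / (INR n - 2) by apply: Rinv_0_lt_compat.
have X1 : X < 1 by rewrite -exp_0 /X /Rpower; apply: exp_increasing; nra.
have X0 : 0 < X by exact: exp_pos.
have t1 : 1 < / (1 - X) by rewrite -{1}Rinv_1; apply: Rinv_lt_contravar; lra.
have := key _ t1; have -> : (/ (1 - X) - 1) / / (1 - X) = X by field; lra.
rewrite /X Rpower_mult; have -> : / (INR n - 2) * ((INR n - 2) / 2) = / 2 by field; lra.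
have r2 : rho < Rpower rho (/ 2).
  rewrite -{1}(Rpower_1 rho) // /Rpower; apply: exp_increasing; nra.
have := Rmult_lt_compat_r _ _ _ f1 r2.
have -> : rho * f y1 = f y2 by rewrite /rho; field; lra.
lra.
Qed.

(** * Reduction to the Emden-Fowler system *)

Lemma jet_unique g a b a' b' : jet g a b -> jet g a' b' -> a = a' /\ b = b'.
Proof.
move=> [g1 [A1 A2 A3]] [h1 [B1 B2 B3]].
have E : locally 0 (fun t => g1 t = h1 t).
  apply: filter_imp (filter_and _ _ A1 B1) => t [p1 p2].
  by rewrite -(is_derive_unique _ _ _ p1) -(is_derive_unique _ _ _ p2).
split; first by rewrite -A2 -B2; exact: locally_singleton E.
rewrite -(is_derive_unique _ _ _ A3); apply/esym.
rewrite -(is_derive_unique _ _ _ B3); apply: Derive_ext_loc.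
by apply: filter_imp E => t ->.
Qed.

Lemma jet_coord n (f : point n -> R) D1 D2 y i : C1_punct f D1 -> (forall i, C1_punct (D1 i) (D2 i)) ->
  0 < nsq y -> jet (fun t => f (upd y i t)) (D1 i y) (D2 i i y).
Proof.
move=> H1 H2 nz.
exists (fun t => D1 i (upd y i t)); split.
- have h : 0 < nsq (psub y (origin n)) by rewrite psub0.
  apply: filter_imp (locally_nsq_gt i h) => t; rewrite psub0 => nzt.
  by apply: line_derive; have [] := H1 _ nzt i.
- by rewrite upd0.
- by apply: line_derive; rewrite upd0; have [] := H2 i y nz i.
Qed.

Definition axis n (i0 : 'I_n) (r : R) : point n := upd (origin n) i0 r.

Lemma nsq_axis n (i0 : 'I_n) r : nsq (axis i0 r) = r ^ 2.
Proof.
rewrite nsq_upd /nsq (sumR_ext (G := fun _ => 0)); last by move=> i; rewrite /origin; ring.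
by rewrite sumR_const /origin; ring.
Qed.

Section RadialLaplacian.
Variables (n : nat) (i0 : 'I_n) (f : point n -> R) (D1 : 'I_n -> point n -> R) (D2 : 'I_n -> 'I_n -> point n -> R).
Hypotheses (H1 : C1_punct f D1) (H2 : forall i, C1_punct (D1 i) (D2 i)).

Let phi r := f (axis i0 r).
Let phi1 r := D1 i0 (axis i0 r).

Lemma axis_nz r : 0 < r -> 0 < nsq (axis i0 r).
Proof. by move=> r0; rewrite nsq_axis; exact: pow_lt. Qed.

Lemma radial_derive r : 0 < r -> is_derive phi r (phi1 r) /\ is_derive phi1 r (D2 i0 i0 (axis i0 r)).
Proof.
move=> /axis_nz nz; split; apply: line_derive.
  by have [] := H1 nz i0.
by have [] := H2 i0 nz i0.
Qed.

Hypothesis rad : forall y1 y2, 0 < nsq y1 -> nsq y1 = nsq y2 -> f y1 = f y2.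

(** A step [t] along another axis changes the radius to [sqrt (r ^ 2 + t ^ 2)]; by radial symmetry
    the second derivative at 0 comes out as [phi1 r / r], and [jet_unique] identifies it with
    [D2 i i]. *)
Lemma radial_tangential r i : 0 < r -> i != i0 -> D2 i i (axis i0 r) = phi1 r / r.
Proof.
move=> r0 ne; have nz := axis_nz r0.
have J := jet_coord i H1 H2 nz.
have pos t : 0 < r ^ 2 + t ^ 2 by have := pow_lt r 2 r0; have := pow2_ge_0 t; lra.
have sp t : 0 < sqrt (r ^ 2 + t ^ 2) by exact: sqrt_lt_R0.
have E t : f (upd (axis i0 r) i t) = phi (sqrt (r ^ 2 + t ^ 2)).
  have Es : nsq (upd (axis i0 r) i t) = r ^ 2 + t ^ 2.
    rewrite nsq_upd nsq_axis /axis {1}/upd (negbTE ne) /origin; ring.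
  apply: rad; first by rewrite Es.
  by rewrite Es nsq_axis -[RHS]Rsqr_pow2 Rsqr_sqrt //; apply: Rlt_le.
have d t : is_derive (fun t => sqrt (r ^ 2 + t ^ 2)) t (t / sqrt (r ^ 2 + t ^ 2)).
  auto_derive; first by have := pos t; rewrite /= !Rmult_1_r.
  rewrite /= !Rmult_1_r; field; have := sp t; rewrite /= !Rmult_1_r; lra.
have s0 : sqrt (r ^ 2 + 0 ^ 2) = r by rewrite (_ : r ^ 2 + 0 ^ 2 = r * r) ?sqrt_square; [lra | lra | ring].
have J' : jet (fun t => f (upd (axis i0 r) i t)) 0 (phi1 r / r).
  apply: (jet_ext (g := fun t => phi (sqrt (r ^ 2 + t ^ 2)))); first by move=> t; rewrite E.
  exists (fun t => t / sqrt (r ^ 2 + t ^ 2) * phi1 (sqrt (r ^ 2 + t ^ 2))); split.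
  - apply: filter_forall => t; have [h _] := radial_derive (sp t).
    exact: (is_derive_comp phi (fun t => sqrt (r ^ 2 + t ^ 2)) t _ _ h (d t)).
  - by rewrite /Rdiv Rmult_0_l Rmult_0_l.
  - have [_ h] := radial_derive r0; rewrite -s0 in h.
    evar_last.
      apply: is_derive_prod.
        by apply: is_derive_div; [exact: is_derive_id | exact: d | rewrite s0; lra].
      exact: (is_derive_comp phi1 (fun t => sqrt (r ^ 2 + t ^ 2)) 0 _ _ h (d 0)).
    by rewrite !s0 /one /scal /= /mult /=; field; lra.
by have [_] := jet_unique J J'.
Qed.

Lemma radial_laplacian r : 0 < r ->
  laplacian_with D2 (axis i0 r) = D2 i0 i0 (axis i0 r) + (INR n - 1) * (phi1 r / r).
Proof.
move=> r0; rewrite /laplacian_with.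
rewrite (sumR_ext (G := fun i => (if i == i0 then 1 else 0) * (D2 i i (axis i0 r) - phi1 r / r) + phi1 r / r)).
  by rewrite sumR_plus sumR_delta sumR_const; ring.
move=> i; case: eqP => [->|/eqP ne]; first by ring.
by rewrite radial_tangential //; ring.
Qed.

End RadialLaplacian.

(** Because [al * q = 1], the nonlinearity picks up [exp (al * t) * exp t ^ 2], the same factor as
    the radial Laplacian; this is why the resulting system is autonomous. *)
Lemma emden_fowler_change (N al q mu be : R) (phi phi1 psi : R -> R) (phi2 : R -> R) t :
  al * q = 1 -> 0 < phi (exp t) -> 0 < psi (exp t) ->
  is_derive phi (exp t) (phi1 (exp t)) -> is_derive phi1 (exp t) (phi2 (exp t)) ->
  phi2 (exp t) + (N + 1) * (phi1 (exp t) / exp t) = - nonlin q mu be (phi (exp t)) (psi (exp t)) ->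
  let U t := exp (al * t) * phi (exp t) in
  let V t := exp (al * t) * psi (exp t) in
  let U1 t := exp (al * t) * (al * phi (exp t) + exp t * phi1 (exp t)) in
  is_derive U t (U1 t) /\
  is_derive U1 t ((2 * al - N) * U1 t + al * (N - al) * U t - nonlin q mu be (U t) (V t)).
Proof.
move=> aq p0 ps0 d1 d2 eqn U V U1.
have e0 := exp_pos t.
have c1 : is_derive (fun t => phi (exp t)) t (exp t * phi1 (exp t)).
  by apply: (is_derive_comp phi exp); [exact: d1 | exact: is_derive_exp].
have c2 : is_derive (fun t => phi1 (exp t)) t (exp t * phi2 (exp t)).
  by apply: (is_derive_comp phi1 exp); [exact: d2 | exact: is_derive_exp].
split.
  evar_last; first by apply: is_derive_prod; [exact: is_derive_exp_scal | exact: c1].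
  by rewrite /U1; ring.
evar_last.
  apply: is_derive_prod; first exact: is_derive_exp_scal.
  apply: is_derive_plus; first by apply: is_derive_scal; exact: c1.
  by apply: is_derive_prod; [exact: is_derive_exp | exact: c2].
rewrite /plus /= nonlin_homogeneous //; last exact: exp_pos.
have -> : Rpower (exp (al * t)) (2 * q + 1) = exp (al * t) * (exp t * exp t).
  rewrite /Rpower ln_exp -!exp_plus; congr exp.
  have -> : (2 * q + 1) * (al * t) = 2 * (al * q) * t + al * t by ring.
  by rewrite aq; ring.
have -> : nonlin q mu be (phi (exp t)) (psi (exp t)) = - (phi2 (exp t) + (N + 1) * (phi1 (exp t) / exp t)).
  by rewrite eqn; ring.
by rewrite /U1 /U; field; lra.
Qed.

Lemma smooth_pos_of_C2 n (f : point n -> R) D1 D2 : C2_punct_with f D1 D2 ->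
  (forall x, norm x <> 0 -> 0 < f x) -> smooth_pos f D1 D2.
Proof.
move=> H P; split.
- move=> z /norm_nz /H [_ /(_ _)] K i; have [A [B _]] := K i; split => //; exact: cont_at_seq.
- move=> i z /norm_nz /H [_ K] j; have [_ [_ /(_ j) [A B]]] := K i; split => //; exact: cont_at_seq.
- by move=> y /norm_nz /H [K _]; exact: cont_at_seq.
- by move=> y /norm_nz; exact: P.
Qed.

(** Equal to [/ q] for [q > 0], but written as [2 / (p - 1)] with [p = 2 * q + 1], so that it agrees
    with the exponent of the theorem by unfolding. *)
Definition decay_exponent (q : R) : R := 2 / (2 * q + 1 - 1).

Lemma exponent_facts n q : (3 <= n)%nat -> INR n / (INR n - 2) < 2 * q + 1 -> 2 * q + 1 < (INR n + 2) / (INR n - 2) ->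
  [/\ 0 < INR n - 2, 0 < q & (INR n - 2) * q < 2] /\
  [/\ 0 < decay_exponent q, decay_exponent q < INR n - 2, INR n - 2 < 2 * decay_exponent q & decay_exponent q * q = 1].
Proof.
move=> n3 h1 h2.
have n3' : INR 3 <= INR n by apply: le_INR; apply/leP.
have m0 : 0 < INR n - 2 by move: n3'; rewrite /=; lra.
have e1 : INR n < (2 * q + 1) * (INR n - 2) by apply/Rlt_div_l.
have e2 : (2 * q + 1) * (INR n - 2) < INR n + 2 by apply/Rlt_div_r.
have q0 : 0 < q by nra.
have E : decay_exponent q = / q by rewrite /decay_exponent; field; lra.
rewrite E; do 2?split; try lra; try nra.
- exact: Rinv_0_lt_compat.
- by rewrite -(Rmult_1_l (/ q)); apply/Rlt_div_l; lra.
- by have : INR n - 2 < 2 / q; [apply/Rlt_div_r; lra | rewrite /Rdiv].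
- by field; lra.
Qed.

Lemma radial_emden_fowler n q mu1 mu2 be (u v : point n -> R) :
  (3 <= n)%nat -> 0 < mu1 -> 0 < mu2 -> 0 < be ->
  INR n / (INR n - 2) < 2 * q + 1 -> 2 * q + 1 < (INR n + 2) / (INR n - 2) ->
  pos_solution q mu1 mu2 be u v ->
  exists U U1 V V1, emden_fowler (INR n - 2) (decay_exponent q) q mu1 mu2 be U U1 V V1 /\
    forall x, 0 < norm x ->
      u x = Rpower (norm x) (- decay_exponent q) * U (ln (norm x)) /\
      v x = Rpower (norm x) (- decay_exponent q) * V (ln (norm x)).
Proof.
move=> n3 mu10 mu20 be0 h1 h2 [D1u [D2u [D1v [D2v [Cu [Cv eqn]]]]]].
have [[m0 q0 mq] [al0 aln nal alq]] := exponent_facts n3 h1 h2.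
set al := decay_exponent q in al0 aln nal alq *.
have su : smooth_pos u D1u D2u by apply: smooth_pos_of_C2 => // x /eqn [].
have sv : smooth_pos v D1v D2v by apply: smooth_pos_of_C2 => // x /eqn [_ []].
have equ y : 0 < nsq y -> laplacian_with D2u y = - nonlin q mu1 be (u y) (v y).
  by move=> /norm_nz /eqn [_ [_ [E _]]]; rewrite /nonlin -E; ring.
have eqv y : 0 < nsq y -> laplacian_with D2v y = - nonlin q mu2 be (v y) (u y).
  by move=> /norm_nz /eqn [_ [_ [_ E]]]; rewrite /nonlin -E; ring.
have MS a l l0 la := moving_spheres m0 q0 mu10 mu20 be0 mq su sv equ eqv (a := a) (l := l) l0 la.
have ru := radial_symmetry m0 (sp_pos su) (fun a l l0 la => proj1 (MS a l l0 la)).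
have rv := radial_symmetry m0 (sp_pos sv) (fun a l l0 la => proj2 (MS a l l0 la)).
have n0 : (0 < n)%nat by apply: leq_trans n3.
pose i0 := Ordinal n0.
have nz t : 0 < nsq (axis i0 (exp t)) by apply: axis_nz; exact: exp_pos.
have mn : INR n - 1 = INR n - 2 + 1 by ring.
have ou t := emden_fowler_change (N := INR n - 2) (al := al) (q := q) (mu := mu1) (be := be)
  (phi := fun r => u (axis i0 r)) (phi1 := fun r => D1u i0 (axis i0 r)) (psi := fun r => v (axis i0 r))
  (phi2 := fun r => D2u i0 i0 (axis i0 r)) (t := t) alq (sp_pos su (nz t)) (sp_pos sv (nz t))
  (proj1 (radial_derive i0 (sp_C1 su) (sp_C2 su) (exp_pos t))) (proj2 (radial_derive i0 (sp_C1 su) (sp_C2 su) (exp_pos t))).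
have ov t := emden_fowler_change (N := INR n - 2) (al := al) (q := q) (mu := mu2) (be := be)
  (phi := fun r => v (axis i0 r)) (phi1 := fun r => D1v i0 (axis i0 r)) (psi := fun r => u (axis i0 r))
  (phi2 := fun r => D2v i0 i0 (axis i0 r)) (t := t) alq (sp_pos sv (nz t)) (sp_pos su (nz t))
  (proj1 (radial_derive i0 (sp_C1 sv) (sp_C2 sv) (exp_pos t))) (proj2 (radial_derive i0 (sp_C1 sv) (sp_C2 sv) (exp_pos t))).
exists (fun t => exp (al * t) * u (axis i0 (exp t))),
  (fun t => exp (al * t) * (al * u (axis i0 (exp t)) + exp t * D1u i0 (axis i0 (exp t)))),
  (fun t => exp (al * t) * v (axis i0 (exp t))),
  (fun t => exp (al * t) * (al * v (axis i0 (exp t)) + exp t * D1v i0 (axis i0 (exp t)))).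
split; first split => //.
- move=> t; split.
    exact: Rmult_lt_0_compat (exp_pos _) (sp_pos su (nz t)).
  exact: Rmult_lt_0_compat (exp_pos _) (sp_pos sv (nz t)).
- move=> t; apply: ou; rewrite -mn -equ //.
  by rewrite (radial_laplacian i0 (sp_C1 su) (sp_C2 su) ru) //; exact: exp_pos.
- move=> t; apply: ov; rewrite -mn -eqv //.
  by rewrite (radial_laplacian i0 (sp_C1 sv) (sp_C2 sv) rv) //; exact: exp_pos.
move=> x x0.
have E (f : point n -> R) : (forall y1 y2, 0 < nsq y1 -> nsq y1 = nsq y2 -> f y1 = f y2) ->
   f x = Rpower (norm x) (- al) * (exp (al * ln (norm x)) * f (axis i0 (exp (ln (norm x))))).
  move=> rf; rewrite -Rmult_assoc -exp_plus (_ : - al * ln (norm x) + al * ln (norm x) = 0); last ring.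
  rewrite exp_0 Rmult_1_l; apply: rf; first by apply/norm_nz; lra.
  by rewrite nsq_axis exp_ln // /= Rmult_1_r norm_sq.
by split; apply: E.
Qed.

Lemma exponent_high_dim n q : (4 <= n)%nat -> 2 * q + 1 < (INR n + 2) / (INR n - 2) -> q < 1.
Proof.
move=> n4 h; have n4' : INR 4 <= INR n by apply: le_INR; apply/leP.
move: n4'; rewrite /= => n4'.
have m0 : 0 < INR n - 2 by lra.
move/(Rlt_div_r _ _ _ m0) in h; nra.
Qed.

Lemma exponent_dim3 q : INR 3 / (INR 3 - 2) < 2 * q + 1 -> 1 < q.
Proof.
rewrite /=; have -> : (1 + 1 + 1) / (1 + 1 + 1 - 2) = 3 by field.
by move=> ?; lra.
Qed.

Lemma exists_norm n r : (0 < n)%nat -> 0 < r -> exists x : point n, norm x = r.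
Proof.
move=> n0 r0; exists (axis (Ordinal n0) r).
have := nsq_axis (Ordinal n0) r; rewrite /norm -/(nsq (axis _ r)) => ->.
by rewrite /= Rmult_1_r sqrt_square; lra.
Qed.

(** * Back to the solution in space *)

Section Transfer.
Variables (n : nat) (q mu1 mu2 be : R) (u v : point n -> R) (U U1 V V1 : R -> R).
Let al := decay_exponent q.
Let N := INR n - 2.
Hypotheses (n0 : (0 < n)%nat) (ef : emden_fowler N al q mu1 mu2 be U U1 V V1).
Hypothesis tr : forall x, 0 < norm x -> u x = Rpower (norm x) (- al) * U (ln (norm x)) /\
      v x = Rpower (norm x) (- al) * V (ln (norm x)).

(** Every large [t] is realized by a point of norm [exp t], so the pointwise bounds become
    [U t <= C * exp (- (N - al) * t)] and [C1 <= V t]. As [al < N], [U] tends to 0 while [V] does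
    not, which [ef_no_semi] forbids. *)
Lemma semi_sing_low_exponent : q < 1 -> ~ semi_sing_pair (2 * q + 1) u v.
Proof.
move=> q1 [C [C1 [C2 [R0 [C0 [C10 [_ H]]]]]]].
have [[al0 alN _] _ P _ _] := ef.
pose T := ln (Rmax R0 1).
have bound t : T <= t -> U t <= C * exp (- (N - al) * t) /\ C1 <= V t.
  move=> Tt; have [x nx] := @exists_norm n (exp t) n0 (exp_pos t).
  have Rx : R0 <= norm x.
    rewrite nx; apply: Rle_trans (Rmax_l R0 1) _.
    rewrite -(exp_ln (Rmax R0 1)); last by have := Rmax_r R0 1; lra.
    by case: Tt => [h|<-]; [apply/Rlt_le/exp_increasing | apply: Rle_refl].
  have x0 : 0 < norm x by rewrite nx; exact: exp_pos.
  have [A [B _]] := H x Rx; have [Eu Ev] := tr x0.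
  have r0 := exp_pos (- al * ln (norm x)); rewrite -/(Rpower _ _) in r0.
  have lnx : ln (norm x) = t by rewrite nx ln_exp.
  split; last first.
    apply: (Rmult_le_reg_l _ _ _ r0); rewrite -lnx -Ev.
    by rewrite Rmult_comm; exact: B.
  apply: (Rmult_le_reg_l _ _ _ r0); rewrite -lnx -Eu; apply: Rle_trans A _.
  apply: Req_le; rewrite /Rpower lnx -/N.
  have -> : exp (- al * t) * (C * exp (- (N - al) * t)) = C * (exp (- al * t) * exp (- (N - al) * t)) by ring.
  by rewrite -exp_plus; congr (_ * exp _); ring.
have U0 : tends0 U.
  move=> e e0; have Na : 0 < N - al by lra.
  have [S HS] := tends0_scal C (tends0_exp Na) e0.
  exists (Rmax T S) => t Ht.
  have [h _] := bound t (Rle_trans _ _ _ (Rmax_l _ _) Ht).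
  have := HS t (Rle_trans _ _ _ (Rmax_r _ _) Ht) => /Rabs_def2 [h2 _].
  by have [Up _] := P t; apply: Rabs_def1; lra.
by apply: (ef_no_semi ef q1 C10 U0 (T := T)) => t /bound [].
Qed.

Lemma semi_sing_of_semi C c T : 0 < C -> 0 < c ->
  (forall t, T <= t -> U t <= C * exp (- (N - al) * t) /\ c < V t) -> semi_sing_pair (2 * q + 1) u v.
Proof.
move=> C0 c0 H.
have [M [M1 HM]] := ef_bound ef.
exists C, c, M, (exp (Rmax T 0)); do 3?split; try lra.
move=> x Hx.
have x0 : 0 < norm x by have := exp_pos (Rmax T 0); lra.
have lx : Rmax T 0 <= ln (norm x).
  rewrite -(ln_exp (Rmax T 0)); apply: ln_le => //; exact: exp_pos.
have [Eu Ev] := tr x0.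
have [A B] := H (ln (norm x)) (Rle_trans _ _ _ (Rmax_l _ _) lx).
have [_ D] := HM (ln (norm x)) (Rle_trans _ _ _ (Rmax_r _ _) lx).
have r0 := exp_pos (- al * ln (norm x)); rewrite -/(Rpower _ _) in r0.
rewrite Eu Ev -/(decay_exponent q) -/al; split; last by split; nra.
apply: Rle_trans (Rmult_le_compat_l _ _ _ (Rlt_le _ _ r0) A) _.
apply: Req_le; rewrite /Rpower -/N.
have -> : exp (- al * ln (norm x)) * (C * exp (- (N - al) * ln (norm x))) =
  C * (exp (- al * ln (norm x)) * exp (- (N - al) * ln (norm x))) by ring.
by rewrite -exp_plus; congr (_ * exp _); ring.
Qed.

Lemma fast_decay C T : 0 < C ->
  (forall t, T <= t -> U t <= C * exp (- (N - al) * t) /\ V t <= C * exp (- (N - al) * t)) ->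
  exists C3, 0 < C3 /\ forall x, 1 <= norm x ->
    u x <= C3 * Rpower (norm x) (- N) /\ v x <= C3 * Rpower (norm x) (- N).
Proof.
move=> C0 H.
have [[al0 alN _] _ P _ _] := ef.
have [M [M1 HM]] := ef_bound ef.
(* The second summand covers the times between 0 and [T], where only the bound [M] is available. *)
pose C3 := C + M * exp ((N - al) * Rmax T 0).
have E0 := exp_pos ((N - al) * Rmax T 0).
have ME : 0 < M * exp ((N - al) * Rmax T 0) by apply: Rmult_lt_0_compat; lra.
have C30 : 0 < C3 by rewrite /C3; lra.
have bound t : 0 <= t -> U t <= C3 * exp (- (N - al) * t) /\ V t <= C3 * exp (- (N - al) * t).
  move=> t0; have e := exp_pos (- (N - al) * t).
  case: (Rle_lt_dec T t) => Tt.
    have [A B] := H t Tt.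
    have : C * exp (- (N - al) * t) <= C3 * exp (- (N - al) * t).
      by apply: Rmult_le_compat_r; [lra | rewrite /C3; nra].
    by move=> h; split; lra.
  have [A B] := HM t t0.
  have h1 : 1 <= exp ((N - al) * Rmax T 0) * exp (- (N - al) * t).
    rewrite -exp_plus -exp_0; have tm : t <= Rmax T 0 by have := Rmax_l T 0; lra.
    have : 0 <= (N - al) * Rmax T 0 + - (N - al) * t by nra.
    by case=> [h|<-]; [apply/Rlt_le/exp_increasing | apply: Rle_refl].
  have h2 : M <= C3 * exp (- (N - al) * t).
    have := Rmult_le_compat_l M _ _ ltac:(lra) h1.
    have : 0 <= C * exp (- (N - al) * t) by nra.
    by rewrite /C3; lra.
  by split; lra.
exists C3; split => // x x1.
have x0 : 0 < norm x by lra.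
have [Eu Ev] := tr x0.
have lx : 0 <= ln (norm x) by rewrite -ln_1; apply: ln_le; lra.
have [A B] := bound _ lx.
have r0 := exp_pos (- al * ln (norm x)); rewrite -/(Rpower _ _) in r0.
have E : Rpower (norm x) (- al) * (C3 * exp (- (N - al) * ln (norm x))) = C3 * Rpower (norm x) (- N).
  rewrite /Rpower (_ : exp (- al * ln (norm x)) * (C3 * exp (- (N - al) * ln (norm x))) =
    C3 * (exp (- al * ln (norm x)) * exp (- (N - al) * ln (norm x)))); last by ring.
  by rewrite -exp_plus; congr (_ * exp _); ring.
by rewrite Eu Ev -E; split; apply: Rmult_le_compat_l; lra.
Qed.

(** On the compact interval that remains, a positive continuous function has a positive minimum. *)
Lemma lower_bound_half_line (f : R -> R) c T : (forall t, continuity_pt f t) -> (forall t, 0 < f t) -> 0 < c ->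
  (forall t, T <= t -> c < f t) -> exists c', 0 < c' /\ forall t, 0 <= t -> c' <= f t.
Proof.
move=> cf fp c0 H.
have [|t _|m [Hm _]] := continuity_ab_min f 0 (Rmax T 0); [exact: Rmax_r | exact: cf |].
exists (Rmin c (f m)); split; first exact: Rmin_glb_lt.
move=> t t0; case: (Rle_lt_dec T t) => Tt.
  by have := H t Tt; have := Rmin_l c (f m); lra.
apply: Rle_trans (Rmin_r _ _) _; apply: Hm; have := Rmax_l T 0; lra.
Qed.

Lemma slow_decay c T : 0 < c -> (forall t, T <= t -> c < U t /\ c < V t) ->
  exists C1 C2, 0 < C1 /\ C1 <= C2 /\ forall x, 1 <= norm x ->
    C1 * Rpower (norm x) (- al) <= u x /\ u x <= C2 * Rpower (norm x) (- al) /\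
    C1 * Rpower (norm x) (- al) <= v x /\ v x <= C2 * Rpower (norm x) (- al).
Proof.
move=> c0 H.
have [_ _ P _ _] := ef.
have [M [M1 HM]] := ef_bound ef.
have [||a [a0 Ha]] := @lower_bound_half_line U c T (fun t => proj1 (ef_continuous ef t)) _ c0.
- by move=> t; case: (P t).
- by move=> t /H [].
have [||b [b0 Hb]] := @lower_bound_half_line V c T (fun t => proj2 (ef_continuous ef t)) _ c0.
- by move=> t; case: (P t).
- by move=> t /H [].
have ab0 : 0 < Rmin a b by apply: Rmin_glb_lt.
have la := Rmin_l a b; have lb := Rmin_r a b.
exists (Rmin a b), M; split => //; split.
  by have [h _] := HM 0 (Rle_refl 0); have := Ha 0 (Rle_refl 0); lra.
move=> x x1.
have x0 : 0 < norm x by lra.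
have [Eu Ev] := tr x0.
have lx : 0 <= ln (norm x) by rewrite -ln_1; apply: ln_le; lra.
have [A B] := HM _ lx; have A' := Ha _ lx; have B' := Hb _ lx.
have r0 := exp_pos (- al * ln (norm x)); rewrite -/(Rpower _ _) in r0.
by rewrite Eu Ev !(Rmult_comm _ (Rpower (norm x) (- al))); do 3?split; apply: Rmult_le_compat_l; lra.
Qed.

End Transfer.

Unset Implicit Arguments.

Theorem theorem1p2 (n : nat) (mu1 mu2 beta q : R) :
  (3 <= n)%nat -> 0 < mu1 -> 0 < mu2 -> 0 < beta ->
  INR n / (INR n - 2) < 2 * q + 1 -> 2 * q + 1 < (INR n + 2) / (INR n - 2) ->
  ((4 <= n)%nat ->
     forall u v : point n -> R, pos_solution q mu1 mu2 beta u v ->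
       ~ semi_singular_at_infty (2 * q + 1) u v) /\
  ((4 <= n)%nat \/
     (n = 3%nat /\ forall u v : point n -> R, pos_solution q mu1 mu2 beta u v ->
        ~ semi_singular_at_infty (2 * q + 1) u v) ->
   forall u v : point n -> R, pos_solution q mu1 mu2 beta u v ->
     (exists C3, 0 < C3 /\ forall x, 1 <= norm x ->
        u x <= C3 * Rpower (norm x) (- (INR n - 2)) /\
        v x <= C3 * Rpower (norm x) (- (INR n - 2))) \/
     (exists C1 C2, 0 < C1 /\ C1 <= C2 /\ forall x, 1 <= norm x ->
        C1 * Rpower (norm x) (- (2 / (2 * q + 1 - 1))) <= u x /\
        u x <= C2 * Rpower (norm x) (- (2 / (2 * q + 1 - 1))) /\
        C1 * Rpower (norm x) (- (2 / (2 * q + 1 - 1))) <= v x /\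
        v x <= C2 * Rpower (norm x) (- (2 / (2 * q + 1 - 1))))).
Proof.
move=> n3 m1 m2 b0 h1 h2.
have n0 : (0 < n)%nat by apply: leq_trans n3.
have part3 : (4 <= n)%nat -> forall u v : point n -> R, pos_solution q mu1 mu2 beta u v ->
    ~ semi_singular_at_infty (2 * q + 1) u v.
  move=> n4 u v sol.
  have [U [U1 [V [V1 [ef tr]]]]] := radial_emden_fowler n3 m1 m2 b0 h1 h2 sol.
  have q1 := exponent_high_dim n4 h2.
  case; first exact: semi_sing_low_exponent n0 ef tr q1.
  apply: (semi_sing_low_exponent n0 (emden_fowler_sym ef) _ q1) => x /tr; tauto.
split => // hyp u v sol.
have nosemi : ~ semi_singular_at_infty (2 * q + 1) u v.
  by case: hyp => [n4|[_ h]]; [exact: part3 | exact: h].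
(* From dimension 4 on, [q < 2 / (n - 2) <= 1]; in dimension 3 the lower bound reads [p > 3], that
   is [q > 1]. *)
have q1 : q <> 1.
  case: hyp => [n4|[E _]]; first by have := exponent_high_dim n4 h2; lra.
  by rewrite E in h1; have := exponent_dim3 h1; lra.
have [U [U1 [V [V1 [ef tr]]]]] := radial_emden_fowler n3 m1 m2 b0 h1 h2 sol.
have tr' x : 0 < norm x -> v x = Rpower (norm x) (- decay_exponent q) * V (ln (norm x)) /\
      u x = Rpower (norm x) (- decay_exponent q) * U (ln (norm x)) by move/tr; tauto.
case: (ef_alternatives ef q1).
- by move=> [C [T [C0 H]]]; left; exact: (fast_decay ef tr C0 H).
- by move=> [c [T [c0 H]]]; right; exact: (slow_decay ef tr c0 H).
- by move=> [C [c [T [C0 c0 H]]]]; case: nosemi; left; exact: (semi_sing_of_semi ef tr C0 c0 H).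
- by move=> [C [c [T [C0 c0 H]]]]; case: nosemi; right; exact: (semi_sing_of_semi (emden_fowler_sym ef) tr' C0 c0 H).
Qed.
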